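(* In the setting described in the context, assume that for each $\omega'\in K$ there is an $\omega\in H$ such that $\kappa(\mathcal{C}(\omega))=\omega'$ and $c_\omega\neq 0$. Then the rank of the Cartier operator $\mathcal{C}$ on $H^0(Y_2,\Omega^1_{Y_2})$ satisfies $\operatorname{rk}(\mathcal{C})\geq \# K$.
   Context: Let $p>2$ be prime, $k$ algebraically closed of characteristic $p$, $x$ a coordinate on $\mathbb{P}^1_k$. Let $f,h\in k(x)$ and $g(T)=\sum_{i=1}^{p-1}(-1)^i\frac{(p-1)!}{i!(p-i)!}T^{p(p-i)+i}$. Let $Y_1: y_1^p-y_1=f(x)$ and $Y_2: y_2^p-y_2=g(y_1)+h(x)$ (smooth projective models); $Y_2\to Y_1\to\mathbb{P}^1$ is the $\mathbb{Z}/p^2\mathbb{Z}$-cover attached to the Witt vector $(f,h)$, assumed reduced (no term in the partial fraction decompositions of $f,h$ has degree divisible by $p$) and minimal. Standing normalizations: $B_1$ is the set of poles of $f$ and $\infty\in B_1$; $x_\infty=x$, $x_P=(x-P)^{-1}$ for $P\ne\infty$; $f=\sum_{P\in B_1}f_P(x_P)$ with $f_P\in k[x_P]$ of degree $d_P$, $d_P\mid p-1$, leading coefficient $u_P\in k^\times$, $u_\infty=1$; for $P\in B_1$, $\operatorname{ord}_P(h)>-pd_P$. $B_2\supseteq B_1$ is the branch locus of $Y_2\to\mathbb{P}^1$; for $P\in B_2\setminus B_1$, $f$ is regular at $P$ and $h$ has a pole of order $e_P\mid p-1$ at $P$. Put $\gamma_P=(p-1)/d_P$, $\delta_P=(p-1)/e_P$,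 $\epsilon_\infty=-1$, $\epsilon_P=1$ for $P\ne\infty$. Basis: $W_\infty=\{y_2^{a_2}y_1^{a_1}x^v dx: 0\le a_1,a_2<p,\ 0\le p^2v\le pd_\infty(p-1-a_1)+d_\infty(p^2-p+1)(p-1-a_2)-p^2-1\}$; for $P\in B_1\setminus\{\infty\}$, $W_P=\{y_2^{a_2}y_1^{a_1}x_P^v dx: 0\le a_i<p,\ 0<p^2v\le pd_P(p-1-a_1)+d_P(p^2-p+1)(p-1-a_2)+p^2-1\}$; for $P\in B_2\setminus B_1$, $W_P=\{y_2^{a_2}y_1^{a_1}x_P^vdx: 0\le a_i<p,\ 0<pv\le e_P(p-1-a_2)+p-1\}$. $W=\bigcup_{P\in B_2}W_P$ is a basis of $H^0(Y_2,\Omega^1_{Y_2})$. Key terms: for $P\in B_1$, $\alpha_P(v)=\lfloor\gamma_P(v-\epsilon_P)/p\rfloor$, $\beta_P(v)=\gamma_P(v-\epsilon_P)-p\alpha_P(v)$, $H_P=\{y_2^{a_2}y_1^{a_1}x_P^vdx\in W_P:\beta_P(v)\le a_1+pa_2\}$, and for $\omega$ in it $\kappa(\mathcal{C}(\omega))=y_2^{a_2}y_1^{a_1-\beta_P(v)}x_P^{v-d_P\alpha_P(v)}dx$ if $a_1\ge\beta_P(v)$, and $=y_2^{a_2-1}y_1^{a_1-\beta_P(v)+p}x_P^{v-d_P\alpha_P(v)}dx$ if $a_1<\beta_P(v)$. For $P\in B_2\setminus B_1$, $\alpha_P(v)=\lfloor\delta_P(v-1)/p\rfloor$, $\beta_P(v)=\delta_P(v-1)-p\alpha_P(v)$,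 $H_P=\{y_2^{a_2}y_1^{a_1}x_P^vdx\in W_P:\beta_P(v)\le a_2\}$, $\kappa(\mathcal{C}(\omega))=y_2^{a_2-\beta_P(v)}y_1^{a_1}x_P^{v-e_P\alpha_P(v)}dx$. $H=\bigcup_P H_P$, $K=\{\kappa(\mathcal{C}(\omega)):\omega\in H\}$ (these lie in $W$). $\mathcal{C}$ is the $p^{-1}$-linear Cartier operator, and for $\omega\in H$, $c_\omega$ is the coefficient of $\kappa(\mathcal{C}(\omega))$ when $\mathcal{C}(\omega)$ is expanded in the basis $W$. *)

(* Defs.v *)
From HB Require Import structures.
From mathcomp Require Import all_boot all_order all_algebra all_field.
From mathcomp Require Import zify.

Set Implicit Arguments.
Unset Strict Implicit.
Unset Printing Implicit Defensive.

Import Order.TTheory GRing.Theory Num.Theory.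
Local Open Scope ring_scope.

(* Points of P^1_k: [Some c] is the point x = c and [None] is infinity. *)

Definition ratX (k : closedFieldType) : {fraction {poly k}} := tofrac 'X.

Definition local_coord (k : closedFieldType) (P : option k) :
    {fraction {poly k}} :=
  if P is Some c then (tofrac ('X - c%:P))^-1 else ratX k.

(* [polar P] is the polynomial q_P in the decomposition \sum_P q_P(x_P); its
   degree is the order of the pole at P of the sum. *)
Definition partial_fractions (k : closedFieldType) (B : seq (option k))
    (polar : option k -> {poly k}) : {fraction {poly k}} :=
  \sum_(P <- B) (map_poly (fun c => tofrac c%:P) (polar P)).[local_coord P].

(* The Witt vector (f, h), given by the partial fraction decompositions of f
   over B1 and of h over B2. *)
Record witt_data (k : closedFieldType) := WittData {
  B1 : seq (option k);
  B2 : seq (option k);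
  f_part : option k -> {poly k};
  h_part : option k -> {poly k} }.

Definition f_of (k : closedFieldType) (X : witt_data k) := partial_fractions (B1 X) (f_part X).
Definition h_of (k : closedFieldType) (X : witt_data k) := partial_fractions (B2 X) (h_part X).

Definition d_ (k : closedFieldType) (X : witt_data k) (P : option k) : nat :=
  (size (f_part X P)).-1.
Definition e_ (k : closedFieldType) (X : witt_data k) (P : option k) : nat :=
  (size (h_part X P)).-1.

(* Constant terms are not poles, and are left unconstrained. *)
Definition reduced_poly (k : closedFieldType) (p : nat) (q : {poly k}) : Prop :=
  forall i, (0 < i)%N -> (p %| i)%N -> q`_i = 0.

(* As p > 1, the conditions d_P | p - 1 and e_P | p - 1 force d_P, e_P > 0, so
   that B1 is exactly the set of poles of f, and B2 \ B1 consists of poles of h.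
   [nd_min] says that ord_P(h) > - p d_P. *)
Record normalized_data (p : nat) (k : closedFieldType) (X : witt_data k) : Prop := NormalizedData {
  nd_uniq1 : uniq (B1 X);
  nd_uniq2 : uniq (B2 X);
  nd_sub : {subset B1 X <= B2 X};
  nd_infty : None \in B1 X;
  nd_monic : lead_coef (f_part X None) = 1;
  nd_fdeg : forall P, P \in B1 X -> (d_ X P %| p.-1)%N;
  nd_min : forall P, P \in B1 X -> (e_ X P < p * d_ X P)%N;
  nd_hdeg : forall P, P \in B2 X -> P \notin B1 X -> (e_ X P %| p.-1)%N;
  nd_fred : forall P, P \in B1 X -> reduced_poly p (f_part X P);
  nd_hred : forall P, P \in B2 X -> reduced_poly p (h_part X P) }.

(* The function field L = k(x)(y1, y2) of Y_2. *)

Definition witt_g (F : fieldType) (p : nat) (T : F) : F :=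
  \sum_(1 <= i < p)
    (-1) ^+ i * ((p.-1)`!%:R / (i`!%:R * (p - i)`!%:R))
    * T ^+ (p * (p - i) + i).

Record function_field (p : nat) (k : closedFieldType) (X : witt_data k)
    (L : fieldExtType {fraction {poly k}}) (y1 y2 : L) : Prop := FunctionField {
  ff_y1 : y1 ^+ p - y1 = (f_of X)%:A;
  ff_y2 : y2 ^+ p - y2 = witt_g p y1 + (h_of X)%:A;
  ff_gen : (<<<<1; y1>>; y2>> = fullv)%VS }.

Section FunctionField.
Variables (k : closedFieldType) (L : fieldExtType {fraction {poly k}}).

Definition constL (c : k) : L := (tofrac c%:P)%:A.

(* As L is separable over k(x), the space of Kahler differentials of L over k is
   the line L.dx; the differential g dx is represented by its coefficient g. If
   D is the extension of d/dx to L, then du is represented by D u. *)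
Record is_ddx (D : L -> L) : Prop := IsDdx {
  ddxD : forall a b, D (a + b) = D a + D b;
  ddxM : forall a b, D (a * b) = D a * b + a * D b;
  ddxC : forall c, D (constL c) = 0;
  ddxX : D (ratX k)%:A = 1 }.

(* C is additive, C(u^p w) = u C(w), C(du) = 0 and C(u^(p-1) du) = du; these
   properties characterize the Cartier operator. *)
Record is_cartier (p : nat) (D C : L -> L) : Prop := IsCartier {
  cartierD : forall a b, C (a + b) = C a + C b;
  cartierM : forall u a, C (u ^+ p * a) = u * C a;
  cartier_exact : forall u, C (D u) = 0;
  cartier_log : forall u, C (u ^+ p.-1 * D u) = D u }.

(* The closed points of the smooth projective curve with function field L are the
   normalized discrete valuations of L that are trivial on k. The value at 0
   is irrelevant. *)
Record is_place (nu : L -> int) : Prop := IsPlace {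
  placeM : forall a b, a != 0 -> b != 0 -> nu (a * b) = nu a + nu b;
  placeD : forall a b, a != 0 -> b != 0 -> a + b != 0 ->
    Num.min (nu a) (nu b) <= nu (a + b);
  placeC : forall c, c != 0 -> nu (constL c) = 0;
  place_unif : exists2 t, t != 0 & nu t = 1 }.

Definition regular_at (D : L -> L) (nu : L -> int) (w : L) : Prop :=
  exists t u, [/\ t != 0, nu t = 1, u = 0 \/ 0 <= nu u & w = u * D t].

(* H^0(Y, Omega^1) *)
Definition holomorphic (D : L -> L) (w : L) : Prop :=
  forall nu, is_place nu -> regular_at D nu w.

Definition lin_indep (n : nat) (w : 'I_n -> L) : Prop :=
  forall a : 'I_n -> k, \sum_i constL (a i) * w i = 0 -> forall i, a i = 0.

(* dim_k V >= n, for a k-subspace V of L. *)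
Definition dim_ge (V : L -> Prop) (n : nat) : Prop :=
  exists w : 'I_n -> L, (forall i, V (w i)) /\ lin_indep w.

(* rk(C) >= n for C on H^0: since C is p^-1-linear and k is perfect, the image
   of H^0 under C is a k-subspace, whose dimension is the rank. *)
Definition cartier_rank_ge (D C : L -> L) (n : nat) : Prop :=
  dim_ge (fun w' => exists2 w, holomorphic D w & C w = w') n.

End FunctionField.

(* (P, a1, a2, v) stands for the differential y2^a2 y1^a1 x_P^v dx. For distinct
   elements of W below these differentials are distinct, and even linearly
   independent. *)
Definition monomial (k : closedFieldType) := (option k * nat * nat * nat)%type.

Definition basis_form (k : closedFieldType)
    (L : fieldExtType {fraction {poly k}}) (y1 y2 : L) (m : monomial k) : L :=
  let: (P, a1, a2, v) := m in
  y2 ^+ a2 * y1 ^+ a1 * (local_coord P ^+ v)%:A.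

Section Combinatorics.
Variables (p : nat) (k : closedFieldType) (X : witt_data k).
Local Open Scope nat_scope.

Definition W_top (P : option k) (a1 a2 : nat) : nat :=
  p * d_ X P * (p.-1 - a1) + d_ X P * (p ^ 2 - p + 1) * (p.-1 - a2).

(* The bound - p^2 - 1 at infinity is moved to the left-hand side, since
   subtraction is truncated. *)
Definition W_cond (P : option k) (a1 a2 v : nat) : bool :=
  if P \in B1 X then
    if P is None then p ^ 2 * v + p ^ 2 + 1 <= W_top P a1 a2
    else (0 < v) && (p ^ 2 * v <= W_top P a1 a2 + (p ^ 2 - 1))
  else (0 < v) && (p * v <= e_ X P * (p.-1 - a2) + p.-1).

(* Only makes the enumeration of W finite: by mem_W it excludes nothing. *)
Definition v_lim (P : option k) (a1 a2 : nat) : nat :=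
  W_top P a1 a2 + e_ X P * p.-1 + p ^ 2 + 1.

Definition W : seq (monomial k) :=
  [seq m <- flatten
     [seq [seq (P, a1, a2, v) | a2 <- iota 0 p, v <- iota 0 (v_lim P a1 a2)]
      | P <- B2 X, a1 <- iota 0 p]
   | let: (P, a1, a2, v) := m in W_cond P a1 a2 v].

Lemma mem_W P a1 a2 v : 0 < p ->
  ((P, a1, a2, v) \in W) =
    [&& P \in B2 X, a1 < p, a2 < p & W_cond P a1 a2 v].
Proof.
move=> p_gt0; rewrite mem_filter; case Wv: (W_cond P a1 a2 v) => /=;
  last by rewrite !andbF.
have v_lt : v < v_lim P a1 a2.
  have le_v n : 0 < n -> v <= n * v by move=> n_gt0; rewrite leq_pmull.
  have le_p2 : p <= p ^ 2 by rewrite leq_pmull.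
  have le_e : e_ X P * (p.-1 - a2) <= e_ X P * p.-1.
    by rewrite leq_mul2l leq_subr orbT.
  have := le_v (p ^ 2); rewrite expn_gt0 p_gt0 => /(_ isT).
  move: Wv (le_v p p_gt0); rewrite /W_cond /v_lim.
  by case: (P \in B1 X); case: P le_e => [c|] /=; lia.
rewrite andbT; apply/flattenP/and3P => [[s]|[P_B2 a1_p a2_p]].
  case/allpairsP=> -[Q b1] /= [Q_B2]; rewrite mem_iota => b1_p ->.
  case/flatten_mapP=> b2 b2_p /mapP[u _ [-> -> -> _]].
  by rewrite mem_iota in b2_p.
exists [seq (P, a1, b2, u) | b2 <- iota 0 p, u <- iota 0 (v_lim P a1 b2)].
  by apply/allpairsP; exists (P, a1); rewrite /= mem_iota.
apply/flatten_mapP; exists a2; first by rewrite mem_iota.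
by apply: map_f; rewrite mem_iota.
Qed.

(* v - epsilon_P; when P is not infinity, v > 0 on W_P. *)
Definition v_sub_eps (P : option k) (v : nat) : nat :=
  if P is None then v.+1 else v.-1.

(* d_P for P in B1 and e_P for P in B2 \ B1. *)
Definition pole (P : option k) : nat := if P \in B1 X then d_ X P else e_ X P.

Definition alpha (P : option k) (v : nat) : nat :=
  (p.-1 %/ pole P * v_sub_eps P v) %/ p.

Definition beta (P : option k) (v : nat) : nat :=
  p.-1 %/ pole P * v_sub_eps P v - p * alpha P v.

Definition H : seq (monomial k) :=
  [seq m <- W | let: (P, a1, a2, v) := m in
     if P \in B1 X then beta P v <= a1 + p * a2 else beta P v <= a2].

(* The key term kappa(C(w)); no subtraction is truncated when w is in H. *)
Definition key_term (m : monomial k) : monomial k :=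
  let: (P, a1, a2, v) := m in
  let v' := v - pole P * alpha P v in
  if P \in B1 X then
    if beta P v <= a1 then (P, a1 - beta P v, a2, v')
    else (P, a1 + p - beta P v, a2.-1, v')
  else (P, a1, a2 - beta P v, v').

Definition K : seq (monomial k) := undup [seq key_term m | m <- H].

End Combinatorics.

(* c is the coefficient of m in the expansion of w in the basis W. *)
Definition W_coef (p : nat) (k : closedFieldType) (X : witt_data k)
    (L : fieldExtType {fraction {poly k}}) (y1 y2 w : L) (m : monomial k)
    (c : k) : Prop :=
  exists2 a : monomial k -> k,
    w = \sum_(n <- W p X) constL L (a n) * basis_form y1 y2 n & a m = c.

(* Main.v *)
Require Import Defs.
From HB Require Import structures.
From mathcomp Require Import all_boot all_order all_algebra all_field.
From mathcomp Require Import generic_quotient zify ring.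
From Stdlib Require Import Classical_Prop.
Set Implicit Arguments.
Unset Strict Implicit.
Unset Printing Implicit Defensive.
Import Order.TTheory GRing.Theory Num.Theory.
Local Open Scope ring_scope.

(* In L over k(x), with basis y2^j y1^i, the equations y1 = y1^p - f and
   y2 = y2^p - g(y1) - h, where g(y1) is a polynomial in y1^p and f, make the
   coefficients of C(omega) explicit. At the pole P of omega, the order of the
   coefficient at the key term is exactly the expected one, because its leading
   coefficient is a sum of binomial coefficients that is prime to p. In a linear
   combination of images with distinct key terms, the image that is maximal for a
   suitable lexicographic order is the only one to reach the lowest order at its
   own key term, so its scalar vanishes: the images are independent.

   At a point of B1 where the pole of h dominates that of g(y1), the differentials
   y2^a2 y1^a1 x_P^v dx are not holomorphic. With rho = y2 - theta(y1), where theta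
   is chosen so that h - theta(y1)^p has small poles, the differentials
   rho^a2 y1^a1 x_P^v dx are holomorphic and have the same key terms. Above a point
   Q outside B2, in B2 \ B1, or in B1, the ramification index is 1, p or p^2, and a
   monomial in rho, y1 and a parameter at Q is a uniformizer, from which the order
   of dx is read off. *)

(** The independence argument uses orders in k(x) only. At each point the polynomial coefficients of
    the y2^j y1^i are filtered by giving y1 and y2 their expected pole orders. Reduction by y1^p =
    y1 + f does not raise such a weight, and C turns an order n relative to du/u into n / p. Orders
    after C are multiplied by p throughout, so that nothing is rounded.

    Passing to rho costs nothing here: theta(y1) = theta(y1^p - f) is again a polynomial in y1^p, so
    rho is y2^p minus the polynomial g(y1) + h + theta(y1) in y1^p, and only terms of lower weight
    change at the points of B1. On the other side rho^p - rho = g(y1) + (h - theta(y1)^p) +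
    theta(y1): removing p-th powers from h leaves the top term of g(y1) dominant there, and its
    degree is the constant p^2 - p + 1 of the basis W.

    Holomorphy has to be tested at every discrete valuation of L that is trivial on k. Neither its
    ramification index nor a uniformizer of it is known beforehand; both are extracted from the
    expansion of an arbitrary uniformizer in powers of rho and y1. *)

(** * Valuations *)

Record is_val (K : fieldType) (v : K -> int) : Prop := IsVal {
  valM : forall a b, a != 0 -> b != 0 -> v (a * b) = v a + v b;
  valD : forall a b, a != 0 -> b != 0 -> a + b != 0 ->
    Num.min (v a) (v b) <= v (a + b) }.

(** The value [v 0] is arbitrary, so the case a = 0 is separated: zero has infinite order. *)
Definition vge (K : fieldType) (v : K -> int) (n : int) (a : K) : bool :=
  (a == 0) || (n <= v a).

Section Valuation.
Variables (K : fieldType) (v : K -> int) (v_val : is_val v).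
Implicit Types (a b : K) (n m : int).

Lemma vge0 n : vge v n 0. Proof. by rewrite /vge eqxx. Qed.

Lemma vgeE n a : a != 0 -> vge v n a = (n <= v a).
Proof. by rewrite /vge => /negPf->. Qed.

Lemma vge_le m n a : n <= m -> vge v m a -> vge v n a.
Proof. by move=> le_nm /orP[|le_m]; rewrite /vge; [move->|rewrite (le_trans le_nm le_m) orbT]. Qed.

Lemma val1 : v 1 = 0.
Proof.
have := valM v_val (oner_neq0 K) (oner_neq0 K); rewrite mul1r => e.
by apply: (@addrI _ (v 1)); rewrite addr0 -e.
Qed.

Lemma valN1 : v (-1) = 0.
Proof.
have n0 : -1 != 0 :> K by rewrite oppr_eq0 oner_neq0.
have := valM v_val n0 n0; rewrite mulrNN mulr1 val1; lia.
Qed.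

Lemma valN a : v (- a) = v a.
Proof.
case: (eqVneq a 0) => [->|a0]; first by rewrite oppr0.
by rewrite -mulN1r (valM v_val) ?valN1 ?add0r // oppr_eq0 oner_neq0.
Qed.

Lemma valV a : a != 0 -> v a^-1 = - v a.
Proof.
move=> a0; have := valM v_val a0 (invr_neq0 a0); rewrite divff // val1; lia.
Qed.

Lemma val_div a b : a != 0 -> b != 0 -> v (a / b) = v a - v b.
Proof. by move=> a0 b0; rewrite (valM v_val) ?invr_eq0 // valV. Qed.

Lemma valX a (i : nat) : a != 0 -> v (a ^+ i) = v a * i%:Z.
Proof.
move=> a0; elim: i => [|i IHi]; first by rewrite expr0 val1 mulr0.
by rewrite exprS (valM v_val) ?expf_neq0 // IHi; lia.
Qed.

Lemma valXz a n : a != 0 -> v (a ^ n) = v a * n.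
Proof.
move=> a0; case: n => i; first by rewrite -exprnP valX.
by rewrite NegzE -exprnN valV ?expf_neq0 // valX //; lia.
Qed.

Lemma vgeN n a : vge v n (- a) = vge v n a.
Proof. by rewrite /vge oppr_eq0 valN. Qed.

Lemma vgeD n a b : vge v n a -> vge v n b -> vge v n (a + b).
Proof.
case: (eqVneq a 0) => [->|a0]; first by rewrite add0r.
case: (eqVneq b 0) => [->|b0]; first by rewrite addr0.
case: (eqVneq (a + b) 0) => [->|s0]; first by rewrite vge0.
rewrite !vgeE // => na nb; apply: le_trans (valD v_val a0 b0 s0).
by rewrite le_min na.
Qed.

Lemma vgeB n a b : vge v n a -> vge v n b -> vge v n (a - b).
Proof. by move=> va vb; apply: vgeD; rewrite ?vgeN. Qed.

Lemma vgeM n m a b : vge v n a -> vge v m b -> vge v (n + m) (a * b).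
Proof.
case: (eqVneq a 0) => [->|a0]; first by rewrite mul0r => *; apply: vge0.
case: (eqVneq b 0) => [->|b0]; first by rewrite mulr0 => *; apply: vge0.
by rewrite !vgeE ?mulf_neq0 // (valM v_val) // => na nb; apply: lerD.
Qed.

Lemma vgeX n a (i : nat) : vge v n a -> vge v (n * i%:Z) (a ^+ i).
Proof.
move=> na; elim: i => [|i IHi]; first by rewrite expr0 mulr0 vgeE ?oner_eq0 ?val1.
by rewrite exprS; apply: vge_le (vgeM na IHi); lia.
Qed.

Lemma vge_sum (I : Type) (s : seq I) (P : pred I) (F : I -> K) n :
  (forall i, P i -> vge v n (F i)) -> vge v n (\sum_(i <- s | P i) F i).
Proof. by move=> nF; apply: (big_ind (vge v n)) => [|a b|//]; [apply: vge0|apply: vgeD]. Qed.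

Lemma vge_mulrn n a (i : nat) : vge v n a -> vge v n (a *+ i).
Proof. by move=> na; rewrite -[i]card_ord -sumr_const; apply: vge_sum. Qed.

Lemma vge_nat (i : nat) : vge v 0 (i%:R).
Proof. by apply: vge_mulrn; rewrite vgeE ?oner_eq0 ?val1. Qed.

Lemma val_addl a b : a != 0 -> vge v (v a + 1) b -> a + b != 0 /\ v (a + b) = v a.
Proof.
move=> a0 gb; have s0 : a + b != 0.
  apply: contraTneq gb => /eqP; rewrite addr_eq0 => /eqP e.
  by rewrite -vgeN -e vgeE //; lia.
split=> //; apply/eqP; rewrite eq_le -(vgeE _ s0) andbC.
rewrite vgeD ?(vge_le _ gb) ?vgeE //=; last by lia.
rewrite leNgt; apply/negP => lt.
have : vge v (v a + 1) (a + b - b) by apply: vgeB => //; rewrite vgeE //; lia.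
by rewrite addrK vgeE //; lia.
Qed.

(** Distinct orders exclude cancellation. Applied to the expansion of a uniformizer, this isolates
    one monomial of order 1. *)
Lemma val_sum_neq0 (I : eqType) (s : seq I) (F : I -> K) :
    {in s &, forall i j, F i != 0 -> F j != 0 -> v (F i) = v (F j) -> i = j} ->
    uniq s -> \sum_(i <- s) F i != 0 ->
  exists2 i, i \in s & F i != 0 /\ v (\sum_(i <- s) F i) = v (F i).
Proof.
elim: s => [|i s IHs] inj; first by rewrite big_nil eqxx.
rewrite big_cons /= => /andP[is_ us] s0.
have inj' : {in s &, forall i j, F i != 0 -> F j != 0 -> v (F i) = v (F j) -> i = j}.
  by move=> a b sa sb; apply: inj; rewrite inE ?sa ?sb orbT.
case: (eqVneq (F i) 0) s0 => [Fi0|Fi0 s0].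
  rewrite Fi0 add0r => /(IHs inj' us)[j js Fj].
  by exists j; rewrite // inE js orbT.
case: (eqVneq (\sum_(j <- s) F j) 0) => [->|t0].
  by exists i; rewrite ?inE ?eqxx // addr0.
have [j js [Fj0 vj]] := IHs inj' us t0.
have neq : v (F i) != v (F j).
  apply: contraNneq is_ => e; suff -> : i = j by [].
  by apply: inj; rewrite // inE ?eqxx ?js ?orbT.
case: (ltrP (v (F i)) (v (F j))) => [lt|le].
  exists i; rewrite ?inE ?eqxx //; split=> //.
  by apply: (val_addl Fi0 _).2; rewrite vgeE // vj; lia.
exists j; rewrite ?inE ?js ?orbT //; split=> //; rewrite addrC -vj.
by apply: (val_addl t0 _).2; rewrite vgeE // vj; lia.
Qed.

Lemma is_val_scale (s : int) : 0 <= s -> is_val (fun a => s * v a).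
Proof.
move=> s_ge0; split=> a b a0 b0; first by rewrite (valM v_val) //; lia.
move=> s0; rewrite -minr_pMr //; apply: ler_wpM2l => //; exact: (valD v_val).
Qed.

Lemma vge_scale (s : int) n a : 0 < s -> vge (fun a => s * v a) (s * n) a = vge v n a.
Proof. by move=> s0; rewrite /vge ler_pM2l. Qed.

End Valuation.

(** * The points of the projective line *)

Section Fractions.
Variables (k : closedFieldType).
Local Notation F := {fraction {poly k}}.
Implicit Types (P : option k) (A B : {poly k}) (a b : F).

Lemma frac_pairP a :
  exists AB : {poly k} * {poly k}, (AB.2 != 0) && (a == tofrac AB.1 / tofrac AB.2).
Proof.
elim/quotW: a => -[[A B] /= B0]; exists (A, B); rewrite /= B0 /=; apply/eqP.
have tB : tofrac B != 0 by rewrite tofrac_eq0.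
apply: (mulIf tB); rewrite divfK //.
rewrite !piE; apply/eqmodP => /=.
rewrite FracField.equivfE /FracField.mulf !numden_Ratio ?mulf_neq0 ?oner_eq0 //=.
by rewrite !mulr1 mulrC.
Qed.

Lemma fracP a : exists A B, B != 0 /\ a = tofrac A / tofrac B.
Proof. by have [[A B] /= /andP[B0 /eqP->]] := frac_pairP a; exists A, B. Qed.

Definition pval P A : int :=
  if P is Some c then (mup c A)%:Z else - (size A).-1%:Z.

Lemma pvalM P A B : A != 0 -> B != 0 -> pval P (A * B) = pval P A + pval P B.
Proof.
case: P => [c|] A0 B0 /=; first by rewrite mupM.
rewrite size_mul //; move: A0 B0; rewrite -!size_poly_gt0.
by case: (size A) (size B) => [|a] [|b] //= _ _; rewrite addnS /=; lia.
Qed.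

Lemma pvalD P A B : A != 0 -> B != 0 -> A + B != 0 ->
  Num.min (pval P A) (pval P B) <= pval P (A + B).
Proof.
case: P => [c|] A0 B0 s0 /=.
  have: (minn (mup c A) (mup c B) <= mup c (A + B))%N.
    rewrite mup_geq // dvdp_add //.
      by rewrite -mup_geq // geq_minl.
    by rewrite -mup_geq // geq_minr.
  by lia.
have := size_polyD A B; move: s0; rewrite -size_poly_gt0.
move: (size _) (size _) (size _) => a b c; rewrite leq_max ge_min => ? /orP[] ?; apply/orP; [left|right]; lia.
Qed.

End Fractions.

HB.lock Definition ordP (k : closedFieldType) (P : option k)
    (a : {fraction {poly k}}) : int :=
  let AB := xchoose (frac_pairP a) in pval P AB.1 - pval P AB.2.

HB.lock Definition unif (k : closedFieldType) (P : option k) :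
  {fraction {poly k}} := (local_coord P)^-1.

Section FractionValuation.
Variables (k : closedFieldType).
Local Notation F := {fraction {poly k}}.
Implicit Types (P : option k) (A B : {poly k}) (a b : F).

Lemma ordP_frac P A B : A != 0 -> B != 0 ->
  ordP P (tofrac A / tofrac B) = pval P A - pval P B.
Proof.
move=> A0 B0; rewrite ordP.unlock; move: (xchooseP (frac_pairP (tofrac A / tofrac B))).
case: (xchoose _) => [A1 B1] /= /andP[B10].
rewrite eqr_div ?tofrac_eq0 // -!tofracM tofrac_eq => /eqP e.
have A10 : A1 != 0.
  apply: contraNneq A0 => A10; move: e; rewrite A10 mul0r => /eqP.
  by rewrite mulf_eq0 (negPf B10) orbF.
by move/(congr1 (pval P)): e; rewrite !pvalM //; lia.
Qed.

Lemma frac_neq0P a : a != 0 -> exists A B, [/\ A != 0, B != 0 & a = tofrac A / tofrac B].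
Proof.
move=> a0; have [A [B [B0 e]]] := fracP a; exists A, B; split=> //.
by apply: contraNneq a0 => A0; rewrite e A0 tofrac0 mul0r.
Qed.

Lemma ordP_val P : is_val (ordP P).
Proof.
split=> a b /frac_neq0P[A [B [A0 B0 ->]]] /frac_neq0P[A' [B' [A'0 B'0 ->]]].
  by rewrite mulf_div -!tofracM !ordP_frac ?mulf_neq0 // !pvalM //; lia.
rewrite addf_div ?tofrac_eq0 // -!tofracM -tofracD.
set Sm : {poly k} := (Z in tofrac Z / tofrac (B * B')) => s0.
have n0 : Sm != 0 by apply: contraNneq s0 => ->; rewrite tofrac0 mul0r.

rewrite !ordP_frac ?mulf_neq0 //.
have : Num.min (pval P (A * B')) (pval P (A' * B)) <= pval P Sm.
  exact: pvalD (mulf_neq0 A0 B'0) (mulf_neq0 A'0 B0) n0.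
by rewrite !pvalM // !ge_min => /orP[] ?; apply/orP; [left|right]; lia.
Qed.

Lemma ordP_tofrac P A : A != 0 -> ordP P (tofrac A) = pval P A.
Proof.
move=> A0; rewrite -[tofrac A]divr1 -tofrac1 ordP_frac ?oner_eq0 //.
have e : pval P 1 = 0.
  by apply: (@addrI _ (pval P 1)); rewrite addr0 -pvalM ?oner_neq0 // mulr1.
by rewrite e subr0.
Qed.

Definition constF (c : k) : F := tofrac c%:P.

HB.instance Definition _ := GRing.RMorphism.copy constF (@tofrac {poly k} \o @polyC k).

Lemma ordP_const P c : c != 0 -> ordP P (constF c) = 0.
Proof.
move=> c0; rewrite ordP_tofrac ?polyC_eq0 //; case: P => [b|] /=.
  by rewrite mupNroot // rootC.
by rewrite size_polyC c0.
Qed.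

Lemma unifE P : unif P = if P is Some c then tofrac ('X - c%:P) else (tofrac 'X)^-1.
Proof. by case: P => [c|]; rewrite unif.unlock ?invrK. Qed.

Lemma ordP_unif P : ordP P (unif P) = 1.
Proof.
rewrite unifE; case: P => [c|].
  by rewrite ordP_tofrac ?polyXsubC_eq0 //= (@mup_XsubCX _ 1) eqxx.
rewrite (valV (ordP_val _)) ?tofrac_eq0 ?polyX_eq0 // ordP_tofrac ?polyX_eq0 //=.
by rewrite size_polyX.
Qed.

Lemma unif_neq0 P : unif P != 0.
Proof. by rewrite unifE; case: P => [c|]; rewrite ?invr_eq0 tofrac_eq0 ?polyXsubC_eq0 ?polyX_eq0. Qed.

Lemma vge_local_coord P Q : P <> Q -> vge (ordP Q) (Q == None)%:Z (local_coord P).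
Proof.
have X0 : 'X != 0 :> {poly k} by rewrite polyX_eq0.
have Xc0 c : 'X - c%:P != 0 :> {poly k} by rewrite polyXsubC_eq0.
case: P Q => [c|] [b|] //= neq; rewrite vgeE ?invr_eq0 ?tofrac_eq0 //.
- rewrite (valV (ordP_val _)) ?tofrac_eq0 // ordP_tofrac //= mupNroot // root_XsubC.
  by apply/eqP => e; apply: neq; rewrite e.
- by rewrite (valV (ordP_val _)) ?tofrac_eq0 // ordP_tofrac //= size_XsubC.
- by rewrite ordP_tofrac.
Qed.

(** When the orders of numerator and denominator agree, the residue is the quotient of their lowest
    Taylor coefficients at a finite point, and of their leading coefficients at infinity. *)
Lemma residueP P a : vge (ordP P) 0 a ->
  exists c, vge (ordP P) 1 (a - constF c).
Proof.
case: (eqVneq a 0) => [->|a0]; first by exists 0; rewrite rmorph0 subr0 vge0.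
have [A [B [A0 B0 ->]]] := frac_neq0P a0.
rewrite vgeE ?mulf_neq0 ?invr_eq0 ?tofrac_eq0 // ordP_frac //.
rewrite subr_ge0 le_eqVlt => /orP[/eqP eqv|lt]; last first.
  exists 0; rewrite rmorph0 subr0 vgeE ?mulf_neq0 ?invr_eq0 ?tofrac_eq0 //.
  by rewrite ordP_frac //; lia.
suff [c ceq] : exists c, A - c *: B = 0 \/
    A - c *: B != 0 /\ pval P B + 1 <= pval P (A - c *: B).
  exists c; have -> : tofrac A / tofrac B - constF c = tofrac (A - c *: B) / tofrac B.
    by rewrite tofracB -mul_polyC tofracM mulrBl mulfK ?tofrac_eq0.
  case: ceq => [->|[n0 le]]; first by rewrite tofrac0 mul0r vge0.
  by rewrite vgeE ?mulf_neq0 ?invr_eq0 ?tofrac_eq0 // ordP_frac //; lia.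
case: P eqv => [b|] /= eqv.
  have e C : C != 0 -> exists2 C', C = C' * ('X - b%:P) ^+ mup b C & ~~ root C' b.
    move=> C0; have /dvdpP[C' e] : ('X - b%:P) ^+ mup b C %| C by rewrite -mup_geq.
    exists C' => //; apply/negP => /factor_theorem[C2 e2].
    have : (mup b C < mup b C)%N.
      by rewrite mup_geq // {2}e e2 -mulrA -exprS dvdp_mull.
    by rewrite ltnn.
  have [A' eA _] := e _ A0; have [B' eB rB] := e _ B0.
  exists (A'.[b] / B'.[b]); set c := _ / _.
  case: (eqVneq (A - c *: B) 0) => [|n0]; [by left | right; split=> //].
  suff h : (mup b B < mup b (A - c *: B))%N by rewrite lezD1 ltz_nat.
  have eAB : mup b A = mup b B by lia.
  rewrite mup_geq //.
  have -> : A - c *: B = (A' - c *: B') * ('X - b%:P) ^+ mup b B.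
    by rewrite mulrBl -scalerAl -eB -eAB -eA.
  rewrite exprS dvdp_mul // dvdp_XsubCl.
  by rewrite /root !hornerE divfK // subrr.
exists (lead_coef A / lead_coef B); set c := _ / _.
have lB : lead_coef B != 0 by rewrite lead_coef_eq0.
case: (eqVneq (A - c *: B) 0) => [|n0]; [by left | right; split=> //].
have sAB : size A = size B.
  by move: eqv A0 B0; rewrite -!size_poly_gt0; move: (size A) (size B) => i j; lia.
suff h : (size (A - c *: B)%R < size B)%N.
  by rewrite lezD1 ltrN2 ltz_nat -ltnS !prednK ?size_poly_gt0.
have s_gt0 : (0 < size B)%N by rewrite size_poly_gt0.
rewrite -(prednK s_gt0) ltnS; apply/leq_sizeP => j; rewrite leq_eqVlt => /orP[/eqP<-|lt].
  by rewrite coefB coefZ -lead_coefE -{1}sAB -lead_coefE divfK // subrr.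
by rewrite coefB coefZ !nth_default ?mulr0 ?subrr ?sAB // -(prednK s_gt0).
Qed.


(** For a polynomial the expansion in the local parameter is finite: it is the Taylor expansion at
    b, or the polynomial itself read in 1/x at infinity. Power series are thereby avoided. *)
Lemma laurentP P (Q : {poly k}) : Q != 0 ->
  exists c n (a : nat -> k) (j : nat -> int), [/\ c != 0,
    forall i, (i < n)%N -> pval P Q + 1 <= j i &
    tofrac Q = constF c * unif P ^ pval P Q
               + \sum_(i < n) constF (a i) * unif P ^ j i].
Proof.
move=> Q0; case: P => [b|] /=; rewrite unifE.
  have /dvdpP[R e] : ('X - b%:P) ^+ mup b Q %| Q by rewrite -mup_geq.
  have rR : ~~ root R b.
    apply/negP => /factor_theorem[R2 e2].
    have : (mup b Q < mup b Q)%N.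
      by rewrite mup_geq // {2}e e2 -mulrA -exprS dvdp_mull.
    by rewrite ltnn.
  set m := mup b Q; set S := R \Po ('X + b%:P).
  exists R.[b], (size S).-1, (fun i => S`_i.+1), (fun i => (m + i.+1)%N : int).
  split=> [//|i _|]; first by lia.
  have eR : R = S \Po ('X - b%:P).
    by rewrite /S -comp_polyA comp_polyD comp_polyX comp_polyC subrK comp_polyXr.
  have S0 : S != 0 by apply: contraNneq rR => S0; rewrite eR S0 comp_poly0 root0.
  have Sb : S`_0 = R.[b] by rewrite -horner_coef0 horner_comp !hornerE.
  rewrite {1}e -/m {1}eR comp_polyE mulr_suml.
  have -> : size S = (size S).-1.+1 by rewrite prednK // size_poly_gt0.
  rewrite big_ord_recl /= Sb expr0 raddfD raddf_sum /=; congr (_ + _).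
    by rewrite -scalerAl mul1r -mul_polyC tofracM tofracXn.
  apply: eq_bigr => i _.
  by rewrite -scalerAl -exprD -mul_polyC tofracM tofracXn addnC.
have [n en] : exists n, size Q = n.+1.
  by exists (size Q).-1; rewrite prednK // size_poly_gt0.
exists (lead_coef Q), n, (fun i => Q`_i), (fun i => - (i%:Z)).
have e i : (tofrac 'X)^-1 ^ (- (i%:Z)) = tofrac ('X ^+ i) :> F.
  by rewrite exprz_inv opprK -exprnP tofracXn.
rewrite en; split=> [|i|]; [by rewrite lead_coef_eq0 | by lia |].
rewrite -{1}[Q]coefK poly_def en big_ord_recr /= addrC lead_coefE en raddfD raddf_sum /=.
by congr (_ + _); [|apply: eq_bigr => i _]; rewrite -mul_polyC tofracM e.
Qed.

(** If 1/x has positive value the center is infinity; otherwise x is integral, and the center is a c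
    such that x - c has positive value. If there is none, all x - c are units, and so is every
    polynomial, since it splits over k. *)
Lemma val_center (w : F -> int) : is_val w -> (forall c, c != 0 -> w (constF c) = 0) ->
  (forall a, a != 0 -> w a = 0) \/
  exists P E, 0 < E /\ forall a, a != 0 -> w a = E * ordP P a.
Proof.
move=> w_val wC.
have wC0 c : vge w 0 (constF c).
  by case: (eqVneq c 0) => [->|c0]; rewrite ?rmorph0 ?vge0 // vgeE ?fmorph_eq0 ?wC.
have center P : 0 < w (unif P) -> forall a, a != 0 -> w a = w (unif P) * ordP P a.
  set E := w (unif P) => E_gt0.
  have wpow c j : vge w (E * j) (constF c * unif P ^ j).
    rewrite -[E * j]add0r; apply: (vgeM w_val) => //.
    by rewrite vgeE ?expfz_neq0 ?unif_neq0 // valXz ?unif_neq0.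
  have wQ (Q : {poly k}) : Q != 0 -> w (tofrac Q) = E * pval P Q.
    move=> Q0; have [c [n [a [j [c0 lej ->]]]]] := laurentP P Q0.
    have wc : w (constF c * unif P ^ pval P Q) = E * pval P Q.
      by rewrite (valM w_val) ?wC ?fmorph_eq0 ?expfz_neq0 ?unif_neq0 // valXz ?unif_neq0 ?add0r.
    rewrite (val_addl w_val _ _).2 ?mulf_neq0 ?fmorph_eq0 ?expfz_neq0 ?unif_neq0 //.
    apply: vge_sum => // i _; apply: vge_le (wpow _ _); rewrite wc.
    have := lej i (ltn_ord i) => le; apply: (@le_trans _ _ (E * (pval P Q + 1))); last by rewrite ler_pM2l.
    by rewrite mulrDr mulr1 lerD2l; lia.
  move=> a /frac_neq0P[A [B [A0 B0 ->]]].
  rewrite (val_div w_val) ?tofrac_eq0 // !wQ // ordP_frac //; lia.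
case: (boolP (0 < w (unif None))) => [E_gt0|Einf].
  by right; exists None, (w (unif None)); split=> //; apply: center.
have X0 : tofrac ('X : {poly k}) != 0 by rewrite tofrac_eq0 polyX_eq0.
have wX : vge w 0 (tofrac ('X : {poly k})).
  by move: Einf; rewrite unifE (valV w_val) // oppr_gt0 -leNgt vgeE.
case: (classic (exists c, 0 < w (unif (Some c)))) => [[c w_gt0]|noc].
  by right; exists (Some c), (w (unif (Some c))); split=> //; apply: center.
left; suff wQ (Q : {poly k}) : Q != 0 -> w (tofrac Q) = 0.
  move=> a /frac_neq0P[A [B [A0 B0 ->]]].
  by rewrite (val_div w_val) ?tofrac_eq0 // !wQ // subrr.
have wlin c : w (tofrac ('X - c%:P)) = 0.
  have l0 : tofrac ('X - c%:P) != 0 by rewrite tofrac_eq0 polyXsubC_eq0.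
  have : vge w 0 (tofrac ('X - c%:P)).
    by rewrite tofracB; apply: (vgeB w_val) => //; apply: wC0.
  have nle : w (tofrac ('X - c%:P)) <= 0.
    by rewrite leNgt; apply/negP => gt; apply: noc; exists c; rewrite unifE.
  by rewrite vgeE // => ge; apply/eqP; rewrite eq_le nle ge.
move=> Q0; have [r e] := closed_field_poly_normal Q.
rewrite e -mul_polyC tofracM (valM w_val); last 2 first.
- by rewrite tofrac_eq0 polyC_eq0 lead_coef_eq0.
- by rewrite tofrac_eq0 prodf_seq_neq0; apply/allP => z _; rewrite /= polyXsubC_eq0.
rewrite wC ?lead_coef_eq0 // add0r {e}; elim: r => [|z r IHr].
  by rewrite big_nil tofrac1 (val1 w_val).
rewrite big_cons tofracM (valM w_val) ?wlin ?IHr ?tofrac_eq0 ?polyXsubC_eq0 //.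
by rewrite prodf_seq_neq0; apply/allP => y _; rewrite /= polyXsubC_eq0.
Qed.

End FractionValuation.

(* The order of Du / u at P, for the local parameter u at P. *)
Definition dlog_ord (k : closedFieldType) (P : option k) : int :=
  if P is None then 1 else -1.

(** The properties of k(x) and its points on which the rest relies. In [pt_laurent] the denominator
    is cleared by a p-th power, A / B = A B^(p-1) / B^p, because a p-th power can be taken out of C.
    In [pt_other] the exponent at infinity is 1, since 1/(x - c) vanishes there. *)
Record function_field_points (p : nat) (k : closedFieldType) (F : fieldType)
    (cst : {rmorphism k -> F}) (u : option k -> F) (v : option k -> F -> int) : Prop :=
  FunctionFieldPoints {
  pt_val : forall P, is_val (v P);
  pt_const : forall P c, c != 0 -> v P (cst c) = 0;
  pt_unif : forall P, u P != 0 /\ v P (u P) = 1;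
  pt_residue : forall P a, vge (v P) 0 a -> exists c, vge (v P) 1 (a - cst c);
  pt_other : forall P Q, P <> Q -> vge (v Q) (Q == None)%:Z (u P)^-1;
  pt_laurent : forall P a, a != 0 -> exists b n (c : nat -> k) (j : nat -> int),
    [/\ b != 0, forall i, (i < n)%N -> v P a + p%:Z * v P b <= j i
      & a * b ^+ p = \sum_(i < n) cst (c i) * u P ^ j i];
  pt_center : forall w, is_val w -> (forall c, c != 0 -> w (cst c) = 0) ->
    (forall a, a != 0 -> w a = 0) \/
    exists P E, 0 < E /\ forall a, a != 0 -> w a = E * v P a }.

(** * Differentiation of rational functions *)

Section RationalFunctions.
Variables (p : nat) (k : closedFieldType).
Local Notation F := {fraction {poly k}}.

Lemma rational_function_points : (0 < p)%N ->
  function_field_points p (@constF k) (@unif k) (@ordP k).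
Proof.
move=> p_gt0; split.
- exact: ordP_val.
- exact: ordP_const.
- by move=> P; split; [apply: unif_neq0 | apply: ordP_unif].
- exact: residueP.
- move=> P Q neq; have -> : (unif P)^-1 = local_coord P by rewrite unif.unlock invrK.
  exact: vge_local_coord.
- move=> P a /frac_neq0P[A [B [A0 B0 ->]]].
  have Q0 : A * B ^+ p.-1 != 0 by rewrite mulf_neq0 ?expf_neq0.
  have [c [n [d [j [c0 lej eQ]]]]] := laurentP P Q0.
  have pQ : pval P (A * B ^+ p.-1) = pval P A + pval P B * p.-1%:Z.
    rewrite pvalM ?expf_neq0 // -!ordP_tofrac ?expf_neq0 // tofracXn.
    by rewrite (valX (ordP_val P)) ?tofrac_eq0 // ordP_tofrac.
  exists (tofrac B), n.+1, (fun i => if i is i'.+1 then d i' else c),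
    (fun i => if i is i'.+1 then j i' else pval P (A * B ^+ p.-1)).
  have pE : p%:Z = p.-1%:Z + 1 by lia.
  split=> [|i|]; first by rewrite tofrac_eq0.
    rewrite ordP_frac // ordP_tofrac // pE.
    have -> : pval P A - pval P B + (p.-1%:Z + 1) * pval P B = pval P (A * B ^+ p.-1).
      by rewrite pQ; ring.
    case: i => [|i] lti //; apply: le_trans (lej i lti); lia.
  rewrite big_ord_recl -eQ -[in X in _ ^+ X](prednK p_gt0) exprS.
  by rewrite mulrA divfK ?tofrac_eq0 // tofracM tofracXn.
- exact: val_center.
Qed.

Variables (L : fieldType) (iota : {rmorphism F -> L}) (D : L -> L).
Hypothesis DD : forall a b, D (a + b) = D a + D b.
Hypothesis DM : forall a b, D (a * b) = D a * b + a * D b.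
Hypothesis DC : forall c, D (iota (constF c)) = 0.
Hypothesis DX : D (iota (tofrac 'X)) = 1.
Local Notation "a %:L" := (iota a) (at level 2, format "a %:L").

Lemma pval_deriv P (A : {poly k}) :
  A != 0 -> vge (ordP P) (pval P A + dlog_ord P) (tofrac A^`()).
Proof.
move=> A0; case: (eqVneq A^`() 0) => [->|dA0]; first by rewrite tofrac0 vge0.
rewrite vgeE ?tofrac_eq0 // ordP_tofrac //.
case: P => [c|] /=.
  case m0 : (mup c A) => [|m]; first by lia.
  suff h : (m <= mup c A^`())%N by lia.
  have /dvdpP[R e] : ('X - c%:P) ^+ m.+1 %| A by rewrite -mup_geq ?m0.
  rewrite mup_geq // e derivM deriv_exp derivXsubC mul1r exprS.
  rewrite dvdp_add //; first by rewrite mulrA dvdp_mull.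
  by rewrite mulrnAr -mulrnAl dvdp_mull.
have := lt_size_deriv A0; have : (0 < size A^`())%N by rewrite size_poly_gt0.
by move: (size _) (size A) => i j; lia.
Qed.

Lemma ddx_tofrac (A : {poly k}) : D (tofrac A)%:L = (tofrac A^`())%:L.
Proof.
have Dc c : D (tofrac c%:P)%:L = 0 by apply: DC.
elim/poly_ind: A => [|A c IHA].
  by rewrite -polyC0 Dc derivC tofrac0 rmorph0.
rewrite derivMXaddC !tofracD !tofracM !rmorphD !rmorphM /= DD DM Dc IHA.
by rewrite DX mulr1 addr0 addrC.
Qed.

Lemma ddx_frac (a : F) : exists b : F, D a%:L = b%:L /\
  forall P n, vge (ordP P) n a -> vge (ordP P) (n + dlog_ord P) b.
Proof.
case: (eqVneq a 0) => [->|a0].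
  exists 0; split=> [|P n _]; last exact: vge0.
  by rewrite -tofrac0 ddx_tofrac deriv0.
have [A [B [A0 B0 e]]] := frac_neq0P a0.
have tB0 : tofrac B != 0 by rewrite tofrac_eq0.
exists ((tofrac A^`() - a * tofrac B^`()) / tofrac B); split=> [|P n].
  have tL0 : (tofrac B)%:L != 0 by rewrite fmorph_eq0.
  apply: (mulIf tL0); rewrite -rmorphM divfK // rmorphB rmorphM -!ddx_tofrac.
  have -> : tofrac A = a * tofrac B by rewrite e divfK.
  by rewrite rmorphM DM addrK.
rewrite (vgeE _ _ a0) => len; have val := ordP_val P.
apply: (@vge_le _ _ (ordP P a + pval P B + dlog_ord P + - pval P B)); first by lia.
apply: (vgeM val); last by rewrite vgeE ?invr_eq0 // valV // ordP_tofrac.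
apply: (vgeB val).
  have -> : ordP P a + pval P B = pval P A by rewrite e ordP_frac // subrK.
  exact: pval_deriv.
rewrite -addrA; apply: (vgeM val); last exact: pval_deriv.
by rewrite (vgeE _ _ a0).
Qed.

Lemma ddx_unif P : exists l, [/\ l != 0, ordP P l = dlog_ord P
  & D (unif P)%:L = (l * unif P)%:L].
Proof.
have val := ordP_val P.
case: P val => [c|] val; rewrite unifE.
  have l0 : tofrac ('X - c%:P) != 0 by rewrite tofrac_eq0 polyXsubC_eq0.
  exists (tofrac ('X - c%:P))^-1; split; first by rewrite invr_eq0.
    by rewrite (valV val) // -(unifE (Some c)) ordP_unif.
  by rewrite mulVf // ddx_tofrac derivXsubC tofrac1.
have X0 : tofrac ('X : {poly k}) != 0 by rewrite tofrac_eq0 polyX_eq0.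
exists (- (tofrac 'X)^-1); split; first by rewrite oppr_eq0 invr_eq0.
  by rewrite (valN val) -(unifE (@None k)) ordP_unif.
have e : D ((tofrac 'X)%:L * ((tofrac 'X)^-1)%:L) = 0.
  by rewrite -rmorphM divff // -tofrac1 ddx_tofrac -polyC1 derivC tofrac0 rmorph0.
move: e; rewrite DM ddx_tofrac derivX tofrac1 rmorph1 mul1r addrC.
move/eqP; rewrite addr_eq0 => /eqP e.
have XL0 : (tofrac ('X : {poly k}))%:L != 0 by rewrite fmorph_eq0.
by apply: (mulfI XL0); rewrite e -rmorphM mulrA mulrN divff // mulN1r rmorphN.
Qed.

End RationalFunctions.

(** * Binomial identities for the Witt polynomial *)

Lemma coef_1DXn (R : comNzRingType) i s : ((1 + 'X) ^+ i : {poly R})`_s = 'C(i, s)%:R.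
Proof.
have -> : (1 + 'X) ^+ i = \poly_(j < i.+1) ('C(i, j)%:R : R).
  rewrite poly_def exprDn; apply: eq_bigr => j _.
  by rewrite expr1n mul1r scaler_nat.
by rewrite coef_poly; case: ltnP => // lt; rewrite bin_small.
Qed.

(** This is the coefficient of X^s in (1 - (1 + X))^n = (-X)^n. *)
Lemma alt_sum_bin n s : (s < n)%N ->
  \sum_(i < n.+1) (-1) ^+ i * ('C(n, i)%:R * 'C(i, s)%:R) = 0 :> int.
Proof.
move=> lt_sn; transitivity ((1 - (1 + 'X) : {poly int}) ^+ n)`_s.
  rewrite exprBn coef_sum; apply: eq_bigr => i _.
  have -> : (-1) ^+ i = ((-1) ^+ i)%:P :> {poly int} by rewrite rmorph_sign.
  by rewrite expr1n mulr1 coefMn coefCM coef_1DXn mulrA mulrAC mulr_natr.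
have sg : (-1) ^+ n = ((-1) ^+ n)%:P :> {poly int} by rewrite rmorph_sign.
by rewrite opprD addrA subrr add0r exprNn sg coefCM coefXn (ltn_eqF lt_sn) mulr0.
Qed.

(* The coefficients of ((x + y)^p - x^p - y^p) / p. *)
Definition wbin (p l : nat) : nat := 'C(p, l) %/ p.

Section Binomials.
Variables (p : nat) (p_prime : prime p).
Let p_gt0 : (0 < p)%N := prime_gt0 p_prime.

Lemma mul_wbin l : (0 < l < p)%N -> (p * wbin p l)%N = 'C(p, l).
Proof. by move=> lt; rewrite mulnC divnK // prime_dvd_bin. Qed.

(** The preceding identity for n = p, with the terms i = 0 and i = p moved to the right and the rest
    divided by p. The division takes place over the integers; the result is then transported to
    characteristic p. *)
Lemma alt_sum_wbin s : (2 < p)%N -> (s < p)%N ->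
  \sum_(1 <= i < p) (-1) ^+ i * ((wbin p i)%:R * 'C(i, s)%:R)
    = (if s == 0%N then 0 else (wbin p s)%:R) :> int.
Proof.
move=> p_gt2 lt_sp; have pz : p%:R != 0 :> int by rewrite pnatr_eq0 -lt0n.
have p_odd : odd p by case: (even_prime p_prime) p_gt2 => [->|].
apply: (mulfI pz); rewrite mulr_sumr.
have := alt_sum_bin lt_sp; rewrite -(big_mkord xpredT (fun i => (-1) ^+ i * ('C(p, i)%:R * 'C(i, s)%:R) : int)).
rewrite big_nat_recr // big_ltn //= expr0 mul1r bin0 binn !mul1r.
rewrite -[(-1) ^+ p]signr_odd p_odd expr1 mulN1r bin0n => /eqP.
rewrite addrAC addr_eq0 => /eqP e.
rewrite (eq_big_nat _ _ (F2 := fun i => (-1) ^+ i * ('C(p, i)%:R * 'C(i, s)%:R))); last first.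
  move=> i lti; rewrite mulrCA; congr (_ * _).
  by rewrite mulrA -(natrM _ p) mul_wbin.
case: eqVneq e => [->|s0] e.
  by apply: oppr_inj; rewrite -e bin0 subrr mulr0 oppr0.
apply: oppr_inj; rewrite -e sub0r -natrM mul_wbin // lt_sp andbT.
by rewrite lt0n.
Qed.

Let factE : p`! = (p * (p.-1)`!)%N.
Proof. by rewrite -{1}(prednK p_gt0) factS (prednK p_gt0). Qed.

Lemma wbin_fact i : (0 < i < p)%N -> (wbin p i * (i`! * (p - i)`!))%N = (p.-1)`!.
Proof.
move=> lti; have /andP[_ ltip] := lti; apply/eqP; rewrite -(eqn_pmul2l p_gt0).
by rewrite mulnA mul_wbin // bin_fact ?(ltnW ltip) // factE.
Qed.

Lemma witt_g_wbin (K : fieldType) (y : K) : (2 < p)%N -> p \in [pchar K] ->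
  witt_g p y = \sum_(1 <= i < p) (-1) ^+ i * (wbin p i)%:R * y ^+ (p * (p - i) + i).
Proof.
move=> p_gt2 charK; have neq0 i : (i < p)%N -> i`!%:R != 0 :> K.
  move=> lti; rewrite -(dvdn_pcharf charK).
  elim: i lti => [|i IHi] lti; first by rewrite dvdn1; case: eqP p_gt2 => // ->.
  rewrite factS Euclid_dvdM // negb_or (IHi (ltnW lti)) andbT.
  by apply/negP => /dvdn_leq; lia.
apply: eq_big_nat => i lti; congr (_ * _ * _).
by rewrite -(wbin_fact lti) !natrM mulfK // mulf_neq0 // neq0 //; lia.
Qed.

(* For f = y^p - y this writes g(y) in terms of y^p and f alone. *)
Lemma witt_gE (K : fieldType) (y : K) : (2 < p)%N -> p \in [pchar K] ->
  witt_g p y = \sum_(1 <= l < p) (wbin p l)%:R * (y - y ^+ p) ^+ l * y ^+ (p * (p - l)).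
Proof.
move=> p_gt2 charK; pose e := y - y ^+ p.
(* Only the factor y^i of y^(p(p-i)+i) is expanded, by y = y^p + e. The total degree in y^p and e is
   then p for every i, so that the sums over i are the alternating sums above. *)
have termE i : (0 < i < p)%N ->
    (-1) ^+ i * (wbin p i)%:R * y ^+ (p * (p - i) + i) =
    \sum_(s < p) (-1) ^+ i * ((wbin p i)%:R * 'C(i, s)%:R) * (e ^+ s * (y ^+ p) ^+ (p - s)).
  move=> lti; have ye : y = y ^+ p + e by rewrite /e addrC subrK.
  rewrite exprD exprM {2}ye exprDn (big_ord_widen p (fun s => (y ^+ p) ^+ (i - s) * e ^+ s *+ 'C(i, s))); last by lia.
  rewrite !mulr_sumr big_mkcond; apply: eq_bigr => s _.
  case: ltnP => [lts|/bin_small->]; last by rewrite !mulr0 mul0r.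
  have -> : (y ^+ p) ^+ (p - s) = (y ^+ p) ^+ (p - i) * (y ^+ p) ^+ (i - s).
    by rewrite -exprD; congr (_ ^+ _); lia.
  by rewrite -mulr_natr; ring.
rewrite witt_g_wbin // (eq_big_nat _ _ termE) exchange_big /=.
have swap (s : 'I_p) : \sum_(1 <= i < p) (-1) ^+ i * ((wbin p i)%:R * 'C(i, s)%:R) * (e ^+ s * (y ^+ p) ^+ (p - s))
   = (if s == 0%N :> nat then 0 else (wbin p s)%:R) * (e ^+ s * (y ^+ p) ^+ (p - s)).
  rewrite -mulr_suml; congr (_ * _).
  have := congr1 (fun z : int => z%:~R : K) (alt_sum_wbin p_gt2 (ltn_ord s)).
  rewrite rmorph_sum /= => eq; transitivity ((if s == 0%N :> nat then 0 else (wbin p s)%:R : int)%:~R : K).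
    rewrite -eq; apply: eq_bigr => i _.
    by rewrite rmorphM rmorph_sign rmorphM !rmorph_nat.
  by case: ifP => _; rewrite ?rmorph0 ?rmorph_nat.
rewrite (eq_bigr _ (fun s _ => swap s)).
rewrite -(big_mkord xpredT (fun s => (if s == 0%N then 0 else (wbin p s)%:R) * (e ^+ s * (y ^+ p) ^+ (p - s)))).
rewrite big_ltn // eqxx mul0r add0r; apply: eq_big_nat => l /andP[l_gt0 _].
by rewrite -(negbK (l == 0)%N) -lt0n l_gt0 mulrA exprM.
Qed.

Lemma fact_add_prime a : (a < p)%N -> exists2 w, (p + a)`! = (p * w)%N & ~~ (p %| w)%N.
Proof.
elim: a => [_|a IHa lta].
  exists (p.-1)`!; first by rewrite addn0 factE.
  have : (p.-1 < p)%N by lia.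
  elim: p.-1 => [|i IHi] lti; first by rewrite dvdn1; case: eqP p_prime => // ->.
  rewrite factS Euclid_dvdM // negb_or (IHi (ltnW lti)) andbT.
  by apply/negP => /dvdn_leq; lia.
have [w e w0] := IHa (ltnW lta); exists ((p + a.+1) * w)%N.
  by rewrite addnS factS e -addnS mulnCA.
rewrite Euclid_dvdM // negb_or w0 andbT dvdn_addr //.
by apply/negP => /dvdn_leq; lia.
Qed.

(** By Vandermonde, p times this sum is 'C(p + a, b), the term l = 0 being 'C(a, b) = 0. This
    binomial divides (p + a)!, in which p occurs exactly once. The sum is the leading coefficient
    met when a power of y2 is lost in the key term. *)
Lemma wbin_conv_ndvd a b : (a < b < p)%N ->
  ~~ (p %| \sum_(1 <= l < b.+1) wbin p l * 'C(a, b - l))%N.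
Proof.
move=> /andP[ltab ltbp]; have [|w e w0] := @fact_add_prime a; first by lia.
have eC : (p * \sum_(1 <= l < b.+1) wbin p l * 'C(a, b - l))%N = 'C(p + a, b).
  rewrite -binomial.Vandermonde -(big_mkord xpredT (fun j => 'C(p, j) * 'C(a, b - j))%N) [RHS]big_ltn //.
  rewrite subn0 (bin_small ltab) muln0 add0n big_distrr; apply: eq_big_nat => l ltl.
  by rewrite /= mulnA mul_wbin //; lia.
apply: contra w0 => dvd; have := @bin_fact (p + a) b; rewrite -eC e -mulnA => /(_ _)/eqP.
by rewrite eqn_pmul2l // => /(_ ltac:(lia))/eqP <-; rewrite dvdn_mulr.
Qed.

End Binomials.

(** * Artin-Schreier extensions *)

Section PrimeCharacteristic.
Variables (R : comNzRingType) (p : nat) (charR : p \in [pchar R]).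

Lemma exprD_char (a b : R) : (a + b) ^+ p = a ^+ p + b ^+ p.
Proof. by rewrite exprDn_pchar // (pnatE _ (pcharf_prime charR)). Qed.

Lemma natrX_char i : (i%:R : R) ^+ p = i%:R.
Proof.
elim: i => [|i IHi]; first by rewrite expr0n (gtn_eqF (prime_gt0 (pcharf_prime charR))).
by rewrite -addn1 natrD exprD_char IHi expr1n.
Qed.

End PrimeCharacteristic.

Section ArtinSchreier.
Variables (F : fieldType) (L : fieldExtType F) (K : {subfield L}).
Variables (p : nat) (y : L).
Hypotheses (charL : p \in [pchar L]) (yK : y ^+ p - y \in K) (y_notin : y \notin K).

Let p_prime : prime p := pcharf_prime charL.

Lemma artin_schreier_factor :
  'X^p - ('X + (y ^+ p - y)%:P) = \prod_(z <- [seq y + i%:R | i <- iota 0 p]) ('X - z%:P).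
Proof.
have p_gt1 := prime_gt1 p_prime.
have sz : (size (- ('X + (y ^+ p - y)%:P)) < size ('X^p : {poly L}))%N.
  by rewrite size_polyN size_XaddC size_polyXn ltnS.
have size_Q : size ('X^p - ('X + (y ^+ p - y)%:P)) = p.+1.
  by rewrite size_polyDl // size_polyXn.
rewrite [LHS](@all_roots_prod_XsubC _ _ [seq y + i%:R | i <- iota 0 p]).
- by rewrite lead_coefDl // lead_coefXn scale1r.
- by rewrite size_Q size_map size_iota.
- apply/allP => _ /mapP[i _ ->]; apply/rootP.
  by rewrite !hornerE /= (exprD_char charL) (natrX_char charL); ring.
rewrite uniq_rootsE map_inj_in_uniq ?iota_uniq // => i j.
rewrite !mem_iota /= !add0n => lti ltj /addrI/eqP.
wlog leij : i j lti ltj / (i <= j)%N => [hw|].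
  by case: (leqP i j) => [|/ltnW] le e; [|apply/esym]; apply: hw => //; rewrite // eq_sym.
rewrite eq_sym -subr_eq0 -natrB // -(dvdn_pcharf charL) => dvd; apply/eqP.
rewrite eqn_leq leij -subn_eq0 /=; apply: contraTT dvd; rewrite -lt0n => gt0.
by apply/negP => /(dvdn_leq gt0); lia.
Qed.

(** The minimal polynomial is a product over n of the roots y + i. The sum of these roots is n y
    plus an integer and lies in K; if n < p then n is invertible and y would lie in K. *)
Lemma artin_schreier_degree : adjoin_degree K y = p.
Proof.
have rP : root ('X^p - ('X + (y ^+ p - y)%:P)) y.
  by apply/rootP; rewrite !hornerE /=; ring.
have ovP : 'X^p - ('X + (y ^+ p - y)%:P) \is a polyOver K.
  by rewrite rpredB ?rpredX ?rpredD ?polyOverX ?polyOverC.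
have := minPoly_dvdp ovP rP; rewrite artin_schreier_factor.
case/dvdp_prod_XsubC => m; set s := mask m _.
rewrite eqp_monic ?monic_minPoly ?monic_prod_XsubC // => /eqP eM.
have size_s : size s = adjoin_degree K y.
  by apply/eqP; rewrite -eqSS -size_minPoly eM size_prod_XsubC.
have sub_s : (size s <= p)%N.
  by apply: leq_trans (size_subseq (mask_subseq _ _)) _; rewrite size_map size_iota.
rewrite -size_s; apply/eqP; rewrite eqn_leq sub_s leqNgt; apply/negP => lt_sp.
have s_neq0 : size s != 0%N by rewrite size_s.
have : \sum_(z <- s) z \in K.
  rewrite -[\sum_(z <- s) z]opprK -coefPn_prod_XsubC // -eM rpredN.
  by have /polyOverP -> := minPolyOver K y.
have [c ec] : exists c, \sum_(z <- s) z = y *+ size s + c%:R.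
  rewrite /s; elim: m (iota 0 p) {s size_s sub_s eM lt_sp s_neq0} => [|b m IHm] [|i r] /=.
  - by exists 0%N; rewrite big_nil addr0.
  - by exists 0%N; rewrite big_nil addr0.
  - by exists 0%N; case: b; rewrite /= big_nil addr0.
  have [c ec] := IHm r; case: b => /=; last by exists c.
  by exists (i + c)%N; rewrite big_cons ec mulrS natrD; ring.
rewrite ec => sK; move: y_notin; apply/negP; rewrite negbK.
have n0 : (size s)%:R != 0 :> L.
  rewrite -(dvdn_pcharf charL); apply/negP => /dvdn_leq; rewrite lt0n => /(_ s_neq0).
  by lia.
have natK i : (i%:R : L) \in K by rewrite rpred_nat.
rewrite -[y](mulfK n0) mulr_natr rpred_div // -(addrK c%:R (y *+ _)).
by rewrite rpredB.
Qed.

Lemma artin_schreier_free (q : {poly L}) :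
  q \is a polyOver K -> (size q <= p)%N -> q.[y] = 0 -> q = 0.
Proof.
move=> qK sq qy; apply/eqP; rewrite -[_ == 0]negbK; apply/negP => q0.
have : (minPoly K y %| q) by apply: minPoly_dvdp => //; apply/rootP.
by move/(dvdp_leq q0); rewrite size_minPoly artin_schreier_degree ltnNge sq.
Qed.

End ArtinSchreier.

(* [wt w d M q]: with the variable of order -d, every term of q has order at
   least -M. *)
Definition wt (F : fieldType) (w : F -> int) (d M : int) (q : {poly F}) : Prop :=
  forall i : nat, vge w (d * i%:Z - M) q`_i.

Definition asP (F : fieldType) (p : nat) (f : F) : {poly F} := 'X^p - ('X + f%:P).

(** * Weights and reduction modulo X^p - X - f *)

Section ReductionPolynomial.
Variables (F : fieldType) (p : nat) (f : F).
Implicit Types q : {poly F}.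

Lemma asP_size : (1 < p)%N -> size (asP p f) = p.+1.
Proof.
move=> p_gt1; rewrite /asP size_polyDl ?size_polyXn // size_polyN size_XaddC.
by rewrite ltnS.
Qed.

Lemma asP_monic : (1 < p)%N -> asP p f \is monic.
Proof.
move=> p_gt1; rewrite monicE /asP lead_coefDl ?lead_coefXn //.
by rewrite size_polyN size_XaddC size_polyXn ltnS.
Qed.

Lemma size_mod_asP q : (1 < p)%N -> (size (q %% asP p f)%R <= p)%N.
Proof.
move=> p_gt1; rewrite -ltnS -(asP_size p_gt1) ltn_modp.
by rewrite monic_neq0 // asP_monic.
Qed.

(** A term X^(p+t) with t < s reduces to X^t (X + f), of degree at most s, so the coefficients
    strictly between s and p are not affected. *)
Lemma coef_mod_asP  q s i : (size q <= p + s)%N -> (s < i < p)%N ->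
  (q %% asP p f)`_i = q`_i.
Proof.
move=> sq /andP[lts ltp]; have p_gt1 : (1 < p)%N by lia.
have eq : q = drop_poly p q * asP p f + (take_poly p q + drop_poly p q * ('X + f%:P)).
  by rewrite -{1}(poly_take_drop p q) /asP; ring.
have sd : (size (drop_poly p q) <= s)%N by rewrite size_drop_poly leq_subLR.
have sdX : (size (drop_poly p q * ('X + f%:P))%R <= s.+1)%N.
  apply: leq_trans (size_polyMleq _ _) _; rewrite size_XaddC addn2 /=.
  by rewrite ltnS.
rewrite {1}eq modpD modp_mull add0r modp_small; last first.
  rewrite asP_size // ltnS; apply: leq_trans (size_polyD _ _) _.
  by rewrite geq_max size_take_poly; apply: leq_trans sdX _; lia.
by rewrite coefD coef_take_poly ltp [X in _ + X]nth_default ?addr0 //; apply: leq_trans sdX _.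
Qed.

End ReductionPolynomial.

Section Weights.
Variables (F : fieldType) (w : F -> int) (w_val : is_val w) (d : int).
Implicit Types (q r : {poly F}) (M N : int).

Lemma wt_le M N q : M <= N -> wt w d M q -> wt w d N q.
Proof. by move=> le wq i; apply: vge_le (wq i); lia. Qed.

Lemma wt0 M : wt w d M 0.
Proof. by move=> i; rewrite coef0 vge0. Qed.

Lemma wtD M q r : wt w d M q -> wt w d M r -> wt w d M (q + r).
Proof. by move=> wq wr i; rewrite coefD; apply: (vgeD w_val). Qed.

Lemma wtN M q : wt w d M q -> wt w d M (- q).
Proof. by move=> wq i; rewrite coefN (vgeN w_val). Qed.

Lemma wtB M q r : wt w d M q -> wt w d M r -> wt w d M (q - r).
Proof. by move=> wq wr; apply: wtD => //; apply: wtN. Qed.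

Lemma wt_sum (I : Type) (s : seq I) (P : pred I) (G : I -> {poly F}) M :
  (forall i, P i -> wt w d M (G i)) -> wt w d M (\sum_(i <- s | P i) G i).
Proof. by move=> wG; apply: (big_ind (wt w d M)) => [|q r|//]; [apply: wt0|apply: wtD]. Qed.

Lemma wtM M N q r : wt w d M q -> wt w d N r -> wt w d (M + N) (q * r).
Proof.
move=> wq wr i; rewrite coefM; apply: (vge_sum w_val) => j _.
apply: vge_le (vgeM w_val (wq j) (wr (i - j)%N)).
by have := ltn_ord j => ltj; rewrite -subzn //; lia.
Qed.

Lemma wtC M c : vge w (- M) c -> wt w d M c%:P.
Proof. by move=> vc [|i]; rewrite coefC ?vge0 //=; apply: vge_le vc; lia. Qed.

Lemma wt1 : wt w d 0 1.
Proof. by rewrite -polyC1; apply: wtC; rewrite vgeE ?oner_eq0 // (val1 w_val). Qed.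

Lemma wt_exp M q (n : nat) : wt w d M q -> wt w d (M * n%:Z) (q ^+ n).
Proof.
move=> wq; elim: n => [|n IHn]; first by rewrite expr0 mulr0; apply: wt1.
by rewrite exprS; apply: wt_le (wtM wq IHn); lia.
Qed.

Lemma wtX : wt w d d 'X.
Proof.
move=> i; rewrite coefX; case: eqP => [->|_]; last by rewrite vge0.
by rewrite vgeE ?oner_eq0 // (val1 w_val); lia.
Qed.

Lemma wtXn (n : nat) : wt w d (d * n%:Z) 'X^n.
Proof. exact: wt_exp wtX. Qed.

Lemma wtZ M N c q : vge w (- M) c -> wt w d N q -> wt w d (M + N) (c *: q).
Proof. by move=> vc wq; rewrite -mul_polyC; apply: wtM => //; apply: wtC. Qed.

Lemma wt_mulrn M q n : wt w d M q -> wt w d M (q *+ n).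
Proof. by move=> wq i; rewrite coefMn; apply: (vge_mulrn w_val). Qed.

Lemma wt_comp_sub (f : F) M q : vge w (- d) f ->
  wt w d M q -> wt w d M (q \Po ('X - f%:P)).
Proof.
move=> vf wq; rewrite comp_polyE; apply: wt_sum => i _.
apply: wt_le (wtZ (M := M - d * i%:Z) (N := d * i%:Z) _ _); first by lia.
  by apply: vge_le (wq i); lia.
by apply: wt_exp; apply: (wtB wtX); apply: wtC.
Qed.

Lemma coef_XsubC_exp (f : F) n i : (i <= n)%N ->
  (('X - f%:P) ^+ n)`_i = (- f) ^+ (n - i) *+ 'C(n, i).
Proof.
move=> le_in; have -> : ('X - f%:P) ^+ n = \poly_(j < n.+1) ((- f) ^+ (n - j) *+ 'C(n, j)).
  rewrite addrC exprDn poly_def; apply: eq_bigr => j _.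
  by rewrite -polyCN -polyC_exp mul_polyC scalerMnl.
by rewrite coef_poly ltnS le_in.
Qed.

(** Each reduction step replaces X^p, of weight p d, by X + f, where X has weight d and f at most p
    d. *)
Lemma wt_mod p (f : F) M q : (1 < p)%N -> 0 <= d -> vge w (- (p%:Z * d)) f ->
  wt w d M q -> wt w d M (q %% asP p f).
Proof.
move=> p_gt1 d_ge0 vf.
move: {2}(size q) (leqnn (size q)) => n; elim: n q => [|n IHn] q.
  by rewrite size_poly_leq0 => /eqP-> _; rewrite mod0p; apply: wt0.
move=> sq wq; case: (leqP (size q) p) => [le_sp|lt_ps].
  by rewrite modp_small // asP_size.
have sn : (p <= n)%N by rewrite -ltnS; apply: leq_trans lt_ps sq.
pose b := q`_n *: 'X^(n - p).
have eq : q - b * asP p f = (q - q`_n *: 'X^n) + b * ('X + f%:P).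
  by rewrite /asP mulrBr /b -scalerAl -exprD subnK // opprB addrA addrAC.
have -> : q %% asP p f = (q - b * asP p f) %% asP p f.
  by rewrite modpD modpN modp_mull oppr0 addr0.
have wb : wt w d (M - p%:Z * d) b.
  apply: (@wt_le (d * n%:Z * -1 + M + d * (n - p)%N%:Z)); first by rewrite -subzn //; lia.
  by apply: wtZ; [apply: vge_le (wq n); lia|apply: wtXn].
rewrite eq; apply: IHn.
  apply: leq_trans (size_polyD _ _) _; rewrite geq_max; apply/andP; split.
    apply/leq_sizeP => j; rewrite leq_eqVlt coefB coefZ coefXn => /orP[/eqP<-|ltj].
      by rewrite eqxx mulr1 subrr.
    by rewrite (gtn_eqF ltj) mulr0 subr0 nth_default //; apply: leq_trans sq _.
  apply: leq_trans (size_polyMleq _ _) _; rewrite size_XaddC addn2 /=.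
  have sb : (size b <= (n - p).+1)%N.
    by apply: leq_trans (size_scale_leq _ _) _; rewrite size_polyXn.
  by apply: (@leq_trans (n - p).+2); [rewrite ltnS | lia].
apply: wtD.
  apply: wtB => //; apply: wt_le (wtZ (M := M - d * n%:Z) _ (wtXn n)); first by lia.
  by apply: vge_le (wq n); lia.
apply: wt_le (wtM wb (N := p%:Z * d) _); first by lia.
apply: wtD; last by apply: wtC.
by apply: wt_le wtX; nia.
Qed.
End Weights.

(** * The Cartier operator on k(x) dx *)

Section CartierRestriction.
Variables (p : nat) (k : closedFieldType) (F L : fieldType).
Variables (cst : {rmorphism k -> F}) (u : option k -> F) (v : option k -> F -> int).
Variables (iota : {rmorphism F -> L}) (D C : L -> L).
Hypotheses (k_char : p \in [pchar k]) (pts : function_field_points p cst u v).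
Hypothesis DD : forall a b, D (a + b) = D a + D b.
Hypothesis DM : forall a b, D (a * b) = D a * b + a * D b.
Hypothesis DC : forall c, D (iota (cst c)) = 0.
Hypothesis CD : forall a b, C (a + b) = C a + C b.
Hypothesis CM : forall a b, C (a ^+ p * b) = a * C b.
Hypothesis C_exact : forall a, C (D a) = 0.
Hypothesis C_log : forall a, C (a ^+ p.-1 * D a) = D a.
Variable lam : option k -> F.
Hypothesis lamP : forall P, [/\ lam P != 0, v P (lam P) = dlog_ord P
  & D (iota (u P)) = iota (lam P * u P)].

Let p_prime : prime p := pcharf_prime k_char.
Let p_gt0 : (0 < p)%N := prime_gt0 p_prime.

Lemma pt_leading P a : a != 0 -> exists2 c, c != 0 &
  vge (v P) (v P a + 1) (a - cst c * u P ^ v P a).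
Proof.
move=> a0; have val := pt_val pts P; have [u0 vu] := pt_unif pts P.
have un0 : u P ^ v P a != 0 by rewrite expfz_neq0.
have ou : v P (u P ^ v P a) = v P a by rewrite valXz // vu mul1r.
have oq : v P (a / u P ^ v P a) = 0 by rewrite val_div // ou subrr.
have q0 : a / u P ^ v P a != 0 by rewrite mulf_neq0 ?invr_eq0.
have [|c vc] := pt_residue pts (P := P) (a := a / u P ^ v P a); first by rewrite vgeE ?oq.
exists c.
  by apply: contraTneq vc => ->; rewrite rmorph0 subr0 vgeE // oq.
rewrite -[a in a - _](divfK un0) -mulrBl addrC; apply: (vgeM val) => //.
by rewrite vgeE // ou.
Qed.

Lemma vge_cst P c : vge (v P) 0 (cst c).
Proof.
case: (eqVneq c 0) => [->|c0]; first by rewrite rmorph0 vge0.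
by rewrite vgeE ?fmorph_eq0 // (pt_const pts).
Qed.

Lemma derivation1 : D 1 = 0.
Proof. by rewrite -(rmorph1 iota) -(rmorph1 cst) DC. Qed.

Lemma derivation_exprz a l j : a != 0 -> D a = l * a -> D (a ^ j) = j%:~R * l * a ^ j.
Proof.
move=> a0 Da; have Dn n : D (a ^+ n) = n%:R * l * a ^+ n.
  elim: n => [|n IHn]; first by rewrite expr0 derivation1 !mul0r.
  by rewrite exprS DM IHn Da -natr1; ring.
case: j => n; first by rewrite -exprnP Dn.
rewrite NegzE -exprnN; set b := a ^+ n.+1; have b0 : b != 0 by rewrite expf_neq0.
apply: (mulfI b0); have := derivation1; rewrite -(divff b0) DM Dn -/b.
move/eqP; rewrite addrC addr_eq0 => /eqP ->.
by rewrite mulrNz -pmulrn; field.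
Qed.

Lemma cartier0 : C 0 = 0.
Proof. by apply: (@addrI _ (C 0)); rewrite -CD !addr0. Qed.

Lemma cartier_sum (I : Type) (s : seq I) (G : I -> L) :
  C (\sum_(i <- s) G i) = \sum_(i <- s) C (G i).
Proof. by rewrite (big_morph C CD cartier0). Qed.

(** [lam P] is the logarithmic derivative Du / u, and Du / u = u^(-p) u^(p-1) Du. *)
Lemma cartier_lam P : C (iota (lam P)) = iota (lam P).
Proof.
have [l0 _ Du] := lamP P; have [u0 _] := pt_unif pts P.
have iu0 : iota (u P) != 0 by rewrite fmorph_eq0.
have e : iota (lam P) = (iota (u P))^-1 * D (iota (u P)).
  by rewrite Du rmorphM mulrC mulfK.
rewrite {2}e -C_log -CM; congr C; rewrite e.
by rewrite mulrA exprVn -{1}(prednK p_gt0) exprS invfM mulfVK ?expf_neq0.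
Qed.

Lemma k_root_p (c : k) : exists b, b ^+ p = c.
Proof.
have [b] := @solve_monicpoly k p (fun i => if i == 0%N then c else 0) p_gt0.
move=> e; exists b; rewrite e (bigD1 (Ordinal p_gt0)) //= expr0 mulr1 big1 ?addr0 // => i.
rewrite -val_eqE /= => /negPf->; exact: mul0r.
Qed.

(** If p does not divide j, then u^j du/u is the differential of u^j / j, which C kills; if j = p m,
    then u^m comes out of C and du/u is fixed. The scalar becomes a p-th root because C is only
    p^-1-linear. *)
Lemma cartier_monomial P c j : exists s,
  C (iota (cst c * u P ^ j * lam P)) = iota (s * lam P) /\
  (s = 0 \/ exists b m, [/\ b ^+ p = c, j = p%:Z * m & s = cst b * u P ^ m]).
Proof.
have [l0 _ Du] := lamP P; have [u0 _] := pt_unif pts P.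
have iu0 : iota (u P) != 0 by rewrite fmorph_eq0.
case: (boolP (p %| `|j|)%N) => [dvd|ndvd].
  have [m em] : exists m, j = p%:Z * m.
    by have /dvdzP[m ->] : (p%:Z %| j)%Z by []; exists m; rewrite mulrC.
  have [b eb] := k_root_p c.
  exists (cst b * u P ^ m); split; last by right; exists b, m.
  rewrite em -eb [p%:Z * m]mulrC -exprz_exp -exprnP rmorphXn -exprMn.
  by rewrite rmorphM rmorphXn CM cartier_lam -rmorphM.
exists 0; split; last by left.
have j0 : (j%:~R : k) != 0.
  case: j ndvd => n /=; first by rewrite (dvdn_pcharf k_char).
  by rewrite NegzE mulrNz oppr_eq0 -pmulrn (dvdn_pcharf k_char).
rewrite mul0r rmorph0 -(C_exact (iota (cst (c / j%:~R) * u P ^ j))); congr C.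
rewrite [in RHS]rmorphM DM DC mul0r add0r fmorphXz.
rewrite (derivation_exprz (l := iota (lam P))) ?Du ?rmorphM //.
rewrite -fmorphXz -(rmorph_int iota j) -(rmorph_int cst j) -!rmorphM.
congr (iota _); rewrite !mulrA -rmorphM divfK //; ring.
Qed.

(** Measured against du/u, C divides orders by p. This is checked termwise on a finite Laurent
    expansion, whose denominator is a p-th power. *)
Lemma cartier_point P a : exists b, C (iota (a * lam P)) = iota (b * lam P) /\
  forall n, vge (v P) n a -> vge (fun z => p%:Z * v P z) n b.
Proof.
have val := pt_val pts P; have [u0 vu] := pt_unif pts P.
case: (eqVneq a 0) => [->|a0].
  by exists 0; rewrite mul0r rmorph0 cartier0; split=> // n _; apply: vge0.
have wval : is_val (fun z => p%:Z * v P z) by apply: is_val_scale.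
have [b0 [n [c [j [bn0 lej eq]]]]] := pt_laurent pts P a0.
have [s sP] := fin_all_exists (fun i : 'I_n => cartier_monomial P (c i) (j i)).
exists (b0^-1 * \sum_i s i); split=> [|m].
  have -> : a * lam P = (b0^-1) ^+ p * \sum_(i < n) cst (c i) * u P ^ j i * lam P.
    by rewrite -mulr_suml -eq mulrA [_ * (a * _)]mulrC exprVn mulfK ?expf_neq0.
  rewrite [iota (_ ^+ _ * _)]rmorphM (rmorphXn iota) CM rmorph_sum cartier_sum.
  rewrite (eq_bigr _ (fun i _ => (sP i).1)) -rmorph_sum -rmorphM; congr (iota _).
  by rewrite -mulr_suml mulrA.
rewrite vgeE // => lem.
apply: (@vge_le _ _ (- (p%:Z * v P b0) + (v P a + p%:Z * v P b0))); first by lia.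
apply: (vgeM wval).
  by rewrite vgeE ?invr_eq0 // valV //; lia.
apply: (vge_sum wval) => i _; case: (sP i).2 => [->|[b [m' [_ em ->]]]]; first exact: vge0.
apply: vge_le (lej i (ltn_ord i)) _; rewrite em -[p%:Z * m']add0r.
apply: (vgeM wval); first by rewrite -[0](mulr0 p%:Z) vge_scale ?vge_cst //; lia.
by rewrite vgeE ?expfz_neq0 // valXz // vu mul1r.
Qed.

(** When p divides the order of [a], its leading term survives under C with order n, and the
    remainder, of order at least p n + 1, maps to order greater than n. *)
Lemma cartier_point_exact P a b n : a != 0 -> v P a = p%:Z * n ->
  C (iota (a * lam P)) = iota (b * lam P) -> b != 0 /\ v P b = n.
Proof.
move=> a0 van eb; have val := pt_val pts P; have [u0 vu] := pt_unif pts P.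
have [l0 _ _] := lamP P.
have wval : is_val (fun z => p%:Z * v P z) by apply: is_val_scale.
have [c c0 vc] := pt_leading P a0.
have [b' [eb' /(_ _ vc) vb']] := cartier_point P (a - cst c * u P ^ v P a).
have [d ed] := k_root_p c.
have d0 : d != 0 by apply: contraNneq c0 => d0; rewrite -ed d0 expr0n (gtn_eqF p_gt0).
have {}eb : b = cst d * u P ^ n + b'.
  apply: (mulIf l0); apply: (fmorph_inj iota); rewrite -eb mulrDl rmorphD -eb'.
  have -> : a * lam P = cst c * u P ^ v P a * lam P + (a - cst c * u P ^ v P a) * lam P by ring.
  rewrite [in LHS]rmorphD CD; congr (_ + _).
  rewrite van -ed [p%:Z * n]mulrC -exprz_exp -exprnP rmorphXn -exprMn.
  by rewrite rmorphM rmorphXn CM cartier_lam -rmorphM.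
have m0 : cst d * u P ^ n != 0 by rewrite mulf_neq0 ?fmorph_eq0 ?expfz_neq0.
have vm : v P (cst d * u P ^ n) = n.
  by rewrite (valM val) ?fmorph_eq0 ?expfz_neq0 // (pt_const pts) // add0r valXz // vu mul1r.
have [|n0 vb] := val_addl wval m0 (b := b'); first by rewrite /= vm -van.
by rewrite eb; split=> //; move: vb; rewrite vm => /mulfI; apply; lia.
Qed.

(** C preserves k(x) dx. Dividing by [lam P] passes from dx to du/u, in which the two estimates take
    the same form at infinity as at a finite point. *)
Lemma cartier_restrict : exists cF : F -> F, [/\ forall a, C (iota a) = iota (cF a),
  forall P n a, vge (v P) n (a / lam P) -> vge (fun z => p%:Z * v P z) n (cF a / lam P)
  & forall P n a, a != 0 -> v P (a / lam P) = p%:Z * n ->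
      cF a / lam P != 0 /\ v P (cF a / lam P) = n].
Proof.
have ex a : exists b, C (iota a) == iota b.
  have [l0 _ _] := lamP None; have [b [eb _]] := cartier_point None (a / lam None).
  by exists (b * lam None); rewrite -eb divfK.
pose cF a := xchoose (ex a); have cFP a : C (iota a) = iota (cF a) by apply/eqP/(xchooseP (ex a)).
have cE P a : C (iota (a / lam P * lam P)) = iota (cF a / lam P * lam P).
  by have [l0 _ _] := lamP P; rewrite !divfK.
exists cF; split=> // P n a.
  have [b [eb vb]] := cartier_point P (a / lam P); have [l0 _ _] := lamP P => /vb.
  suff -> : cF a / lam P = b by [].
  by apply: (mulIf l0); apply: (fmorph_inj iota); rewrite -eb -cE.
move=> a0 va; apply: cartier_point_exact va (cE P a).
by have [l0 _ _] := lamP P; rewrite mulf_neq0 ?invr_eq0.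
Qed.

End CartierRestriction.

Section ArtinSchreierValuation.
Variables (K : fieldType) (w : K -> int) (w_val : is_val w) (p : nat).
Hypothesis p_gt1 : (1 < p)%N.

Lemma as_val_neg z : z != 0 -> w z < 0 ->
  z ^+ p - z != 0 /\ w (z ^+ p - z) = p%:Z * w z.
Proof.
move=> z0 wz; have wp : w (z ^+ p) = p%:Z * w z by rewrite (valX w_val) // mulrC.
rewrite -wp; apply: val_addl => //; first by rewrite expf_neq0.
by rewrite (vgeN w_val) vgeE // wp; nia.
Qed.

Lemma as_vge_ge0 z : vge w 0 (z ^+ p - z) -> vge w 0 z.
Proof.
case: (eqVneq z 0) => [->|z0]; first by rewrite vge0.
rewrite [vge _ _ z]vgeE // leNgt => vR; apply/negP => wz.
have [R0 wR] := as_val_neg z0 wz; move: vR; rewrite vgeE // wR; nia.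
Qed.

Lemma as_val z : z ^+ p - z != 0 -> w (z ^+ p - z) < 0 ->
  z != 0 /\ p%:Z * w z = w (z ^+ p - z).
Proof.
move=> R0 wR; have z0 : z != 0.
  by apply: contraNneq R0 => ->; rewrite expr0n (gtn_eqF (ltnW p_gt1)) subrr.
split=> //; case: (ltrP (w z) 0) => [wz|wz]; first by have [_ ->] := as_val_neg z0 wz.
have : vge w 0 (z ^+ p - z).
  have v0 : vge w 0 z by rewrite vgeE.
  by apply: (vgeB w_val) => //; have := vgeX w_val p v0; rewrite mul0r.
by rewrite vgeE // leNgt wR.
Qed.

End ArtinSchreierValuation.

(** * The Witt tower *)

Section WittTower.
Variables (p : nat) (F : fieldType) (L : fieldExtType F) (f h : F) (y1 y2 : L).
Variables (v : F -> int) (d : nat).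
Hypotheses (charF : p \in [pchar F]) (p_gt2 : (2 < p)%N).
Hypotheses (y1E : y1 ^+ p - y1 = f%:A) (y2E : y2 ^+ p - y2 = witt_g p y1 + h%:A).
Hypothesis gen : (<<<<1; y1>>; y2>> = fullv)%VS.
Hypotheses (v_val : is_val v) (f0 : f != 0) (vf : v f = - d%:Z).
Hypotheses (d_gt0 : (0 < d)%N) (dvd_d : ~~ (p %| d)%N).

Local Notation iota := (in_alg L).
Local Notation ev q := (map_poly iota q).[y1].

Let p_prime : prime p := pcharf_prime charF.
Let p_gt1 : (1 < p)%N := prime_gt1 p_prime.
Let charL : p \in [pchar L].
Proof. by rewrite (pchar_lalg L). Qed.

Lemma as_no_root (a : F) : a != 0 -> v a = - d%:Z -> forall r, r ^+ p - r <> a.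
Proof.
move=> a0 va r e; have [||r0] := @as_val F v v_val p p_gt1 r; rewrite ?e ?va //; first by lia.
move=> pv; have : (p%:Z %| - d%:Z)%Z by rewrite -pv dvdz_mulr.
by rewrite dvdzE abszN /= (negPf dvd_d).
Qed.

Lemma y1_notin : y1 \notin 1%AS.
Proof.
apply/negP => /vlineP[r e]; apply: (@as_no_root f f0 vf r).
by apply: (fmorph_inj iota); rewrite rmorphB rmorphXn /= -e y1E.
Qed.

Lemma ev_eq0 (q : {poly F}) : (size q <= p)%N -> ev q = 0 -> q = 0.
Proof.
move=> sq eq; apply: (map_poly_inj iota); rewrite rmorph0.
apply: (artin_schreier_free charL _ y1_notin) eq; rewrite ?size_map_poly //.
  by rewrite y1E rpredZ ?rpred1.
by apply/polyOver1P; exists q.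
Qed.

Lemma ev_asP : ev (asP p f) = 0.
Proof.
rewrite /asP !(rmorphB, rmorphD) /= map_polyXn map_polyX map_polyC !hornerE /=.
by rewrite opprD addrA y1E subrr.
Qed.

Lemma ev_mod q : ev (q %% asP p f) = ev q.
Proof.
rewrite [in RHS](divp_eq q (asP p f)) rmorphD rmorphM hornerD hornerM ev_asP mulr0.
by rewrite add0r.
Qed.

(** Suppose y2 = r(y1) with deg r < p. In terms of y1^p = y1 + f, the coefficient of y1^(p-1) in
    r(y1)^p - r(y1) = g(y1) + h reads c^p - c = -f for c the top coefficient of r: only the term l =
    1 of g reaches degree p - 1. The order of f, prime to p, forbids this. *)
Lemma y2_notin : y2 \notin <<1; y1>>%AS.
Proof.
apply/negP => /Fadjoin1_polyP[q0]; rewrite -ev_mod; set r := _ %% _ => e2.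
have sr : (size r <= p)%N by apply: size_mod_asP.
have evXf : ev ('X + f%:P) = y1 ^+ p.
  by rewrite rmorphD /= map_polyX map_polyC !hornerE /= -y1E addrC subrK.
have evC c : ev c%:P = iota c by rewrite map_polyC hornerC.
pose E : {poly F} := \sum_(i < p) (r`_i ^+ p)%:P * ('X + f%:P) ^+ i - r
  - (\sum_(1 <= l < p) ((wbin p l)%:R * (- f) ^+ l)%:P * ('X + f%:P) ^+ (p - l) + h%:P).
have szXf i : (size (('X + f%:P) ^+ i) <= i.+1)%N.
  by apply: leq_trans (size_poly_exp_leq _ _) _; rewrite size_XaddC mul1n.
have E0 : E = 0.
  apply: ev_eq0.
    rewrite /E; apply: leq_trans (size_polyD _ _) _; rewrite geq_max size_polyN.
    apply/andP; split.
      apply: leq_trans (size_polyD _ _) _; rewrite geq_max size_polyN sr andbT.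
      apply: leq_trans (size_sum _ _ _) _; apply/bigmax_leqP => i _.
      rewrite mul_polyC; apply: leq_trans (size_scale_leq _ _) _.
      by apply: leq_trans (szXf i) _; apply: ltn_ord.
    apply: leq_trans (size_polyD _ _) _; rewrite geq_max; apply/andP; split; last first.
      by apply: leq_trans (size_polyC_leq1 _) _; apply: ltnW.
    rewrite big_nat; apply: leq_trans (size_sum _ _ _) _; apply/bigmax_leqP_seq => i _ lti.
    rewrite mul_polyC; apply: leq_trans (size_scale_leq _ _) _.
    by apply: leq_trans (szXf _) _; lia.
  rewrite /E !(rmorphB, rmorphD) !hornerE /= -e2 evC.
  have -> : ev (\sum_(i < p) (r`_i ^+ p)%:P * ('X + f%:P) ^+ i) = y2 ^+ p.
    rewrite e2 [in RHS](@horner_coef_wide _ p) ?size_map_poly //.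
    have z0 : 0 ^+ p = 0 :> L by rewrite expr0n (gtn_eqF (prime_gt0 p_prime)).
    rewrite (big_morph (fun z : L => z ^+ p) (exprD_char charL) z0).
    rewrite rmorph_sum horner_sum; apply: eq_bigr => i _.
    rewrite coef_map exprMn -!exprM mulnC exprM.
    by rewrite rmorphM hornerM evC !rmorphXn horner_exp evXf.
  have -> : ev (\sum_(1 <= l < p) ((wbin p l)%:R * (- f) ^+ l)%:P * ('X + f%:P) ^+ (p - l)) = witt_g p y1.
    rewrite (witt_gE p_prime) // rmorph_sum horner_sum; apply: eq_bigr => l _.
    rewrite rmorphM hornerM evC rmorphM !rmorphXn horner_exp evXf rmorphN rmorph_nat.
    by rewrite -exprM /= -y1E opprB.
  by rewrite -y2E; ring.
have := congr1 (fun q : {poly F} => q`_p.-1) E0.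
have cXf i : (i < p)%N -> (('X + f%:P) ^+ i)`_p.-1 = (i == p.-1)%:R.
  move=> lti; case: eqP => [->|ne]; last first.
    by rewrite nth_default //; apply: leq_trans (szXf i) _; lia.
  have mon : ('X + f%:P) ^+ p.-1 \is monic by rewrite monic_exp ?monicXaddC.
  by have := monicP mon; rewrite lead_coefE size_exp size_XaddC mul1n.
rewrite coef0 /E !(coefB, coefD) !coef_sum coefC (gtn_eqF (_ : 0 < p.-1)%N) ?addr0; last by lia.
rewrite (bigD1 (Ordinal (_ : p.-1 < p)%N)) //=; first by lia.
move=> ltp; rewrite coefCM cXf // eqxx mulr1 big1 => [|i ne]; last first.
  by rewrite coefCM cXf // (negPf (_ : val i != p.-1)) ?mulr0.
rewrite addr0 big_ltn // coefCM cXf ?subn1 // eqxx mulr1 big_nat big1 => [|i lti]; last first.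
  by rewrite coefCM cXf ?(ltn_eqF (_ : p - i < p.-1)%N) ?mulr0 //; lia.
rewrite /wbin bin1 divnn (prime_gt0 p_prime) expr1 mul1r addr0 opprK => /eqP.
rewrite addr_eq0 => /eqP; apply: as_no_root; rewrite ?oppr_eq0 //.
by rewrite (valN v_val).
Qed.

Lemma tower_free (B : nat -> {poly F}) : (forall j, (size (B j) <= p)%N) ->
  \sum_(j < p) y2 ^+ j * ev (B j) = 0 -> forall j, (j < p)%N -> B j = 0.
Proof.
move=> sB e j ltj; apply: ev_eq0 => //.
pose Q := \poly_(j < p) ev (B j).
suff Q0 : Q = 0 by have := congr1 (fun q : {poly L} => q`_j) Q0; rewrite coef_poly ltj coef0.
have evK q : ev q \in <<1; y1>>%AS by apply/Fadjoin1_polyP; exists q.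
apply: (artin_schreier_free charL _ y2_notin); rewrite ?size_poly //.
- rewrite y2E (witt_gE p_prime) // rpredD ?rpred_sum // => [l _|].
    rewrite !rpredM ?rpredX ?rpred_nat ?rpredB ?rpredX //; exact: memv_adjoin.
  by apply: (subvP (subv_adjoin _ _)); rewrite rpredZ ?rpred1.
- by apply/polyOver_poly => i _; apply: evK.
by rewrite horner_poly -[RHS]e; apply: eq_bigr => i _; rewrite mulrC.
Qed.

(** A translate of y2 by an element of F(y1) generates the same extension of F(y1), so its powers
    below p span as well. *)
Lemma tower_span (t : {poly F}) (w : L) : exists2 B : nat -> {poly F},
  forall j, (size (B j) <= p)%N & w = \sum_(j < p) (y2 - ev t) ^+ j * ev (B j).
Proof.
set rho := y2 - ev t.
have evK q : ev q \in <<1; y1>>%AS by apply/Fadjoin1_polyP; exists q.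
have eqK : (<<<<1; y1>>; rho>> = <<<<1; y1>>; y2>>)%VS.
  apply/eqP; rewrite eqEsubv; apply/andP; split; apply/FadjoinP; split=> /=;
    rewrite ?subv_adjoin //.
    by rewrite rpredB ?memv_adjoin //; apply: (subvP (subv_adjoin _ _)); apply: evK.
  rewrite -[y2](subrK (ev t)) -/rho rpredD ?memv_adjoin //.
  by apply: (subvP (subv_adjoin _ _)); apply: evK.
have y2K : y2 ^+ p - y2 \in <<1; y1>>%AS.
  rewrite y2E (witt_gE p_prime) // rpredD ?rpred_sum // => [l _|].
    rewrite !rpredM ?rpredX ?rpred_nat ?rpredB ?rpredX //; exact: memv_adjoin.
  by apply: (subvP (subv_adjoin _ _)); rewrite rpredZ ?rpred1.
have deg : adjoin_degree <<1; y1>>%AS rho = p.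
  rewrite -(artin_schreier_degree charL y2K y2_notin).
  by apply/eqP; rewrite !adjoin_degreeE eqK.
have win : w \in <<<<1; y1>>%AS; rho>>%VS by rewrite eqK gen memvf.
have := Fadjoin_poly_eq win; have := size_Fadjoin_poly <<1; y1>>%AS rho w.
have := Fadjoin_polyOver <<1; y1>>%AS rho w.
set Q := Fadjoin_poly _ _ _ => /polyOverP QK; rewrite deg => sQ ew.
have ex j : exists q : {poly F}, Q`_j == ev (q %% asP p f).
  by have /Fadjoin1_polyP[q e] := QK j; exists q; rewrite ev_mod e.
exists (fun j => xchoose (ex j) %% asP p f) => [j|]; first exact: size_mod_asP.
rewrite -ew (@horner_coef_wide _ p) //; apply: eq_bigr => j _.
by rewrite mulrC; congr (_ * _); apply/eqP/(xchooseP (ex j)).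
Qed.

End WittTower.

(** * Expansion of the Cartier operator *)

Section CartierExpansion.
Variables (p : nat) (F L : fieldType) (iota : {rmorphism F -> L}) (C : L -> L) (cF : F -> F).
Hypotheses (charF : p \in [pchar F]) (p_gt2 : (2 < p)%N).
Hypothesis CD : forall a b, C (a + b) = C a + C b.
Hypothesis CM : forall a b, C (a ^+ p * b) = a * C b.
Hypothesis C_iota : forall a, C (iota a) = iota (cF a).
Variables (f h : F) (y1 y2 : L) (theta : {poly F}).
Hypothesis y1E : y1 ^+ p - y1 = iota f.
Hypothesis y2E : y2 ^+ p - y2 = witt_g p y1 + iota h.

Local Notation evp q z := (map_poly iota q).[z].

Let p_prime : prime p := pcharf_prime charF.
Let charL : p \in [pchar L]. Proof. by rewrite (fmorph_pchar iota). Qed.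

Lemma cF0 : cF 0 = 0.
Proof.
apply: (fmorph_inj iota); rewrite -C_iota rmorph0.
by apply: (@addrI _ (C 0)); rewrite -CD !addr0.
Qed.

Lemma cFD a b : cF (a + b) = cF a + cF b.
Proof. by apply: (fmorph_inj iota); rewrite -C_iota !rmorphD CD -!C_iota. Qed.

Lemma map_cF_coef q i : (map_poly cF q)`_i = cF q`_i.
Proof. by rewrite coef_map_id0 // cF0. Qed.

Lemma size_map_cF q : (size (map_poly cF q) <= size q)%N.
Proof. exact: size_poly. Qed.

Lemma cartier_evp q (z w : L) : C (w ^+ p * evp q (z ^+ p)) = w * evp (map_poly cF q) z.
Proof.
rewrite CM; congr (_ * _).
have C0 : C 0 = 0 by rewrite -(rmorph0 iota) C_iota cF0.
rewrite horner_coef size_map_poly (big_morph C CD C0).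
rewrite (@horner_coef_wide _ (size q)); last first.
  by rewrite size_map_poly size_map_cF.
apply: eq_bigr => i _.
by rewrite !coef_map /= map_cF_coef -exprM mulnC exprM mulrC CM C_iota mulrC.
Qed.

(* y2^p - (y2 - theta(y1)) as a polynomial in y1^p: this is g(y1) + h + theta(y1). *)
Definition witt_main : {poly F} :=
  \sum_(1 <= l < p) ((wbin p l)%:R * (- f) ^+ l) *: 'X^(p - l).
Definition witt_rest : {poly F} := h%:P + (theta \Po ('X - f%:P)).

Lemma witt_rhsE : evp (witt_main + witt_rest) (y1 ^+ p) =
  y2 ^+ p - (y2 - evp theta y1).
Proof.
have fE : iota f = y1 ^+ p - y1 by rewrite y1E.
have -> : y2 ^+ p - (y2 - evp theta y1) = witt_g p y1 + iota h + evp theta y1.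
  by rewrite -y2E; ring.
rewrite /witt_main /witt_rest !rmorphD /= !hornerD map_polyC hornerC addrA; congr (_ + _ + _).
  rewrite (witt_gE p_prime) // rmorph_sum horner_sum; apply: eq_bigr => l _.
  rewrite /= map_polyZ hornerZ map_polyXn hornerXn -exprM; congr (_ * _).
  by rewrite rmorphM rmorph_nat rmorphXn rmorphN /= fE opprB.
by rewrite map_comp_poly horner_comp rmorphB /= map_polyX map_polyC !hornerE /= fE; congr _.[_]; ring.
Qed.

(** The coefficient of y2^(p j) in rho^a2 y1^a1 r, as a polynomial in y1^p: rho is replaced by y2^p
    - ([witt_main] + [witt_rest])(y1^p), and y1 by y1^p - f. *)
Definition expansion (a1 a2 : nat) (r : F) (j : nat) : {poly F} :=
  (r *: ((- (witt_main + witt_rest)) ^+ (a2 - j) * ('X - f%:P) ^+ a1)) *+ 'C(a2, j).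

Definition cartier_coef (a1 a2 : nat) (r : F) (j : nat) : {poly F} :=
  map_poly cF (expansion a1 a2 r j) %% asP p f.

Lemma evp_mod q : evp (q %% asP p f) y1 = evp q y1.
Proof.
have ev0 : evp (asP p f) y1 = 0.
  by rewrite /asP !(rmorphB, rmorphD) /= map_polyXn map_polyX map_polyC !hornerE /= -y1E; ring.
by rewrite [in RHS](divp_eq q (asP p f)) rmorphD rmorphM hornerD hornerM ev0 mulr0 add0r.
Qed.

Lemma cartier_expansion a1 a2 r : (a2 < p)%N ->
  C ((y2 - evp theta y1) ^+ a2 * y1 ^+ a1 * iota r) =
    \sum_(j < p) y2 ^+ j * evp (cartier_coef a1 a2 r j) y1.
Proof.
move=> a2_p; have C0 : C 0 = 0 by rewrite -(rmorph0 iota) C_iota cF0.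
have -> : (y2 - evp theta y1) ^+ a2 * y1 ^+ a1 * iota r =
    \sum_(j < p) (y2 ^+ j) ^+ p * evp (expansion a1 a2 r j) (y1 ^+ p).
  have -> : y2 - evp theta y1 = evp (- (witt_main + witt_rest)) (y1 ^+ p) + y2 ^+ p.
    by rewrite rmorphN hornerN witt_rhsE; ring.
  rewrite exprDn (big_ord_widen p (fun j => evp (- (witt_main + witt_rest)) (y1 ^+ p) ^+ (a2 - j) * (y2 ^+ p) ^+ j *+ 'C(a2, j))) // !mulr_suml.
  rewrite big_mkcond; apply: eq_bigr => j _; rewrite /expansion.
  have evy : evp ('X - f%:P) (y1 ^+ p) = y1.
    by rewrite rmorphB /= map_polyX map_polyC !hornerE /= -y1E; ring.
  rewrite raddfMn hornerMn /= map_polyZ hornerZ rmorphM hornerM !rmorphXn /= !horner_exp evy.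
  case: ltnP => [ltj|/bin_small->]; last by rewrite mulr0n mulr0.
  rewrite -!exprM [(p * j)%N]mulnC.
  rewrite mulrnAl mulrnAl mulrnAr; congr (_ *+ _); rewrite -!mulrA mulrCA; congr (_ * _).
  by rewrite [RHS]mulrC mulrA.
rewrite (big_morph C CD C0); apply: eq_bigr => j _.
by rewrite cartier_evp /cartier_coef evp_mod.
Qed.

End CartierExpansion.

(** * Orders of the coefficients at one point *)

Section ValuedField.
Variables (p : nat) (F : fieldType) (v : F -> int).
Hypotheses (charF : p \in [pchar F]) (v_val : is_val v).

(** In characteristic p one has n^p = n, hence p v(n) = v(n). *)
Lemma nat_val (n : nat) : ~~ (p %| n)%N -> (n%:R : F) != 0 /\ v n%:R = 0.
Proof.
move=> ndvd; have n0 : (n%:R : F) != 0 by rewrite -(dvdn_pcharf charF).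
split=> //; have := valX v_val p n0; rewrite (natrX_char charF).
by move: (v _) => z; nia.
Qed.

Lemma wt_main (f : F) (d : nat) : vge v (- d%:Z) f -> wt v d (p * d)%N (witt_main p f).
Proof.
move=> vf; rewrite /witt_main big_nat; apply: (wt_sum v_val) => i lti.
apply: wt_le (wtZ v_val (M := d%:Z * i%:Z) (N := d%:Z * (p - i)%N%:Z) _ _).
- by rewrite -mulrDr -PoszD subnKC ?(ltnW (andP lti).2) // PoszM mulrC.
- rewrite -[- _]add0r; apply: (vgeM v_val); first exact: (vge_nat v_val).
  by rewrite -mulNr; apply: (vgeX v_val); rewrite (vgeN v_val).
exact: (wtXn v_val).
Qed.

End ValuedField.

Section PointEstimates.
Variables (p : nat) (F : fieldType) (cF : F -> F).
Hypotheses (charF : p \in [pchar F]) (p_gt2 : (2 < p)%N).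
Hypothesis cFD : forall a b, cF (a + b) = cF a + cF b.
Variables (f h : F) (theta : {poly F}) (v : F -> int) (l : F).
Hypotheses (v_val : is_val v) (l0 : l != 0).
Let pv (a : F) : int := p%:Z * v a.
Hypothesis cF_bound : forall n a, vge v n (a / l) -> vge pv n (cF a / l).
Hypothesis cF_exact : forall n a, a != 0 -> v (a / l) = p%:Z * n ->
  cF a / l != 0 /\ v (cF a / l) = n.

Let p_prime : prime p := pcharf_prime charF.
Let p_gt1 : (1 < p)%N := prime_gt1 p_prime.
Let pv_val : is_val pv. Proof. exact: is_val_scale. Qed.
Local Notation main := (witt_main p f).
Local Notation rest := (witt_rest f h theta).
Local Notation expansion := (expansion p f h theta).
Local Notation cc := (cartier_coef p cF f h theta).

Let cF0 : cF 0 = 0.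
Proof. by apply: (@addrI _ (cF 0)); rewrite -cFD !addr0. Qed.

Let coef_map_cF q i : (map_poly cF q)`_i = cF q`_i.
Proof. by rewrite coef_map_id0 // cF0. Qed.

Lemma wt_expansion (d DD : nat) (o : int) a1 a2 r j : vge v (- d%:Z) f ->
  wt v d DD (main + rest) -> vge v o (r / l) ->
  wt v d (DD%:Z * (a2 - j)%N%:Z + d%:Z * a1%:Z - o) (l^-1 *: expansion a1 a2 r j).
Proof.
move=> vf wG vr; rewrite /expansion -scalerMnr scalerA [l^-1 * r]mulrC; apply: (wt_mulrn v_val).
rewrite addrC; apply: (wtZ v_val); first by rewrite opprK.
apply: (wtM v_val); first by apply: (wt_exp v_val); apply: (wtN v_val).
by apply: (wt_exp v_val); apply: (wtB v_val (wtX v_val _)); apply: wtC.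
Qed.

Lemma wt_map_cF (d : nat) M q : wt v d M (l^-1 *: q) -> wt pv d M (l^-1 *: map_poly cF q).
Proof.
move=> wq i; rewrite coefZ coef_map_cF [l^-1 * _]mulrC; apply: cF_bound.
by rewrite [_ / l]mulrC -coefZ; apply: wq.
Qed.

(** The variable stands for y1^p before C and for y1 after it. Measured by v and by p v
    respectively, both have order -d, so the weight M is kept. *)
Lemma wt_mod_cF (d : nat) M q : vge v (- d%:Z) f -> wt v d M (l^-1 *: q) ->
  wt pv d M (l^-1 *: (map_poly cF q %% asP p f)).
Proof.
move=> vf /wt_map_cF wq; rewrite -modpZl; apply: (wt_mod pv_val) => //.
by rewrite -mulrN /pv vge_scale //; lia.
Qed.

Lemma cc_above a1 a2 r j : (a2 < j)%N -> cc a1 a2 r j = 0.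
Proof.
move=> lt; rewrite /cartier_coef /expansion bin_small // mulr0n.
have -> : map_poly cF 0 = 0 by apply/polyP => i; rewrite coef_map_cF !coef0.
exact: mod0p.
Qed.

(** The expansion is split into a part q1 known exactly and a part q2 of smaller weight. The order
    of the coefficient of q1 is divisible by p, so C keeps it sharp, while q2 contributes only to
    higher order. *)
Lemma cc_leading a1 a2 r j i (t : int) q1 q2 (d : nat) M :
  vge v (- d%:Z) f -> expansion a1 a2 r j = q1 + q2 ->
  wt v d (M - 1) (l^-1 *: q2) -> d%:Z * i%:Z - M = p%:Z * t ->
  (map_poly cF q1 %% asP p f)`_i = cF q1`_i ->
  q1`_i != 0 -> v (q1`_i / l) = p%:Z * t ->
  (cc a1 a2 r j)`_i / l != 0 /\ v ((cc a1 a2 r j)`_i / l) = t.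
Proof.
move=> vf e wq2 et e1 n0 v1; have [c0 vc] := cF_exact n0 v1.
have -> : cc a1 a2 r j = map_poly cF q1 %% asP p f + map_poly cF q2 %% asP p f.
  rewrite /cartier_coef e -modpD; congr (_ %% _).
  by apply/polyP => n; rewrite coefD !coef_map_cF coefD cFD.
have /(_ i) := wt_mod_cF vf wq2; rewrite coefZ [l^-1 * _]mulrC => b2.
rewrite coefD mulrDl e1.
have [|s0 vs] := val_addl pv_val c0 (b := (map_poly cF q2 %% asP p f)`_i / l).
  by apply: vge_le b2; rewrite /pv vc -et; lia.
by split=> //; move: vs; rewrite /pv vc => /mulfI; apply; lia.
Qed.


Lemma mod_map_small (q : {poly F}) i : (size q <= p)%N -> (map_poly cF q %% asP p f)`_i = cF q`_i.
Proof.
move=> sq; rewrite modp_small ?coef_map_cF // asP_size // ltnS.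
exact: leq_trans (size_poly _ _) sq.
Qed.

Lemma expansion_top a1 a2 r : expansion a1 a2 r a2 = r *: ('X - f%:P) ^+ a1.
Proof. by rewrite /expansion subnn expr0 mul1r binn. Qed.

Lemma cc_top_above a1 a2 r i : (a1 < p)%N -> (a1 < i)%N -> (cc a1 a2 r a2)`_i = 0.
Proof.
move=> lt1 lti; rewrite /cartier_coef expansion_top mod_map_small.
  by rewrite nth_default ?cF0 //; apply: leq_trans (size_scale_leq _ _) _; rewrite size_exp_XsubC.
by apply: leq_trans (size_scale_leq _ _) _; rewrite size_exp_XsubC.
Qed.

Lemma nat_prime_ndvd n : (0 < n < p)%N -> ~~ (p %| n)%N.
Proof. by move=> /andP[n_gt0 ltn]; apply/negP => /(dvdn_leq n_gt0); lia. Qed.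

Lemma bin_ndvd n m : (m <= n < p)%N -> ~~ (p %| 'C(n, m))%N.
Proof.
move=> /andP[le_mn lt_np]; apply/negP => dvd.
have : (p %| n`!)%N by rewrite -(bin_fact le_mn) dvdn_mulr.
elim: n lt_np {le_mn dvd} => [|n IHn] lt_np; first by rewrite dvdn1; case: eqP p_gt2 => // ->.
rewrite factS Euclid_dvdM // => /orP[|]; last by apply/negP/negPn/IHn/ltnW.
by apply/negP; apply: nat_prime_ndvd.
Qed.

Section WildPoint.
Variables (d : nat) (a1 a2 : nat) (r : F) (vs t : int) (b : nat).
Hypotheses (f0 : f != 0) (vf : v f = - d%:Z) (wt_rest : wt v d (p%:Z * d%:Z - 1) rest).
Hypotheses (r0 : r != 0) (vr : v (r / l) = - vs) (a1_p : (a1 < p)%N) (a2_p : (a2 < p)%N).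
Hypothesis (bt : d%:Z * b%:Z + vs = p%:Z * t).

Let vge_f : vge v (- d%:Z) f. Proof. by rewrite vgeE // vf. Qed.

Let val_term (c : F) i : c != 0 -> v c = 0 ->
  v (r * (c * (- f) ^+ i) / l) = - vs - d%:Z * i%:Z.
Proof.
move=> c0 vc; have nf0 : - f != 0 by rewrite oppr_eq0.
rewrite mulrAC (valM v_val) ?mulf_neq0 ?invr_eq0 ?expf_neq0 // vr.
by rewrite (valM v_val) ?expf_neq0 // vc (valX v_val) // (valN v_val) vf; lia.
Qed.

(** With j = a2 no factor rho is expanded, and y1^(a1-b) arises from (y1^p - f)^a1 with the
    coefficient 'C(a1, b) (-f)^b. *)
Lemma cc_wild_low : (b <= a1)%N ->
  (cc a1 a2 r a2)`_(a1 - b) / l != 0 /\ v ((cc a1 a2 r a2)`_(a1 - b) / l) = - t.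
Proof.
move=> le_b; have eC : (expansion a1 a2 r a2)`_(a1 - b) = r * ('C(a1, a1 - b)%:R * (- f) ^+ b).
  rewrite expansion_top coefZ coef_XsubC_exp ?leq_subr // subKn //.
  by rewrite -[(_ *+ _) in LHS]mulr_natl.
have [|c0 vc] := @nat_val p F v charF v_val 'C(a1, a1 - b); first by rewrite bin_ndvd // leq_subr.
have nf0 : - f != 0 by rewrite oppr_eq0.
apply: (@cc_leading _ _ _ _ _ _ (expansion a1 a2 r a2) 0 d (d%:Z * a1%:Z + vs)) => //.
- by rewrite addr0.
- by rewrite scaler0; apply: wt0.
- by rewrite -subzn //; lia.
- rewrite mod_map_small // expansion_top; apply: leq_trans (size_scale_leq _ _) _.
  by rewrite size_exp_XsubC.
- by rewrite eC !mulf_neq0 ?expf_neq0.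
by rewrite eC val_term //; lia.
Qed.

(** The product is homogeneous of degree p + a1 in X and f, so the coefficient is an integer times
    (-f)^b. The summands with i > b have degree too small to contribute. *)
Lemma coef_main_shift : (a1 < b < p)%N ->
  (main * ('X - f%:P) ^+ a1)`_(a1 + p - b) =
    (\sum_(1 <= i < b.+1) wbin p i * 'C(a1, b - i))%N%:R * (- f) ^+ b.
Proof.
move=> /andP[ltab ltbp]; rewrite /witt_main mulr_suml coef_sum natr_sum mulr_suml.
rewrite [LHS](big_cat_nat (n := b.+1)) //=.
have termE i : (0 < i < p)%N ->
    ((((wbin p i)%:R * (- f) ^+ i) *: 'X^(p - i)) * ('X - f%:P) ^+ a1)`_(a1 + p - b) =
    (wbin p i)%:R * (- f) ^+ i *
      (if (a1 + p - b < p - i)%N then 0 else (('X - f%:P) ^+ a1)`_(a1 + i - b)).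
  move=> lti; rewrite -scalerAl coefZ [_ * ('X - _) ^+ _]mulrC coefMXn.
  by congr (_ * _); case: ltnP => // le; congr (_`__); lia.
rewrite [X in _ + X]big_nat [X in _ + X]big1 ?addr0 => [|i lti]; last first.
  rewrite termE; last by lia.
  rewrite ifF; last by apply/negbTE; lia.
  by rewrite nth_default ?mulr0 // size_exp_XsubC; lia.
apply: eq_big_nat => i lti; rewrite termE; last by lia.
case: ltnP => [lt|le].
  by rewrite (@bin_small a1) ?muln0 ?mulr0 ?mul0r //; lia.
rewrite coef_XsubC_exp; last by lia.
have -> : 'C(a1, a1 + i - b) = 'C(a1, b - i).
  by rewrite -(@bin_sub a1 (b - i)); [congr 'C(_, _); lia | lia].
have -> : (- f) ^+ b = (- f) ^+ i * (- f) ^+ (a1 - (a1 + i - b)).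
  by rewrite -exprD; congr (_ ^+ _); lia.
rewrite natrM -mulr_natr; ring.
Qed.

(** As y1^a1 alone cannot absorb the shift b, one factor rho is spent on [main], in a2 ways. The
    leading integer is a2 times the sum of [wbin_conv_ndvd], and [rest] has smaller weight than
    [main]. *)
Lemma cc_wild_high : (a1 < b < p)%N -> (0 < a2)%N ->
  (cc a1 a2 r a2.-1)`_(a1 + p - b) / l != 0 /\ v ((cc a1 a2 r a2.-1)`_(a1 + p - b) / l) = - t.
Proof.
move=> ltb a2_gt0; have /andP[ltab ltbp] := ltb.
pose q1 := (r *: (- main * ('X - f%:P) ^+ a1)) *+ a2.
pose q2 := (r *: (- rest * ('X - f%:P) ^+ a1)) *+ a2.
set s := (\sum_(1 <= i < b.+1) wbin p i * 'C(a1, b - i))%N.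
have [s0 vs0] : ((a2 * s)%:R : F) != 0 /\ v (a2 * s)%:R = 0.
  apply: (nat_val charF v_val); rewrite Euclid_dvdM // negb_or (wbin_conv_ndvd p_prime ltb) andbT.
  by apply: nat_prime_ndvd; rewrite a2_gt0.
have eC : q1`_(a1 + p - b) = r * (- (a2 * s)%:R * (- f) ^+ b).
  rewrite coefMn coefZ [- main * _]mulNr coefN coef_main_shift // -/s natrM -mulr_natr; ring.
have nf0 : - f != 0 by rewrite oppr_eq0.
have szq1 : (size q1 <= p + a1)%N.
  rewrite /q1 -scaler_nat; apply: leq_trans (size_scale_leq _ _) _.
  apply: leq_trans (size_scale_leq _ _) _.
  apply: leq_trans (size_polyMleq _ _) _; rewrite size_exp_XsubC size_polyN addnS /=.
  rewrite leq_add2r /witt_main big_nat; apply: leq_trans (size_sum _ _ _) _.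
  apply/bigmax_leqP_seq => i _ lti; apply: leq_trans (size_scale_leq _ _) _.
  by rewrite size_polyXn; lia.
apply: (@cc_leading _ _ _ _ _ _ q1 q2 d (p%:Z * d%:Z + d%:Z * a1%:Z + vs)) => //.
- rewrite /expansion /q1 /q2 -mulrnDl -scalerDr -mulrDl -opprD.
  have -> : (a2 - a2.-1 = 1)%N by lia.
  by rewrite expr1; congr (_ *+ _); rewrite -{1}(prednK a2_gt0) binSn prednK.
- rewrite /q2 -scalerMnr scalerA [l^-1 * r]mulrC; apply: (wt_mulrn v_val).
  have -> : p%:Z * d%:Z + d%:Z * a1%:Z + vs - 1 = vs + (p%:Z * d%:Z - 1 + d%:Z * a1%:Z) by ring.
  apply: (wtZ v_val); first by rewrite vgeE ?vr // mulf_neq0 ?invr_eq0.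
  apply: (wtM v_val); first exact: (wtN v_val).
  by apply: (wt_exp v_val); apply: (wtB v_val (wtX v_val _)); apply: wtC.
- by rewrite -subzn ?PoszD; lia.
(* b < p puts the index above a1, and a1 < b puts it below p: this is the range that reduction
   leaves untouched. *)
- rewrite (coef_mod_asP _ (s := a1)) ?coef_map_cF //; last by lia.
  by apply: leq_trans szq1; apply: size_poly.
- by rewrite eC !mulf_neq0 ?expf_neq0 ?oppr_eq0.
by rewrite eC val_term ?oppr_eq0 ?(valN v_val) //; lia.
Qed.

End WildPoint.

Section TamePoint.
Variables (e : nat) (a1 a2 : nat) (r : F) (vs : int).
Hypotheses (e_gt0 : (0 < e)%N) (vf : vge v 0 f) (h0 : h != 0) (vh : v h = - e%:Z).
Hypothesis wt_theta : wt v 0 0 theta.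
Hypotheses (r0 : r != 0) (vr : v (r / l) = - vs) (a1_p : (a1 < p)%N) (a2_p : (a2 < p)%N).

Let vf0 : vge v (- 0%:Z) f. Proof. by rewrite oppr0. Qed.

Let approx (n : nat) : {poly F} := (- h%:P) ^+ n.

(** Outside B1 both g(y1) and theta(y1) are regular, so the polynomial is -h up to weight 0. Each
    term of the difference of n-th powers has traded at least one factor of weight e for a regular
    one. *)
Lemma wt_tame_diff (n : nat) :
  wt v 0 (e%:Z * n%:Z - 1) ((- (main + rest)) ^+ n - approx n).
Proof.
have wG : wt v 0 0 (- (main + rest) + h%:P).
  have -> : - (main + rest) + h%:P = - (main + (theta \Po ('X - f%:P))).
    by rewrite /witt_rest; ring.
  apply: (wtN v_val); apply: (wtD v_val); last exact: (wt_comp_sub v_val).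
  by have := @wt_main p F v v_val f 0 vf0; rewrite muln0.
have wh : wt v 0 e (- h%:P) by apply: (wtN v_val); apply: wtC; rewrite vgeE ?vh.
have wGe : wt v 0 e (- (main + rest)).
  rewrite -[- _](addrK h%:P) ; apply: (wtD v_val) => //.
  by apply: wt_le wG.
rewrite /approx subrXX opprK; case: n => [|n].
  by rewrite big_ord0 [X in wt _ _ _ X]mulr0; apply: wt0.
apply: (wt_le (M := 0 + e%:Z * n%:Z)); first by lia.
apply: (wtM v_val) => //; apply: (wt_sum v_val) => i _.
have lti := ltn_ord i.
apply: wt_le (wtM v_val (wt_exp v_val (n.+1.-1 - i) wGe) (wt_exp v_val i wh)).
by rewrite /= -subzn //; lia.
Qed.

Let q1 n j := (r *: (approx n * ('X - f%:P) ^+ a1)) *+ 'C(a2, j).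
Let q2 n j := (r *: (((- (main + rest)) ^+ n - approx n) * ('X - f%:P) ^+ a1)) *+ 'C(a2, j).

Let expansionE j : expansion a1 a2 r j = q1 (a2 - j) j + q2 (a2 - j) j.
Proof. by rewrite /expansion /q1 /q2 -mulrnDl -scalerDr -mulrDl [approx _ + _]addrC subrK. Qed.

Let wt_q2 n j : wt v 0 (e%:Z * n%:Z + vs - 1) (l^-1 *: q2 n j).
Proof.
rewrite /q2 -scalerMnr scalerA [l^-1 * r]mulrC; apply: (wt_mulrn v_val).
have -> : e%:Z * n%:Z + vs - 1 = vs + (e%:Z * n%:Z - 1 + 0 * a1%:Z) by ring.
apply: (wtZ v_val); first by rewrite vgeE ?vr // mulf_neq0 ?invr_eq0.
apply: (wtM v_val); first exact: wt_tame_diff.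
by apply: (wt_exp v_val); apply: (wtB v_val (wtX v_val _)); apply: wtC.
Qed.

Let q1E n j : q1 n j = ((r * (- h) ^+ n) *+ 'C(a2, j)) *: ('X - f%:P) ^+ a1.
Proof.
by rewrite /q1 /approx -polyCN -polyC_exp mul_polyC scalerA scalerMnl.
Qed.

Let size_q1 n j : (size (q1 n j) <= a1.+1)%N.
Proof. by rewrite q1E; apply: leq_trans (size_scale_leq _ _) _; rewrite size_exp_XsubC. Qed.

Lemma cc_tame_exact (b : nat) t : (b <= a2)%N -> e%:Z * b%:Z + vs = p%:Z * t ->
  (cc a1 a2 r (a2 - b))`_a1 / l != 0 /\ v ((cc a1 a2 r (a2 - b))`_a1 / l) = - t.
Proof.
move=> le_b bt; have nh0 : - h != 0 by rewrite oppr_eq0.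
have [|c0 vc] := @nat_val p F v charF v_val 'C(a2, a2 - b); first by rewrite bin_ndvd // leq_subr.
have eC : (q1 b (a2 - b))`_a1 = r * ('C(a2, a2 - b)%:R * (- h) ^+ b).
  rewrite q1E coefZ coef_XsubC_exp // subnn expr0 binn mulr1n mulr1 -mulr_natr; ring.
apply: (@cc_leading _ _ _ _ _ _ (q1 b (a2 - b)) (q2 b (a2 - b)) 0 (e%:Z * b%:Z + vs)) => //.
- by rewrite expansionE subKn.
- by rewrite bt; lia.
- by apply: mod_map_small; apply: leq_trans (size_q1 _ _) _.
- by rewrite eC !mulf_neq0 ?expf_neq0.
rewrite eC mulrAC (valM v_val) ?mulf_neq0 ?invr_eq0 ?expf_neq0 // vr.
by rewrite (valM v_val) ?expf_neq0 // vc (valX v_val) // (valN v_val) vh; lia.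
Qed.

(** The leading part (-h)^(a2-j) (X - f)^a1 has degree a1 in X, so beyond a1 only the remainder is
    left, which gains one. This lets ties at a point outside B1 be decided by the exponent of y1. *)
Lemma cc_tame_above i j : (a1 < i)%N -> (j <= a2)%N ->
  vge pv (e%:Z * j%:Z - (e%:Z * a2%:Z + vs) + 1) ((cc a1 a2 r j)`_i / l).
Proof.
move=> lti le_j.
have -> : cc a1 a2 r j = map_poly cF (q1 (a2 - j) j) %% asP p f + map_poly cF (q2 (a2 - j) j) %% asP p f.
  rewrite /cartier_coef expansionE -modpD; congr (_ %% _).
  by apply/polyP => n; rewrite coefD !coef_map_cF coefD cFD.
rewrite coefD mod_map_small; last by apply: leq_trans (size_q1 _ _) _.
rewrite nth_default ?cF0 ?add0r; last by apply: leq_trans (size_q1 _ _) _.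
have /(_ i) := wt_mod_cF vf0 (wt_q2 (a2 - j) j); rewrite coefZ [l^-1 * _]mulrC.
by apply: vge_le; rewrite -subzn //; lia.
Qed.

End TamePoint.

Lemma cc_bound (d DD : nat) (o : int) a1 a2 r i j : vge v (- d%:Z) f ->
  wt v d DD (main + rest) -> vge v o (r / l) ->
  vge pv (d%:Z * i%:Z + DD%:Z * j%:Z - (DD%:Z * a2%:Z + d%:Z * a1%:Z - o)) ((cc a1 a2 r j)`_i / l).
Proof.
move=> vf wG vr; case: (leqP j a2) => [le_j|lt_j]; last first.
  by rewrite cc_above // coef0 mul0r vge0.
have /(_ i) := wt_mod_cF vf (wt_expansion a1 a2 j vf wG vr).
by rewrite coefZ [l^-1 * _]mulrC; apply: vge_le; rewrite -subzn //; lia.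
Qed.

End PointEstimates.

(** * Key terms *)

Section KeyTerms.
Variables (p : nat) (k : closedFieldType) (X : witt_data k).
Hypotheses (p_prime : prime p) (p_gt2 : (2 < p)%N) (X_norm : normalized_data p X).
Implicit Types (P Q : option k) (m : monomial k).
Local Open Scope nat_scope.

Local Notation d P := (d_ X P).
Local Notation e P := (e_ X P).
Local Notation vs m := (v_sub_eps m.1.1.1 m.2).
Local Notation pt m := m.1.1.1.
Local Notation A1 m := m.1.1.2.
Local Notation A2 m := m.1.2.

(* The weights of y1 and y2 at P, with that of x_P equal to 1 before and to p
   after applying the Cartier operator. *)
Definition wy1 P : nat := if P \in B1 X then d P else 0.
Definition wy2 P : nat := if P \in B1 X then p * d P else e P.

Definition own_weight m : nat := wy2 (pt m) * A2 m + wy1 (pt m) * A1 m + vs m.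

(* Differentials with large index do not meet the key terms of those with a
   smaller one at other points; ties are broken in favour of the finite points. *)
Definition key_index m : nat :=
  if pt m \in B1 X then p.-1 * (p * A2 m + A1 m) + p.-1 %/ d (pt m) * vs m
  else p.-1 * (p * (A2 m + vs m %/ e (pt m)) + p.-1).

(** Separates differentials with the same point and the same own weight: by [key_eq], equality of
    this quantity then forces equality of the key terms. *)
Definition key_tie m : nat :=
  if pt m \in B1 X then A2 (key_term p X m) else A1 m.

Record H_spec m : Prop := HSpec {
  Hs_pt : pt m \in B2 X;
  Hs_a1 : A1 m < p;
  Hs_a2 : A2 m < p;
  Hs_v : pt m != None -> 0 < m.2;
  Hs_pole : 0 < pole X (pt m);
  Hs_dvd : p.-1 %/ pole X (pt m) * pole X (pt m) = p.-1;
  Hs_beta : beta p X (pt m) m.2 < p;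
  Hs_alpha : pole X (pt m) * alpha p X (pt m) m.2 <= vs m;
  Hs_shift : pole X (pt m) * beta p X (pt m) m.2 + vs m =
             p * (vs m - pole X (pt m) * alpha p X (pt m) m.2);
  Hs_key : if pt m \in B1 X then beta p X (pt m) m.2 <= A1 m + p * A2 m
           else beta p X (pt m) m.2 <= A2 m }.

Lemma pole_gt0 P : P \in B2 X -> 0 < pole X P /\ (pole X P %| p.-1).
Proof.
move=> PB2; have dvd : pole X P %| p.-1.
  by rewrite /pole; case: ifP => [/(nd_fdeg X_norm)|/negbT/(nd_hdeg X_norm PB2)].
by split=> //; apply: dvdn_gt0 dvd; lia.
Qed.

(** [Hs_shift] is the division of ((p - 1) / pole) (v - epsilon) by p, with quotient alpha and
    remainder beta, multiplied by the pole order: lowering y1 (or y2) by beta is what makes the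
    order divisible by p. *)
Lemma HP m : m \in H p X -> H_spec m.
Proof.
case: m => [[[P a1] a2] v]; rewrite mem_filter mem_W ?prime_gt0 //.
move=> /andP[key /and4P[PB2 lt1 lt2 Wc]].
have [po_gt0 po_dvd] := pole_gt0 PB2.
set b := beta p X P v; set al := alpha p X P v; set s := v_sub_eps P v.
have ediv : p.-1 %/ pole X P * s = al * p + b.
  by rewrite /b /beta -/al -/s [p * al]mulnC subnKC //; apply: leq_trunc_div.
have b_lt : b < p.
  have : b = (p.-1 %/ pole X P * s) %% p.
    by apply/eqP; rewrite -(eqn_add2l (al * p)) -ediv {1}(divn_eq (p.-1 %/ pole X P * s) p).
  by move->; rewrite ltn_mod prime_gt0.
have pdiv : p.-1 %/ pole X P * pole X P = p.-1 by rewrite divnK.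
have e1 : pole X P * b + s + p * (pole X P * al) = p * s.
  have : pole X P * (p.-1 %/ pole X P * s) = pole X P * (al * p + b) by rewrite ediv.
  rewrite mulnA [pole X P * (_ %/ _)]mulnC pdiv mulnDr => e2.
  have -> : p * s = p.-1 * s + s by rewrite -{1}(prednK (prime_gt0 p_prime)) mulSn addnC.
  by rewrite e2; lia.
have le_al : pole X P * al <= s.
  by rewrite -(leq_pmul2l (prime_gt0 p_prime)) -e1 leq_addl.
split=> //=.
  by case: (P) Wc => [c|//]; rewrite /W_cond; case: ifP => _ /andP[].
by rewrite mulnBr -e1 addnK.
Qed.

(** C divides orders by p, so the weight is conserved once x_P counts p times. When beta exceeds a1,
    one y2 of weight p d is exchanged for p factors y1 of weight d. *)
Lemma weight_key m : H_spec m ->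
  wy2 (pt m) * A2 (key_term p X m) + wy1 (pt m) * A1 (key_term p X m)
    + p * (vs m - pole X (pt m) * alpha p X (pt m) m.2) = own_weight m
  /\ A1 (key_term p X m) < p /\ A2 (key_term p X m) <= A2 m.
Proof.
case: m => [[[P a1] a2] v] [/= PB2 lt1 lt2 _ _ _ b_lt le_al es key].
rewrite /own_weight /= /wy1 /wy2 -es /pole; move: b_lt key le_al es; rewrite /pole.
case: ifP => PB1 b_lt key le_al es /=.
  case: (leqP (beta p X P v) a1) => [le_b|lt_b] /=; split; try lia.
    by rewrite mulnBr; have := leq_mul (leqnn (d P)) le_b; lia.
  have a2_gt0 : 0 < a2 by case: a2 key {lt2} => //; lia.
  have e1 : d P * (a1 + p - beta p X P v) + d P * beta p X P v = d P * a1 + p * d P.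
    by rewrite -mulnDr subnK; lia.
  have -> : p * d P * a2 = p * d P * a2.-1 + p * d P by rewrite -{1}(prednK a2_gt0) mulnS addnC.
  by lia.
by rewrite mulnBr; have := leq_mul (leqnn (e P)) key; split; lia.
Qed.

Lemma mod_cancel g x y t s : 0 < g < p -> x < p -> y < p ->
  g * x + p * t = g * y + p * s -> x = y.
Proof.
move=> ltg ltx lty eqxy.
wlog le_xy : x y t s ltx lty eqxy / x <= y => [hw|].
  by case: (leqP x y) => [|/ltnW] le; [|apply/esym]; apply: hw le; eauto.
have : p %| g * (y - x).
  apply/dvdnP; exists (t - s); rewrite mulnBr mulnBl.
  by have := leq_mul (leqnn g) le_xy; nia.
rewrite Euclid_dvdM // => /orP[] /dvdn_leq; lia.
Qed.

Lemma pole_lt P : P \in B2 X -> pole X P < p.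
Proof. by move=> /pole_gt0[_ /dvdn_leq]; lia. Qed.

(** The pole order is invertible modulo p. Hence the conserved weight modulo p determines the
    exponent of y1 in the key term at a point of B1, and that of y2 elsewhere; once the other
    exponent is given, the weight itself determines that of x_P. *)
Lemma key_eq m m0 : H_spec m -> H_spec m0 -> pt m = pt m0 ->
  own_weight m = own_weight m0 ->
  (if pt m \in B1 X then A2 (key_term p X m) = A2 (key_term p X m0) else A1 m = A1 m0) ->
  key_term p X m = key_term p X m0.
Proof.
move=> Hm Hm0 ept eN eT; have [W [b1_lt b2_le]] := weight_key Hm.
have [W0 [b1_lt0 b2_le0]] := weight_key Hm0; move: W W0 eT.
have ltp := pole_lt (Hs_pt Hm); have gtp := Hs_pole Hm.
have ekey n : H_spec n -> key_term p X n =
    (pt n, A1 (key_term p X n), A2 (key_term p X n),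
     if pt n is None then (vs n - pole X (pt n) * alpha p X (pt n) n.2).-1
     else (vs n - pole X (pt n) * alpha p X (pt n) n.2).+1).
  case: n => [[[P a1] a2] v] [/= PB2 lt1 lt2 v0 _ _ _ le _ _].
  have ev : v - pole X P * alpha p X P v =
      if P is None then (v_sub_eps P v - pole X P * alpha p X P v).-1
      else (v_sub_eps P v - pole X P * alpha p X P v).+1.
    by case: (P) v0 le => [c|] /=; [move=> /(_ isT)|]; move: (_ * _) => z; lia.
  by case: ifP => _ /=; [case: ifP => _ /=|]; rewrite -ev.
move=> W W0 eT; rewrite (ekey m Hm) (ekey m0 Hm0); move: b1_lt b1_lt0 b2_le b2_le0 W W0 eT.
have a2_p := Hs_a2 Hm; have a2_p0 := Hs_a2 Hm0.
have a1E n : pt n \notin B1 X -> A1 (key_term p X n) = A1 n.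
  by case: n => [[[P a1] a2] v] /= /negPf->.
have := a1E m; have := a1E m0; rewrite -!ept.
move: (A1 (key_term p X m)) (A2 (key_term p X m)) => b1 b2.
move: (A1 (key_term p X m0)) (A2 (key_term p X m0)) => c1 c2 eb1' eb1 b1_lt c1_lt b2_le c2_le.
move: (v_sub_eps (pt m) m0.2 - _) (v_sub_eps (pt m) m.2 - _) => t0 t W W0.
have {W W0} : wy2 (pt m) * b2 + wy1 (pt m) * b1 + p * t =
              wy2 (pt m) * c2 + wy1 (pt m) * c1 + p * t0 by rewrite W eN.
rewrite /wy1 /wy2; move: ltp gtp; rewrite /pole; case: ifP => PB1 ltp gtp W eT.
  have eb : b1 = c1.
    apply: (@mod_cancel (d (pt m)) _ _ t t0) => //; first by rewrite gtp.
    by move: W; rewrite eT; lia.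
  have et : t = t0.
    by apply/eqP; rewrite -(eqn_pmul2l (prime_gt0 p_prime)); apply/eqP; move: W; rewrite eT eb; lia.
  by rewrite eT eb et.
have eb : b2 = c2.
  apply: (@mod_cancel (e (pt m)) _ _ t t0); rewrite ?gtp //; try lia.
have et : t = t0.
  by apply/eqP; rewrite -(eqn_pmul2l (prime_gt0 p_prime)); apply/eqP; move: W; rewrite eb; lia.
by rewrite eb et eb1 ?PB1 // eb1' ?PB1 // eT.
Qed.

(** Multiplied by (p - 1) / d, the weight of y2^a2 y1^a1 at a point of B1 becomes (p - 1)(p a2 +
    a1), which no longer depends on the point and is at most the index of m; the own weight of m0
    becomes its index. Outside B1 the summand p - 1 in the index bounds any a1 < p and stays below
    the next multiple of p. *)
Lemma key_index_other m m0 : H_spec m -> H_spec m0 -> pt m != pt m0 ->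
  key_index m < key_index m0 \/
  key_index m = key_index m0 /\ (pt m != None) <= (pt m0 != None) ->
  wy2 (pt m0) * A2 m + wy1 (pt m0) * A1 m < own_weight m0 + (pt m0 != None).
Proof.
move=> Hm Hm0 neq; have [_ lt1 lt2 _ _ _ _ _ _ _] := Hm.
have gtp := Hs_pole Hm0; have edv := Hs_dvd Hm0; have v0 := Hs_v Hm0.
have idx : p.-1 * (p * A2 m + A1 m) <= key_index m.
  rewrite /key_index; case: ifP => _; rewrite ?leq_addr // leq_mul2l; apply/orP; right.
  by apply: leq_add; [rewrite leq_mul2l leq_addr orbT | move: lt1; lia].
have fin_lt : (pt m != None) <= (pt m0 != None) -> pt m0 != None.
  by case: (pt m0) neq => // /negPf; case: (pt m).
move=> hlt; rewrite ltnNge; apply/negP => le.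
suff : key_index m0 + (pt m0 != None) <= key_index m.
  by case: hlt => [|[-> /fin_lt->]]; lia.
apply: leq_trans idx; move: le; rewrite /own_weight /wy1 /wy2 /key_index.
move: gtp edv; rewrite /pole; case: ifP => PB1 gtp edv.
  have g_gt0 : 0 < p.-1 %/ d (pt m0) by case: (_ %/ _) edv => //; lia.
  move: (pt m0 != None : nat) (vs m0) (A1 m) (A2 m) (A1 m0) (A2 m0) => fin s a b a0 b0.
  move: (p.-1 %/ _) edv g_gt0 => g <- g_gt0 le.
  have e1 x y z : g * (p * d (pt m0) * x + d (pt m0) * y + z) = g * d (pt m0) * (p * x + y) + g * z by ring.
  have := leq_mul (leqnn g) le; rewrite -[p * _ * b + _]addn0 -addnA !e1 muln0 addn0.
  by apply: leq_trans; rewrite [g * (s + fin)]mulnDr addnA leq_add2l leq_pmull.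
move=> le; have ltA : A2 m0 + vs m0 %/ e (pt m0) < A2 m.
  have fin1 : (pt m0 != None) = 1 :> nat.
    by move: PB1; case: (pt m0) => //; rewrite (nd_infty X_norm).
  move: le; rewrite !mul0n !addn0 fin1 addn1 => le.
  have e_gt0 : 0 < e (pt m0) := gtp.
  rewrite -(ltn_pmul2l e_gt0); apply: leq_trans le; rewrite ltnS mulnDr leq_add2l.
  by rewrite mulnC leq_trunc_div.
have fin_le : (pt m0 != None) <= 1 by case: (_ != _).
apply: (@leq_trans (p.-1 * (p * A2 m))); last by rewrite leq_mul2l leq_addr orbT.
apply: (@leq_trans (p.-1 * (p * (A2 m0 + vs m0 %/ e (pt m0)).+1))); last by rewrite !leq_mul2l ltA !orbT.
rewrite mulnS; move: (p * _) => z.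
have -> : p + z = z + p.-1 + 1 by lia.
by rewrite [X in _ <= X]mulnDr muln1 leq_add2l; apply: leq_trans fin_le _; lia.
Qed.

(** At a point of B1 the index is (p - 1) / d times the own weight. Elsewhere it is an increasing
    function of the quotient of the own weight by e. *)
Lemma key_index_same m m0 : H_spec m -> H_spec m0 -> pt m = pt m0 ->
  key_index m < key_index m0 -> own_weight m < own_weight m0.
Proof.
move=> Hm Hm0 ept; have gtp := Hs_pole Hm0; have edv := Hs_dvd Hm0.
rewrite /key_index /own_weight /wy1 /wy2 ept; move: gtp edv; rewrite /pole.
case: ifP => PB1 gtp edv.
  have g_gt0 : 0 < p.-1 %/ d (pt m0) by case: (_ %/ _) edv => //; lia.
  move: (v_sub_eps (pt m0) m.2) (vs m0) (A1 m) (A2 m) (A1 m0) (A2 m0) => t s a b a0 b0.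
  move: (p.-1 %/ _) edv g_gt0 => g <- g_gt0.
  have e1 x y z : g * d (pt m0) * (p * x + y) + g * z = g * (p * d (pt m0) * x + d (pt m0) * y + z) by ring.
  by rewrite !e1 ltn_pmul2l.
rewrite !mul0n !addn0 ltn_pmul2l; last by lia.
rewrite ltn_add2r ltn_pmul2l ?prime_gt0 // => lt.
have e_gt0 : 0 < e (pt m0) := gtp.
apply: (@leq_trans (e (pt m0) * (A2 m0 + vs m0 %/ e (pt m0)))); last first.
  by rewrite mulnDr leq_add2l mulnC leq_trunc_div.
apply: (@leq_trans (e (pt m0) * (A2 m + v_sub_eps (pt m0) m.2 %/ e (pt m0)).+1)).
  move: (v_sub_eps _ _) => s; rewrite mulnS mulnDr addnCA ltn_add2l.
  by rewrite {1}(divn_eq s (e (pt m0))) mulnC addnC ltn_add2r ltn_mod.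
by rewrite leq_mul2l lt orbT.
Qed.

End KeyTerms.

(** * Independence of the images *)

Section KeyIndependence.
Variables (p : nat) (k : closedFieldType) (X : witt_data k) (F : fieldType).
Variables (cst : {rmorphism k -> F}) (u : option k -> F) (v : option k -> F -> int).
Variables (lam : option k -> F) (cF : F -> F) (f h : F) (theta : {poly F}).
Hypotheses (charF : p \in [pchar F]) (p_gt2 : (2 < p)%N) (X_norm : normalized_data p X).
Hypothesis pts : function_field_points p cst u v.
Hypothesis lamP : forall P, lam P != 0 /\ v P (lam P) = dlog_ord P.
Hypothesis cFD : forall a b, cF (a + b) = cF a + cF b.
Hypothesis cF_bound : forall P n a, vge (v P) n (a / lam P) ->
  vge (fun z => p%:Z * v P z) n (cF a / lam P).
Hypothesis cF_exact : forall P n a, a != 0 -> v P (a / lam P) = p%:Z * n ->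
  cF a / lam P != 0 /\ v P (cF a / lam P) = n.
Hypothesis f_B1 : forall P, P \in B1 X -> f != 0 /\ v P f = - (d_ X P)%:Z.
Hypothesis f_reg : forall P, P \notin B1 X -> vge (v P) 0 f.
Hypothesis h_B2 : forall P, P \in B2 X -> P \notin B1 X -> h != 0 /\ v P h = - (e_ X P)%:Z.
Hypothesis rest_B1 : forall P, P \in B1 X ->
  wt (v P) (d_ X P) (p%:Z * (d_ X P)%:Z - 1) (witt_rest f h theta).
Hypothesis theta_reg : forall P, P \notin B1 X -> wt (v P) 0 0 theta.

Let p_prime : prime p := pcharf_prime charF.

Local Notation pt m := m.1.1.1.
Local Notation A1 m := m.1.1.2.
Local Notation A2 m := m.1.2.

Definition cc_of (m : monomial k) (j : nat) : {poly F} :=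
  cartier_coef p cF f h theta (A1 m) (A2 m) ((u (pt m))^-1 ^+ m.2) j.

(** At a finite Q other than its pole, x_P is regular and du/u has order -1, which gains 1. At
    infinity du/u has order 1, but x_P^v with v > 0 vanishes, which compensates. *)
Definition weight_at (Q : option k) (m : monomial k) : int :=
  if pt m == Q then (own_weight p X m)%:Z
  else (wy2 p X Q * A2 m + wy1 X Q * A1 m)%N%:Z - (Q != None)%:Z.

Let pv Q (a : F) : int := p%:Z * v Q a.

Lemma val_form m : H_spec p X m ->
  let r := (u (pt m))^-1 ^+ m.2 in
  r != 0 /\ v (pt m) (r / lam (pt m)) = - (v_sub_eps (pt m) m.2)%:Z.
Proof.
move=> Hm r; have [u0 vu] := pt_unif pts (pt m); have val := pt_val pts (pt m).
have [l0 vl] := lamP (pt m).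
have r0 : r != 0 by rewrite expf_neq0 ?invr_eq0.
split=> //; rewrite (val_div val) // vl (valX val) ?invr_eq0 // (valV val) // vu.
have := Hs_v Hm; rewrite /v_sub_eps /dlog_ord; case: (pt m) => [c|] /=; last by lia.
by move=> /(_ isT); lia.
Qed.

Lemma vge_form Q m : H_spec p X m ->
  vge (v Q) ((wy2 p X Q * A2 m + wy1 X Q * A1 m)%N%:Z - weight_at Q m)
    ((u (pt m))^-1 ^+ m.2 / lam Q).
Proof.
move=> Hm; have [r0 vr] := val_form Hm; have [l0 vl] := lamP Q; have val := pt_val pts Q.
rewrite /weight_at; case: eqP => [eQ|/eqP neQ].
  rewrite -eQ vgeE ?mulf_neq0 ?invr_eq0 //; last by have [] := lamP (pt m).
  by rewrite vr /own_weight; lia.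
have vl' : vge (v Q) (- dlog_ord Q) (lam Q)^-1 by rewrite vgeE ?invr_eq0 // (valV val) ?vl.
have vx := vgeX val m.2 (pt_other pts (elimN eqP neQ)).
apply: vge_le (vgeM val vx vl').
have := Hs_v Hm; rewrite /dlog_ord; case: (Q) (pt m) neQ => [b|] [c|] //= _; lia.
Qed.

Lemma wt_G Q : Q \in B2 X ->
  vge (v Q) (- (wy1 X Q)%:Z) f /\ wt (v Q) (wy1 X Q) (wy2 p X Q) (witt_main p f + witt_rest f h theta).
Proof.
move=> QB2; have val := pt_val pts Q; rewrite /wy1 /wy2; case: ifPn => QB1.
  have [f0 vf] := f_B1 QB1; have vf' : vge (v Q) (- (d_ X Q)%:Z) f by rewrite vgeE // vf.
  split=> //; apply: (wtD val); first exact: wt_main.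
  by apply: wt_le (rest_B1 QB1); rewrite PoszM; lia.
have vf := f_reg QB1; split; first by rewrite oppr0.
have [h0 vh] := h_B2 QB2 QB1.
apply: (wtD val).
  by have := @wt_main p F (v Q) val f 0; rewrite oppr0 muln0 => /(_ vf); apply: wt_le.
apply: (wtD val); first by apply: wtC; rewrite vgeE ?vh.
apply: (@wt_le _ _ _ 0) => //; apply: (wt_comp_sub val).
  by rewrite oppr0.
exact: theta_reg.
Qed.

Lemma cc_of_bound Q m i j : Q \in B2 X -> H_spec p X m ->
  vge (pv Q) ((wy1 X Q)%:Z * i%:Z + (wy2 p X Q)%:Z * j%:Z - weight_at Q m)
    ((cc_of m j)`_i / lam Q).
Proof.
move=> QB2 Hm; have [vf wG] := wt_G QB2; have [l0 _] := lamP Q.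
apply: vge_le (cc_bound charF p_gt2 cFD (pt_val pts Q) l0 (@cF_bound Q) _ _ _ _ vf wG (vge_form Q Hm)).
by rewrite PoszD !PoszM; lia.
Qed.

Lemma cc_of_exact m : H_spec p X m ->
  let c := (cc_of m (A2 (key_term p X m)))`_(A1 (key_term p X m)) / lam (pt m) in
  c != 0 /\ p%:Z * v (pt m) c =
    (wy1 X (pt m))%:Z * (A1 (key_term p X m))%:Z
    + (wy2 p X (pt m))%:Z * (A2 (key_term p X m))%:Z - (own_weight p X m)%:Z.
Proof.
move=> Hm; have [W _] := weight_key p_prime p_gt2 Hm.
have [r0 vr] := val_form Hm; have [l0 _] := lamP (pt m).
have val := pt_val pts (pt m).
set t := (v_sub_eps (pt m) m.2 - pole X (pt m) * alpha p X (pt m) m.2)%N in W.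
have bt : (pole X (pt m))%:Z * (beta p X (pt m) m.2)%:Z + (v_sub_eps (pt m) m.2)%:Z = p%:Z * t%:Z.
  by rewrite -!PoszM -PoszD (Hs_shift Hm).
suff [c0 vc] : (cc_of m (A2 (key_term p X m)))`_(A1 (key_term p X m)) / lam (pt m) != 0
  /\ v (pt m) ((cc_of m (A2 (key_term p X m)))`_(A1 (key_term p X m)) / lam (pt m)) = - t%:Z.
  by split=> //; rewrite vc -W !PoszD !PoszM; lia.
have key := Hs_key Hm; move: bt; rewrite /pole; case: ifPn key => PB1 key bt.
  have [f0 vf] := f_B1 PB1.
  case: (leqP (beta p X (pt m) m.2) (A1 m)) => [le_b|lt_b].
    have -> : A1 (key_term p X m) = (A1 m - beta p X (pt m) m.2)%N.
      by case: m PB1 le_b {W t bt r0 vr l0 val key Hm vf} => [[[P a1] a2] w] /= -> ->.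
    have -> : A2 (key_term p X m) = A2 m.
      by case: m PB1 le_b {W t bt r0 vr l0 val key Hm vf} => [[[P a1] a2] w] /= -> ->.
    exact: (cc_wild_low charF p_gt2 cFD h theta val l0 (@cF_bound (pt m)) (@cF_exact (pt m)) f0 vf r0 vr (Hs_a1 Hm) (Hs_a2 Hm) bt le_b).
  have -> : A1 (key_term p X m) = (A1 m + p - beta p X (pt m) m.2)%N.
    by case: m PB1 lt_b {W t bt r0 vr l0 val key Hm vf} => [[[P a1] a2] w] /= ->; rewrite ltnNge => /negPf->.
  have -> : A2 (key_term p X m) = (A2 m).-1.
    by case: m PB1 lt_b {W t bt r0 vr l0 val key Hm vf} => [[[P a1] a2] w] /= ->; rewrite ltnNge => /negPf->.
  apply: (cc_wild_high charF p_gt2 cFD val l0 (@cF_bound (pt m)) (@cF_exact (pt m)) f0 vf (rest_B1 PB1) r0 vr (Hs_a1 Hm) (Hs_a2 Hm) bt).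
    by rewrite lt_b (Hs_beta Hm).
  by case: (A2 m) key => //; lia.
have -> : A1 (key_term p X m) = A1 m.
  by case: m PB1 {W t bt r0 vr l0 val key Hm} => [[[P a1] a2] w] /= /negPf->.
have -> : A2 (key_term p X m) = (A2 m - beta p X (pt m) m.2)%N.
  by case: m PB1 {W t bt r0 vr l0 val key Hm} => [[[P a1] a2] w] /= /negPf->.
have [h0 vh] := h_B2 (Hs_pt Hm) PB1.
have e_gt0 : (0 < e_ X (pt m))%N by have := Hs_pole Hm; rewrite /pole (negPf PB1).
exact: (cc_tame_exact charF p_gt2 cFD val l0 (@cF_bound (pt m)) (@cF_exact (pt m)) e_gt0 (f_reg PB1) h0 vh (theta_reg PB1) r0 vr (Hs_a1 Hm) (Hs_a2 Hm) key bt).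
Qed.


(** The first two entries compare differentials with different poles, the last two those with the
    same pole; there a smaller index already forces a smaller own weight. *)
Definition key_rank (m : monomial k) : seqlexi nat :=
  [:: key_index p X m; nat_of_bool (pt m != None); own_weight p X m; key_tie p X m].

Lemma key_rankP m m0 : (key_rank m <= key_rank m0)%O ->
  (key_index p X m < key_index p X m0 \/ key_index p X m = key_index p X m0 /\
    ((pt m != None) < (pt m0 != None) \/ (pt m != None) = (pt m0 != None) :> nat /\
      (own_weight p X m < own_weight p X m0 \/ own_weight p X m = own_weight p X m0 /\
        key_tie p X m <= key_tie p X m0)))%N.
Proof.
rewrite /key_rank !Order.SeqLexiOrder.lexi_cons !Order.NatOrder.leEnat.
by lia.
Qed.

(** At the key term of m0 and at the pole of m0, the image of m has order strictly above the one
    that m0 attains. With different poles or different own weights the general bound suffices; equal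
    own weights require the shape of the expansion. *)
Lemma cc_of_isolated m m0 : H_spec p X m -> H_spec p X m0 ->
  key_term p X m != key_term p X m0 -> (key_rank m <= key_rank m0)%O ->
  vge (pv (pt m0)) ((wy1 X (pt m0))%:Z * (A1 (key_term p X m0))%:Z
    + (wy2 p X (pt m0))%:Z * (A2 (key_term p X m0))%:Z - (own_weight p X m0)%:Z + 1)
    ((cc_of m (A2 (key_term p X m0)))`_(A1 (key_term p X m0)) / lam (pt m0)).
Proof.
move=> Hm Hm0 neq /key_rankP rk; have bnd := cc_of_bound _ _ (Hs_pt Hm0) Hm.
have QB2 := Hs_pt Hm0; have [l0 _] := lamP (pt m0); have val := pt_val pts (pt m0).
case: (eqVneq (pt m) (pt m0)) => [ept|npt]; last first.
  apply: vge_le (bnd _ _); rewrite /weight_at (negPf npt).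
  have := key_index_other p_prime p_gt2 X_norm Hm Hm0 npt.
  have {}rk : (key_index p X m < key_index p X m0 \/
     key_index p X m = key_index p X m0 /\ (pt m != None) <= (pt m0 != None))%N by lia.
  by move=> /(_ rk); lia.
have wE : weight_at (pt m0) m = (own_weight p X m)%:Z by rewrite /weight_at ept eqxx.
have [ltN|[eN le_tie]] : (own_weight p X m < own_weight p X m0 \/
    own_weight p X m = own_weight p X m0 /\ key_tie p X m <= key_tie p X m0)%N.
- case: rk => [lti|[_ [|[_ //]]]]; first by left; apply: key_index_same lti.
  by rewrite ept ltnn.
- by apply: vge_le (bnd _ _); rewrite wE; lia.
have kneq : ~ (if pt m \in B1 X then A2 (key_term p X m) = A2 (key_term p X m0) else A1 m = A1 m0).
  by move=> e; move/eqP: neq; apply; apply: key_eq.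
case: (ltnP (A2 m) (A2 (key_term p X m0))) => [lt_b|le_b].
  by rewrite /cc_of cc_above // coef0 mul0r vge0.
move: le_tie kneq; rewrite /key_tie -ept; case: ifPn => PB1 le_tie kneq; last first.
  rewrite ept in PB1.
  have e1 : A1 (key_term p X m0) = A1 m0.
    by case: m0 PB1 {neq rk bnd QB2 l0 val ept wE eN le_tie kneq Hm0 le_b} => [[[P a1] a2] w] /= /negPf->.
  have lt1 : (A1 m < A1 m0)%N by rewrite ltn_neqAle le_tie andbT; apply/eqP.
  have [h0 vh] := h_B2 QB2 PB1.
  have e_gt0 : (0 < e_ X (pt m0))%N by have := Hs_pole Hm0; rewrite /pole (negPf PB1).
  have [r0 vr] := val_form Hm; rewrite ept in r0 vr.
  rewrite ept e1 /wy1 /wy2 (negPf PB1).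
  have := cc_tame_above charF p_gt2 cFD val l0 (@cF_bound (pt m0)) e_gt0 (f_reg PB1) h0 vh (theta_reg PB1) r0 vr (Hs_a1 Hm) (Hs_a2 Hm) lt1 le_b.
  rewrite /cc_of ept; apply: vge_le; rewrite -eN /own_weight ept /wy1 /wy2 (negPf PB1).
  by clear; lia.
have lt2 : (A2 (key_term p X m) < A2 (key_term p X m0))%N by rewrite ltn_neqAle le_tie andbT; apply/eqP.
(* The key term of m has a smaller y2-exponent than that of m0, which is at most that of m. Hence m
   lost one y2, and the coefficient in question is that of y2^a2, of degree at most a1 in y1. *)
have [e2 lt_b] : A2 (key_term p X m0) = A2 m /\ (A1 m < beta p X (pt m) m.2)%N.
  move: PB1 lt2 le_b; move: (A2 (key_term p X m0)) => b2; case: (m) => [[[P a1] a2] w] /= ->.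
  by case: (leqP (beta p X P w) a1) => /= lt1 lt2 le2; split=> //; lia.
suff lt1 : (A1 m < A1 (key_term p X m0))%N.
  by rewrite /cc_of e2 cc_top_above ?(Hs_a1 Hm) // mul0r vge0.
(* Otherwise the equality of weights modulo p would give beta = A1 m - A1 (key_term m0), at most
   a1. *)
rewrite ltnNge; apply/negP => le1.
have [W0 [b1_lt b2_le]] := weight_key p_prime p_gt2 Hm0.
have shift := Hs_shift Hm; move: W0.
rewrite -eN /own_weight -ept e2 /wy1 /wy2 PB1 => W0.
have ltp := pole_lt p_prime p_gt2 X_norm (Hs_pt Hm); have gtp := Hs_pole Hm.
rewrite /pole PB1 in ltp gtp shift.
have le_d := leq_mul (leqnn (d_ X (pt m))) le1.
suff : beta p X (pt m) m.2 = (A1 m - A1 (key_term p X m0))%N by lia.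
move: W0 shift; move: (v_sub_eps (pt m) m0.2 - _)%N (v_sub_eps (pt m) m.2 - _)%N => t0 t W0 shift.
apply: (@mod_cancel p p_prime p_gt2 (d_ X (pt m)) _ _ t0 t).
- by rewrite gtp.
- exact: Hs_beta Hm.
- by apply: leq_ltn_trans (leq_subr _ _) (Hs_a1 Hm).
by rewrite mulnBr; move: W0 shift le_d; clear; lia.
Qed.

Lemma lexi_max (s : seq (monomial k)) : s != [::] ->
  exists2 m0, m0 \in s & {in s, forall m, (key_rank m <= key_rank m0)%O}.
Proof.
elim: s => [//|m [|n s] IHs] _.
  by exists m; rewrite ?mem_head // => x; rewrite inE => /eqP->.
have [//|m0 m0s max0] := IHs.
case: (leP (key_rank m) (key_rank m0)) => [le|/ltW ge].
  by exists m0 => [|x]; rewrite inE ?m0s ?orbT // => /predU1P[->|/max0].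
exists m; rewrite ?mem_head // => x; rewrite inE => /predU1P[->//|/max0 le].
exact: le_trans le ge.
Qed.

Lemma key_indep (s : seq (monomial k)) (c : monomial k -> k) :
  uniq s -> {subset s <= H p X} -> {in s &, injective (key_term p X)} ->
  (forall j, (j < p)%N -> \sum_(m <- s) cst (c m) *: cc_of m j = 0) ->
  {in s, forall m, c m = 0}.
Proof.
move=> us sH injk sum0 m ms; apply/eqP; apply: contraTT isT => cm0.
have [|m0] := @lexi_max [seq m <- s | c m != 0].
  by apply/eqP => e; move: (mem_filter (fun m => c m != 0) m s); rewrite e cm0 ms.
rewrite mem_filter => /andP[c0 m0s] max0.
have Hm0 := HP p_prime p_gt2 X_norm (sH _ m0s).
have [_ [_ b2_le]] := weight_key p_prime p_gt2 Hm0.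
have [e0 ve] := cc_of_exact Hm0; have val := pt_val pts (pt m0).
have pval : is_val (pv (pt m0)) by apply: is_val_scale.
have := sum0 _ (leq_ltn_trans b2_le (Hs_a2 Hm0)).
rewrite (big_rem m0) //= => /(congr1 (fun q : {poly F} => q`_(A1 (key_term p X m0)) / lam (pt m0))).
rewrite coefD coef0 mul0r mulrDl coefZ coef_sum mulr_suml -mulrA.
set z := _ / _ in e0 ve *; set S := \sum_(_ <- _) _.
have cz0 : cst (c m0) * z != 0 by rewrite mulf_neq0 ?fmorph_eq0.
have vz : pv (pt m0) (cst (c m0) * z) = p%:Z * v (pt m0) z.
  by rewrite /pv (valM val) ?fmorph_eq0 // (pt_const pts) // add0r.
have [|n0 _] := val_addl pval cz0 (b := S); last by move/eqP; rewrite (negPf n0).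
rewrite vz ve /S big_seq; apply: (vge_sum pval) => i.
rewrite mem_rem_uniq // inE => /andP[i_neq i_s]; rewrite coefZ -mulrA.
case: (eqVneq (c i) 0) => [->|ci0]; first by rewrite rmorph0 mul0r vge0.
rewrite -[X in vge _ X]add0r; apply: (vgeM pval).
  by rewrite vgeE ?fmorph_eq0 // /pv (pt_const pts) // mulr0.
apply: cc_of_isolated => //; first exact: (HP p_prime p_gt2 X_norm (sH _ i_s)).
  by apply: contraNneq i_neq => /injk->.
by apply: max0; rewrite mem_filter ci0.
Qed.

End KeyIndependence.

(** * Reduction of the poles of h *)

Section PoleReduction.
Variables (p : nat) (k : closedFieldType) (F : fieldType).
Variables (cst : {rmorphism k -> F}) (u : option k -> F) (v : option k -> F -> int).
Hypotheses (k_char : p \in [pchar k]) (p_gt2 : (2 < p)%N).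
Hypothesis pts : function_field_points p cst u v.
Variables (f h : F) (B : seq (option k)) (d e : option k -> nat).
Hypothesis f_B : forall P, P \in B -> f != 0 /\ v P f = - (d P)%:Z.
Hypothesis f_reg : forall P, P \notin B -> vge (v P) 0 f.
Hypothesis d_dvd : forall P, P \in B -> (d P %| p.-1)%N.
Hypothesis h_B : forall P, P \in B -> vge (v P) (- (e P)%:Z) h.
Hypothesis e_lt : forall P, P \in B -> (e P < p * d P)%N.
Let p_prime : prime p := pcharf_prime k_char.
Let charF : p \in [pchar F]. Proof. by rewrite (fmorph_pchar cst). Qed.

Let pv P (a : F) : int := p%:Z * v P a.
Let pv_val P : is_val (pv P). Proof. exact: (is_val_scale (pt_val pts P)). Qed.

(* [frob theta] represents theta(y1)^p, as y1^p = y1 + f. *)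
Definition frob (theta : {poly F}) : {poly F} :=
  \sum_(i < p) (theta`_i ^+ p)%:P * ('X + f%:P) ^+ i.

Lemma frobD t1 t2 : frob (t1 + t2) = frob t1 + frob t2.
Proof.
rewrite /frob -big_split; apply: eq_bigr => i _ /=.
by rewrite coefD (exprD_char charF) polyCD mulrDl.
Qed.

Let d_gt0 P : P \in B -> (0 < d P)%N.
Proof. by move=> /d_dvd/dvdn_gt0; apply; lia. Qed.

Let wt_Xf P : P \in B -> wt (pv P) (d P) (p%:Z * (d P)%:Z) ('X + f%:P).
Proof.
move=> PB; have [f0 vf] := f_B PB; apply: (wtD (pv_val P)).
  by apply: wt_le (wtX (pv_val P) _); nia.
by apply: wtC; rewrite vgeE // /pv vf; lia.
Qed.

(** Only the powers (y1 + f)^i with i < p contribute. As p d (p - 1) < d (p^2 - p + 1), corrections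
    made at other points do not spoil the bound at P. *)
Lemma wt_frob_regular P (t : {poly F}) : P \in B -> wt (v P) 0 0 t ->
  wt (pv P) (d P) (p%:Z * (d P)%:Z * (p%:Z - 1)) (frob t).
Proof.
move=> PB wt_t; rewrite /frob; apply: (wt_sum (pv_val P)) => i _.
apply: wt_le (wtM (pv_val P) (M := 0) _ (wt_exp (pv_val P) i (wt_Xf PB))).
  by have := ltn_ord i; have := d_gt0 PB; nia.
apply: wtC; rewrite oppr0; have := wt_t i; rewrite mul0r subr0.
move/(vgeX (pt_val pts P) p); rewrite mul0r /pv => h0.
by rewrite -[0](mulr0 p%:Z) vge_scale //; lia.
Qed.

Lemma wt_regular P (t : {poly F}) : P \in B -> (size t <= p)%N -> wt (v P) 0 0 t ->
  wt (pv P) (d P) (p%:Z * (d P)%:Z - 1) t.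
Proof.
move=> PB st wt_t i; case: (ltnP i p) => [lti|le]; last first.
  by rewrite nth_default ?vge0 // (leq_trans st).
have := wt_t i; rewrite mul0r subr0 => w0.
apply: (@vge_le _ _ (p%:Z * 0)); first by have := d_gt0 PB; nia.
by rewrite /pv vge_scale //; lia.
Qed.

Lemma frob_monomial c b : (b < p)%N -> frob (c *: 'X^b) = (c ^+ p) *: ('X + f%:P) ^+ b.
Proof.
move=> ltb; rewrite /frob (bigD1 (Ordinal ltb)) //= coefZ coefXn eqxx mulr1 mul_polyC.
rewrite big1 ?addr0 // => i; rewrite -val_eqE /= => /negPf neq.
by rewrite coefZ coefXn neq mulr0 expr0n (gtn_eqF (prime_gt0 p_prime)) mul0r.
Qed.

Lemma weight_split P n : P \in B -> (d P * p.-1 < n)%N ->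
  exists a b, (b < p)%N /\ n = (p * a + d P * b)%N.
Proof.
(* d ((p - 1) / d) = -1 modulo p, so p - (p - 1) / d is an inverse of d and d b = n modulo p; the
   bound on n makes n - d b nonnegative. *)
move=> PB ltn; pose b := ((n * (p - p.-1 %/ d P)) %% p)%N.
have b_p : (b < p)%N by rewrite ltn_mod prime_gt0.
have le_b : (d P * b <= n)%N.
  by apply: leq_trans (ltnW ltn); rewrite leq_mul2l; apply/orP; right; lia.
have e1 : (d P * b = n %[mod p])%N.
  rewrite /b modnMmr mulnCA mulnBr [(d P * (_ %/ _))%N]mulnC divnK ?d_dvd //.
  have -> : (d P * p - p.-1 = (d P).-1 * p + 1)%N.
    case: (d P) (d_gt0 PB) => // q _; rewrite mulSn /=; move: (q * p)%N p_gt2; clear; lia.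
  by rewrite mulnDr muln1 mulnA modnMDl.
exists ((n - d P * b) %/ p)%N, b; split=> //.
by rewrite mulnC divnK ?subnK // -eqn_mod_dvd //; apply/eqP.
Qed.

(** Induction on the pole order n. If it is too large for the bound, then n > d (p - 1), so n = p a
    + d b, and the leading term of r is that of c^p x_P^(p a) f^b. This is the main part of the p-th
    power of c x_P^a y1^b, as y1^p = y1 + f; subtracting it lowers the pole. *)
Lemma pole_reduction_at P n r : P \in B -> (n < p * d P)%N -> vge (v P) (- n%:Z) r ->
  exists t : {poly F}, [/\ (size t <= p)%N, wt (pv P) (d P) (p%:Z * (d P)%:Z - 1) t,
    forall Q, Q <> P -> wt (v Q) 0 0 t &
    wt (pv P) (d P) ((d P)%:Z * (p%:Z ^+ 2 - p%:Z + 1) - 1) (r%:P - frob t)].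
Proof.
move=> PB; have [f0 vf] := f_B PB; have d0 := d_gt0 PB; have val := pt_val pts P.
have p_pos : 0 < p%:Z by rewrite ltz_nat prime_gt0.
have [u0 vu] := pt_unif pts P.
have small n0 r0 : (p%:Z * n0%:Z <= (d P)%:Z * (p%:Z ^+ 2 - p%:Z + 1) - 1) ->
   vge (v P) (- n0%:Z) r0 -> exists t : {poly F}, [/\ (size t <= p)%N, wt (pv P) (d P) (p%:Z * (d P)%:Z - 1) t,
    forall Q, Q <> P -> wt (v Q) 0 0 t &
    wt (pv P) (d P) ((d P)%:Z * (p%:Z ^+ 2 - p%:Z + 1) - 1) (r0%:P - frob t)].
  move=> le_n vr; exists 0; rewrite size_poly0; split=> // [|Q _|]; try exact: wt0.
  have -> : frob 0 = 0.
    by rewrite /frob big1 // => i _; rewrite coef0 expr0n (gtn_eqF (prime_gt0 p_prime)) mul0r.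
  rewrite subr0; apply: wtC; apply: (@vge_le _ _ (p%:Z * - n0%:Z)); first by move: le_n; clear; lia.
  by rewrite /pv vge_scale.
elim: n r => [|n IHn] r ltn vr; first by apply: small vr; move: d0 p_gt2; clear; nia.
case: (lerP (p%:Z * n.+1%:Z) ((d P)%:Z * (p%:Z ^+ 2 - p%:Z + 1) - 1)) => [le|gt].
  exact: small vr.
have [|a [b [b_p en]]] := @weight_split P n.+1 PB.
  by rewrite -(ltn_pmul2l (prime_gt0 p_prime)); move: gt d0 p_gt2; rewrite expr2; clear; nia.
pose z := (u P)^-1 ^+ (p * a) * f ^+ b.
have z0 : z != 0 by rewrite mulf_neq0 ?expf_neq0 ?invr_eq0.
have vz : v P z = - n.+1%:Z.
  rewrite (valM val) ?expf_neq0 ?invr_eq0 // !(valX val) ?invr_eq0 // (valV val) // vu vf en.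
  by rewrite PoszD !PoszM; clear; lia.
have [|c1 vc1] := pt_residue pts (P := P) (a := r / z).
  have vz' : vge (v P) n.+1%:Z z^-1 by rewrite vgeE ?invr_eq0 // (valV val) // vz opprK.
  by apply: vge_le (vgeM val vr vz'); clear; lia.
have [c ec] := k_root_p k_char c1.
have vr'' : vge (v P) (- n%:Z) (r - cst c1 * z).
  rewrite -[r in r - _](divfK z0) -mulrBl.
  have vz' : vge (v P) (- n.+1%:Z) z by rewrite vgeE // vz.
  by apply: vge_le (vgeM val vc1 vz'); clear; lia.
have [t [st wt1 wt2 wt3]] := IHn _ (ltnW ltn) vr''.
have hn : (p * a + d P * b)%N%:Z <= p%:Z * (d P)%:Z - 1 by rewrite -en; move: ltn; clear; lia.
pose w := cst c * (u P)^-1 ^+ a; pose t0 : {poly F} := w *: 'X^b.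
have vw : vge (v P) (- a%:Z) w.
  apply: (@vge_le _ _ (0 + -1 * a%:Z)); first by clear; lia.
  apply: (vgeM val); first exact: (vge_cst pts).
  by apply: (vgeX val); rewrite vgeE ?invr_eq0 // (valV val) // vu.
have ewp : w ^+ p = cst c1 * (u P)^-1 ^+ (p * a).
  by rewrite /w exprMn -ec rmorphXn -exprM mulnC.
exists (t0 + t); split.
- apply: leq_trans (size_polyD _ _) _; rewrite geq_max st andbT.
  by apply: leq_trans (size_scale_leq _ _) _; rewrite size_polyXn.
- apply: (wtD (pv_val P)) => //.
  apply: wt_le (wtZ (pv_val P) (M := p%:Z * a%:Z) _ (wtXn (pv_val P) _ b)).
    by move: hn; rewrite PoszD !PoszM.
  by rewrite -mulrN /pv vge_scale.
- move=> Q neq; apply: (wtD (pt_val pts Q)); last exact: wt2.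
  apply: (@wt_le _ _ _ (0 + 0 * b%:Z)); first by rewrite mul0r.
  apply: (wtZ (pt_val pts Q)); last exact: (wtXn (pt_val pts Q)).
  apply: (@vge_le _ _ (0 + (Q == None)%:Z * a%:Z)); first by rewrite add0r -PoszM.
  apply: (vgeM (pt_val pts Q)); first exact: (vge_cst pts).
  by apply: (vgeX (pt_val pts Q)); apply: (pt_other pts) => e1; apply: neq.
rewrite frobD frob_monomial // ewp.
have -> : r%:P - ((cst c1 * (u P)^-1 ^+ (p * a)) *: ('X + f%:P) ^+ b + frob t) =
    (r - cst c1 * z)%:P - frob t
    - (cst c1 * (u P)^-1 ^+ (p * a)) *: (('X + f%:P) ^+ b - (f%:P) ^+ b).
  rewrite scalerBr -polyC_exp polyCB /z mulrA !polyCM.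
  by rewrite -[_ *: (f ^+ b)%:P]mul_polyC polyCM; ring.
apply: (wtB (pv_val P)) => //.
have wdiff b' : wt (pv P) (d P) (p%:Z * (d P)%:Z * b'%:Z - (p%:Z - 1) * (d P)%:Z)
    (('X + f%:P) ^+ b' - f%:P ^+ b').
  have wf : wt (pv P) (d P) (p%:Z * (d P)%:Z) f%:P by apply: wtC; rewrite vgeE // /pv vf mulrN.
  rewrite subrXX addrK; case: b' => [|b']; first by rewrite big_ord0 [X in wt _ _ _ X]mulr0; apply: wt0.
  apply: (@wt_le _ _ _ ((d P)%:Z + p%:Z * (d P)%:Z * b'%:Z)); first by clear; lia.
  apply: (wtM (pv_val P)); first exact: (wtX (pv_val P)).
  apply: (wt_sum (pv_val P)) => i _; have lti := ltn_ord i.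
  apply: wt_le (wtM (pv_val P) (wt_exp (pv_val P) _ (wt_Xf PB)) (wt_exp (pv_val P) i wf)).
  by rewrite -mulrDr /= -PoszD subnK.
apply: (@wt_le _ _ _ (p%:Z * (p * a)%N%:Z + (p%:Z * (d P)%:Z * b%:Z - (p%:Z - 1) * (d P)%:Z))).
  move: hn => /(ler_wpM2l (ltW p_pos)); rewrite expr2 PoszD !PoszM; move: p_gt2; clear; lia.
apply: (wtZ (pv_val P)) => //.
rewrite -mulrN /pv vge_scale //.
apply: (@vge_le _ _ (0 + -1 * (p * a)%N%:Z)); first by clear; lia.
apply: (vgeM val); first exact: (vge_cst pts).
by apply: (vgeX val); rewrite vgeE ?invr_eq0 // (valV val) // vu.
Qed.

Lemma pole_reduction : exists t : {poly F}, [/\ (size t <= p)%N,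
    forall P, P \in B -> wt (pv P) (d P) (p%:Z * (d P)%:Z - 1) t,
    forall P, P \notin B -> wt (v P) 0 0 t &
    forall P, P \in B ->
      wt (pv P) (d P) ((d P)%:Z * (p%:Z ^+ 2 - p%:Z + 1) - 1) (h%:P - frob t)].
Proof.
suff [t [st t1 t2 t3]] : exists t : {poly F}, [/\ (size t <= p)%N,
    forall P, P \in B -> wt (pv P) (d P) (p%:Z * (d P)%:Z - 1) t,
    forall P, P \notin undup B -> wt (v P) 0 0 t &
    forall P, P \in undup B ->
      wt (pv P) (d P) ((d P)%:Z * (p%:Z ^+ 2 - p%:Z + 1) - 1) (h%:P - frob t)].
  by exists t; split=> // P PB; [apply: t2 | apply: t3]; rewrite mem_undup.
have sB : {subset undup B <= B} by move=> P; rewrite mem_undup.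
elim: (undup B) (undup_uniq B) sB => [|P s IHs] /= us sB.
  exists 0; rewrite size_poly0; split=> // P _; exact: wt0.
have /andP[Ps us'] := us; have PB : P \in B by apply: sB; rewrite mem_head.
have [|t [st t1 t2 t3]] := IHs us'; first by move=> Q Qs; apply: sB; rewrite inE Qs orbT.
have [t' [st' t1' t2' t3']] := pole_reduction_at PB (e_lt PB) (h_B PB).
have bound Q : Q \in B -> p%:Z * (d Q)%:Z * (p%:Z - 1) <= (d Q)%:Z * (p%:Z ^+ 2 - p%:Z + 1) - 1.
  by move=> QB; have := d_gt0 QB; rewrite expr2; nia.
exists (t' + t); split.
- by apply: leq_trans (size_polyD _ _) _; rewrite geq_max st'.
- move=> Q QB; apply: (wtD (pv_val Q)); last exact: t1.
  case: (eqVneq Q P) => [->//|/eqP neq]; apply: wt_regular => //; exact: t2'.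
- move=> Q; rewrite inE negb_or => /andP[/eqP neq Qs].
  by apply: (wtD (pt_val pts Q)); [apply: t2' | apply: t2].
move=> Q; rewrite inE => Qs; rewrite frobD.
case: (eqVneq Q P) Qs => [->|neq] Qs.
  rewrite opprD addrA; apply: (wtB (pv_val P)) => //.
  by apply: wt_le (bound _ PB) _; apply: wt_frob_regular => //; apply: t2.
rewrite /= in Qs; have QB : Q \in B by apply: sB; rewrite inE Qs orbT.
rewrite opprD addrCA addrC; apply: (wtB (pv_val Q)); first exact: t3.
by apply: wt_le (bound _ QB) _; apply: wt_frob_regular => //; apply: t2'; apply/eqP.
Qed.

End PoleReduction.

(** * Approximation by elements of k(x) *)

Section Approximation.
Variables (p : nat) (k : closedFieldType) (F L : fieldType).
Variables (cst : {rmorphism k -> F}) (w : F -> int) (iota : {rmorphism F -> L}).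
Variables (nu : L -> int) (E : int).
Hypotheses (charL : p \in [pchar L]) (nu_val : is_val nu) (E_gt0 : 0 < E).
Hypothesis nuE : forall a, a != 0 -> nu (iota a) = E * w a.
Hypothesis w_cst : forall c, vge w 0 (cst c).
Hypothesis residue : forall a, vge w 0 a -> exists c, vge w 1 (a - cst c).
Let p_prime : prime p := pcharf_prime charL.

Lemma vge_iota n a : vge w n a -> vge nu (E * n) (iota a).
Proof.
case: (eqVneq a 0) => [->|a0]; first by rewrite rmorph0 => _; apply: vge0.
by rewrite !vgeE ?fmorph_eq0 // nuE // ler_pM2l.
Qed.

(* z lies in the closure of F for the topology of nu. *)
Definition approximable (z : L) : Prop := forall N : int, exists a, vge nu N (z - iota a).

Lemma approx_iota a : approximable (iota a).
Proof. by move=> N; exists a; rewrite subrr vge0. Qed.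

Lemma approxD y z : approximable y -> approximable z -> approximable (y + z).
Proof.
move=> Ay Az N; have [a va] := Ay N; have [b vb] := Az N; exists (a + b).
by rewrite rmorphD opprD addrACA; apply: (vgeD nu_val).
Qed.

Lemma vge_some z : exists2 n : int, n <= 0 & vge nu n z.
Proof.
case: (eqVneq z 0) => [->|z0]; first by exists 0; rewrite ?vge0.
case: (lerP 0 (nu z)) => [le|lt]; first by exists 0; rewrite ?vgeE.
by exists (nu z); [apply: ltW | rewrite vgeE].
Qed.

Lemma approxM y z : approximable y -> approximable z -> approximable (y * z).
Proof.
move=> Ay Az N; have [n n0 vz] := vge_some z; have [a va] := Ay (N - n).
have [m m0 va'] := vge_some (iota a); have [b vb] := Az (N - m).
exists (a * b); rewrite rmorphM.
have -> : y * z - iota a * iota b = (y - iota a) * z + iota a * (z - iota b) by ring.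
apply: (vgeD nu_val).
  by apply: vge_le (vgeM nu_val va vz); rewrite subrK.
by apply: vge_le (vgeM nu_val va' vb); rewrite addrC subrK.
Qed.

Lemma approx_exp z n : approximable z -> approximable (z ^+ n).
Proof.
move=> Az; elim: n => [|n IHn]; last by rewrite exprS; apply: approxM.
by rewrite expr0 -(rmorph1 iota); apply: approx_iota.
Qed.

Lemma approx_sum (I : Type) (s : seq I) (P : pred I) (G : I -> L) :
  (forall i, P i -> approximable (G i)) -> approximable (\sum_(i <- s | P i) G i).
Proof.
move=> AG; apply: (big_ind approximable) => [|y z|//]; last exact: approxD.
by rewrite -(rmorph0 iota); apply: approx_iota.
Qed.

Lemma approx_horner (q : {poly F}) z : approximable z -> approximable (map_poly iota q).[z].
Proof.
move=> Az; rewrite horner_coef; apply: approx_sum => i _; rewrite coef_map.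
by apply: approxM; [apply: approx_iota | apply: approx_exp].
Qed.

Lemma vge_prod_root (s : seq k) z : (forall c, vge nu 0 (z - iota (cst c))) ->
  vge nu 1 (\prod_(c <- s) (z - iota (cst c))) -> exists c, vge nu 1 (z - iota (cst c)).
Proof.
move=> v0; elim: s => [|c s IHs].
  by rewrite big_nil vgeE ?oner_eq0 // (val1 nu_val).
rewrite big_cons; case: (boolP (vge nu 1 (z - iota (cst c)))) => [vc _|nvc]; first by exists c.
move=> vp; apply: IHs; move: nvc; rewrite /vge negb_or => /andP[z0 nle].
have nz : nu (z - iota (cst c)) = 0.
  by have := v0 c; rewrite vgeE // => le; apply/eqP; rewrite eq_le le andbT -ltzD1 add0r ltNge.
rewrite -[\prod_(_ <- s) _](mulKf z0); apply: (@vge_le _ _ (0 + 1)) => //; apply: (vgeM nu_val) => //.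
by rewrite vgeE ?invr_eq0 // (valV nu_val) // nz oppr0.
Qed.

(** A form of Hensel's lemma. The residue of z is a root of Y^p - Y - c, which splits over k; after
    subtracting it, z1 has positive order and is the limit of an iteration. *)
Lemma approx_artin_schreier z : approximable (z ^+ p - z) -> vge nu 0 (z ^+ p - z) ->
  approximable z.
Proof.
set R := _ - z => AR vR; have p_gt1 := prime_gt1 p_prime.
have vz : vge nu 0 z by apply: (as_vge_ge0 nu_val p_gt1).
have nuc c : vge nu 0 (iota (cst c)).
  by rewrite -(mulr0 E); apply: vge_iota.
have E1 : 1 <= E by rewrite -gtz0_ge1.
have [c vc] : exists c, vge nu 1 (R - iota (cst c)).
  have [a va] := AR 1; have va0 : vge w 0 a.
    have : vge nu 0 (iota a).
      by rewrite -[iota a](subKr R); apply: (vgeB nu_val) => //; apply: vge_le va.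
    case: (eqVneq a 0) => [->|a0]; first by rewrite vge0.
    by rewrite !vgeE ?fmorph_eq0 // nuE // pmulr_rge0.
  have [c vc] := residue va0; exists c.
  have -> : R - iota (cst c) = (R - iota a) + iota (a - cst c) by rewrite rmorphB; ring.
  by apply: (vgeD nu_val) => //; apply: vge_le (vge_iota vc); rewrite mulr1.
have [s es] : exists s : seq k, 'X^p - ('X + c%:P) = \prod_(y <- s) ('X - y%:P).
  have [s es] := closed_field_poly_normal ('X^p - ('X + c%:P)); exists s.
  by rewrite {1}es -/(asP p c) (monicP (asP_monic _ p_gt1)) scale1r.
have [y vy] : exists y, vge nu 1 (z - iota (cst y)).
  apply: (@vge_prod_root s) => [y|]; first by apply: (vgeB nu_val).
  have -> : \prod_(y <- s) (z - iota (cst y)) = R - iota (cst c); last by [].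
  have := congr1 (fun q : {poly k} => (map_poly (iota \o cst) q).[z]) es.
  rewrite map_prod_XsubC horner_prod => e; transitivity ((map_poly (iota \o cst) ('X^p - ('X + c%:P))).[z]).
    by rewrite e; apply: eq_bigr => y _; rewrite !hornerE.
  by rewrite !(rmorphB, rmorphD) /= map_polyXn map_polyX map_polyC !hornerE /= /R; ring.
set z1 := z - iota (cst y) in vy.
have -> : z = z1 + iota (cst y) by rewrite subrK.
apply: approxD; last exact: approx_iota.
have A1 : approximable (z1 ^+ p - z1).
  have -> : z1 ^+ p - z1 = R - iota (cst y ^+ p - cst y).
    rewrite /R; have {1 2}-> : z = z1 + iota (cst y) by rewrite subrK.
    by rewrite [in RHS](exprD_char charL) rmorphB rmorphXn; ring.
  by rewrite -rmorphN; apply: approxD => //; apply: approx_iota.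
(* Iterates z1 = z1^p - (z1^p - z1): raising to the p-th power multiplies the order of the error by
   p. *)
have An (n : nat) : exists a, vge nu n.+1%:Z (z1 - iota a).
  elim: n => [|n [a va]]; first by exists 0; rewrite rmorph0 subr0.
  have [b vb] := A1 n.+2%:Z; exists (a ^+ p - b).
  have -> : z1 - iota (a ^+ p - b) = (z1 - iota a) ^+ p - (z1 ^+ p - z1 - iota b).
    rewrite (exprD_char charL) rmorphB rmorphXn.
    have -> : (- iota a) ^+ p = - (iota a ^+ p).
      apply/eqP; rewrite -addr_eq0 addrC; apply/eqP.
      by rewrite -(exprD_char charL) subrr expr0n (gtn_eqF (prime_gt0 p_prime)).
    by ring.
  apply: (vgeB nu_val) => //; apply: vge_le (vgeX nu_val p va).
  by move: p_gt1; clear; nia.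
move=> N; case: N => n; last by exists 0; rewrite rmorph0 subr0; apply: vge_le vy.
by have [a va] := An n; exists a; apply: vge_le va; rewrite lez_nat.
Qed.

End Approximation.

(** * Places of L *)

Section Places.
Variables (p : nat) (k : closedFieldType) (X : witt_data k) (F L : fieldType).
Variables (cst : {rmorphism k -> F}) (u : option k -> F) (v : option k -> F -> int).
Variables (iota : {rmorphism F -> L}) (D : L -> L) (lam : option k -> F).
Variables (f h : F) (theta : {poly F}) (y1 y2 : L).
Hypotheses (k_char : p \in [pchar k]) (p_gt2 : (2 < p)%N) (X_norm : normalized_data p X).
Hypothesis pts : function_field_points p cst u v.
Hypothesis DD : forall a b, D (a + b) = D a + D b.
Hypothesis DM : forall a b, D (a * b) = D a * b + a * D b.
Hypothesis DC : forall c, D (iota (cst c)) = 0.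
Hypothesis D_iota : forall a, exists b, D (iota a) = iota b /\
  forall P n, vge (v P) n a -> vge (v P) (n + dlog_ord P) b.
Hypothesis lamP : forall P, [/\ lam P != 0, v P (lam P) = dlog_ord P
  & D (iota (u P)) = iota (lam P * u P)].
Hypothesis y1E : y1 ^+ p - y1 = iota f.
Hypothesis y2E : y2 ^+ p - y2 = witt_g p y1 + iota h.
Local Notation ev q := (map_poly iota q).[y1].
Hypothesis span : forall (t : {poly F}) (w : L), exists2 B : nat -> {poly F},
  forall j, (size (B j) <= p)%N & w = \sum_(j < p) (y2 - ev t) ^+ j * ev (B j).
Hypothesis f_B1 : forall P, P \in B1 X -> f != 0 /\ v P f = - (d_ X P)%:Z.
Hypothesis f_reg : forall P, P \notin B1 X -> vge (v P) 0 f.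
Hypothesis h_B1 : forall P, P \in B1 X -> vge (v P) (- (e_ X P)%:Z) h.
Hypothesis h_B2 : forall P, P \in B2 X -> P \notin B1 X -> h != 0 /\ v P h = - (e_ X P)%:Z.
Hypothesis h_reg : forall P, P \notin B2 X -> vge (v P) 0 h.
Hypothesis theta_size : (size theta <= p)%N.
Hypothesis theta_B1 : forall P, P \in B1 X ->
  wt (fun a => p%:Z * v P a) (d_ X P) (p%:Z * (d_ X P)%:Z - 1) theta.
Hypothesis theta_reg : forall P, P \notin B1 X -> wt (v P) 0 0 theta.
Hypothesis frob_theta : forall P, P \in B1 X ->
  wt (fun a => p%:Z * v P a) (d_ X P) ((d_ X P)%:Z * (p%:Z ^+ 2 - p%:Z + 1) - 1)
    (h%:P - frob p f theta).

Let p_prime : prime p := pcharf_prime k_char.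
Let p_gt1 : (1 < p)%N := prime_gt1 p_prime.
Let charF : p \in [pchar F]. Proof. by rewrite (fmorph_pchar cst). Qed.
Let charL : p \in [pchar L]. Proof. by rewrite (fmorph_pchar iota). Qed.
Let rho := y2 - ev theta.

Lemma D_exp z n : D (z ^+ n) = (z ^+ n.-1 * D z) *+ n.
Proof.
case: n => [|n]; first by rewrite expr0 (derivation1 DC) mulr0n.
elim: n => [|n IHn]; first by rewrite expr0 mul1r mulr1n expr1.
by rewrite exprS DM IHn mulrnAr mulrA -exprS [D z * _]mulrC addrC -mulrSr.
Qed.

Lemma D_pth z : D (z ^+ p) = 0.
Proof. by rewrite D_exp mulrn_pchar. Qed.

Lemma D_opp z : D (- z) = - D z.
Proof.
apply/eqP; rewrite -addr_eq0 -DD addNr; apply/eqP.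
by apply: (@addrI _ (D 0)); rewrite -DD !addr0.
Qed.

Lemma D0 : D 0 = 0.
Proof. by apply: (@addrI _ (D 0)); rewrite -DD !addr0. Qed.

Lemma D_y1 : D y1 = - D (iota f).
Proof. by rewrite -y1E DD D_opp D_pth add0r opprK. Qed.

Lemma wbin_diag l : (0 < l < p)%N -> (l * wbin p l)%N = 'C(p.-1, l.-1).
Proof.
move=> /andP[l_gt0 ltl]; apply/eqP; rewrite -(eqn_pmul2l (prime_gt0 p_prime)).
by rewrite mulnCA (mul_wbin p_prime) ?l_gt0 // mul_bin_diag prednK.
Qed.

(** D kills y1^p, and l 'C(p, l) / p = 'C(p - 1, l - 1). Differentiating the form of g in y1^p and f
    thus gives the binomial expansion of (y1^p - f)^(p-1) = y1^(p-1) without its last term. *)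
Lemma D_witt_g : D (witt_g p y1) = D y1 * (y1 ^+ p.-1 - (- iota f) ^+ p.-1).
Proof.
have eA : y1 - y1 ^+ p = - iota f by rewrite -y1E opprB.
have DA : D (y1 - y1 ^+ p) = D y1 by rewrite DD D_opp D_pth oppr0 addr0.
rewrite (witt_gE p_prime y1 p_gt2 charL) (big_morph D DD D0).
have term l : (0 < l < p)%N ->
    D ((wbin p l)%:R * (y1 - y1 ^+ p) ^+ l * y1 ^+ (p * (p - l))) =
    D y1 * ((y1 ^+ p) ^+ (p.-1 - l.-1) * (- iota f) ^+ l.-1 *+ 'C(p.-1, l.-1)).
  move=> ltl; have -> : (p.-1 - l.-1)%N = (p - l)%N by lia.
  have Dn : D (wbin p l)%:R = 0 by rewrite -(rmorph_nat iota) -(rmorph_nat cst) DC.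
  rewrite -(wbin_diag ltl) [(p * (p - l))%N]mulnC exprM DM D_pth mulr0 addr0 DM Dn mul0r add0r.
  rewrite D_exp DA eA mulr_natl -mulrnA mulrnAl mulrnAr [(y1 ^+ p) ^+ _]exprAC; congr (_ *+ _).
  by rewrite mulrC [_ * D y1]mulrC mulrCA mulrA.
rewrite (eq_big_nat _ _ term) -mulr_sumr; congr (_ * _).
have {2}-> : y1 = y1 ^+ p + - iota f by rewrite -eA addrC subrK.
rewrite exprDn -(big_mkord xpredT (fun s => (y1 ^+ p) ^+ (p.-1 - s) * (- iota f) ^+ s *+ 'C(p.-1, s))).
rewrite big_nat_recr //= subnn expr0 mul1r binn mulr1n addrK.
by rewrite big_add1.
Qed.

Lemma D_rho : D rho = - (D (witt_g p y1) + D (iota h)) - D (ev theta).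
Proof. by rewrite -DD -y2E /rho !DD !D_opp D_pth add0r opprK. Qed.

Lemma D_iota_exact P a : a != 0 -> ~~ (p %| `|v P a|)%N ->
  exists b, [/\ D (iota a) = iota b, b != 0 & v P b = v P a + dlog_ord P].
Proof.
move=> a0 ndvd; have val := pt_val pts P; have [u0 vu] := pt_unif pts P.
have [l0 vl Du] := lamP P; have [c c0 vc] := pt_leading pts P a0.
have [b' [eb' /(_ P _ vc) vb']] := D_iota (a - cst c * u P ^ v P a).
have n0 : ((v P a)%:~R : F) != 0.
  case: (v P a) ndvd => n /=; first by rewrite (dvdn_pcharf charF).
  by rewrite NegzE mulrNz oppr_eq0 -pmulrn (dvdn_pcharf charF).
set z := cst c * (v P a)%:~R * lam P * u P ^ v P a.
have z0 : z != 0 by rewrite !mulf_neq0 ?fmorph_eq0 ?expfz_neq0.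
have vz : v P z = v P a + dlog_ord P.
  have vn : v P (v P a)%:~R = 0.
    rewrite -(rmorph_int cst) (pt_const pts) //.
    by rewrite -(fmorph_eq0 cst) rmorph_int.
  rewrite !(valM val) ?mulf_neq0 ?fmorph_eq0 ?expfz_neq0 // (pt_const pts) // vn vl valXz // vu.
  by clear; lia.
have ez : D (iota (cst c * u P ^ v P a)) = iota z.
  rewrite rmorphM DM DC mul0r add0r fmorphXz.
  rewrite (derivation_exprz DM DC (l := iota (lam P))) ?fmorph_eq0 ?Du ?rmorphM //.
  by rewrite fmorphXz rmorph_int; ring.
have [|s0 vs] := val_addl val z0 (b := b'); first by apply: vge_le vb'; rewrite vz; clear; lia.
exists (z + b'); split=> //; last by rewrite vs.
by rewrite rmorphD -ez -eb' -DD -rmorphD addrC subrK.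
Qed.

Lemma vge_witt_g (nu : L -> int) : is_val nu -> vge nu 0 y1 -> vge nu 0 (witt_g p y1).
Proof.
move=> nu_val v1; rewrite (witt_gE p_prime y1 p_gt2 charL); apply: (vge_sum nu_val) => l _.
have vX n z : vge nu 0 z -> vge nu 0 (z ^+ n) by move/(vgeX nu_val n); rewrite mul0r.
have := vgeM nu_val (vgeM nu_val (vge_nat nu_val (wbin p l)) (vX l _ (vgeB nu_val v1 (vX p _ v1)))) (vX (p * (p - l))%N _ v1).
by rewrite !addr0.
Qed.

Section PlaceOver.
Variables (nu : L -> int) (Q : option k) (E : int).
Hypotheses (nu_val : is_val nu) (E_gt0 : 0 < E).
Hypothesis nuE : forall a, a != 0 -> nu (iota a) = E * v Q a.
Let pnu (z : L) : int := p%:Z * nu z.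
Let pnu_val : is_val pnu. Proof. exact: (is_val_scale nu_val). Qed.
Let val := pt_val pts Q.
Let p_pos : 0 < p%:Z. Proof. by rewrite ltz_nat prime_gt0. Qed.

Lemma vge_D_iota n a : vge (v Q) n a -> vge nu (E * (n + dlog_ord Q)) (D (iota a)).
Proof.
by move=> va; have [b [-> /(_ Q n va) vb]] := D_iota a; apply: (vge_iota E_gt0 nuE).
Qed.

Lemma vge_ev (d : int) M q : vge pnu (- (E * d)) y1 ->
  wt (fun a => p%:Z * v Q a) d M q -> vge pnu (- (E * M)) (ev q).
Proof.
move=> vy wq; rewrite horner_coef; apply: (vge_sum pnu_val) => i _; rewrite coef_map /=.
have vi : vge pnu (E * (d * i%:Z - M)) (iota q`_i).
  case: (eqVneq q`_i 0) (wq i) => [->|q0]; first by rewrite rmorph0 => _; apply: vge0.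
  by rewrite !vgeE ?fmorph_eq0 // /pnu nuE // mulrCA ler_pM2l.
by apply: vge_le (vgeM pnu_val vi (vgeX pnu_val i vy)); clear; lia.
Qed.

Lemma D_ev q : D (ev q) =
  \sum_(i < size q) (D (iota q`_i) * y1 ^+ i + iota q`_i * (y1 ^+ i.-1 * D y1) *+ i).
Proof.
rewrite horner_coef size_map_poly (big_morph D DD D0); apply: eq_bigr => i _.
by rewrite coef_map DM D_exp mulrnAr.
Qed.


Definition regular_form (w : L) : Prop :=
  exists t z, [/\ t != 0, nu t = 1, z = 0 \/ 0 <= nu z & w = z * D t].

Lemma regular_of t w : t != 0 -> nu t = 1 -> D t != 0 -> vge nu (nu (D t)) w ->
  regular_form w.
Proof.
move=> t0 nt Dt0 vw; exists t, (w / D t); split=> //; last by rewrite divfK.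
case: (eqVneq w 0) vw => [-> _|w0]; first by left; rewrite mul0r.
by rewrite vgeE // (val_div nu_val) // subr_ge0; right.
Qed.

Variable tau : L.
Hypotheses (tau0 : tau != 0) (nu_tau : nu tau = 1).

Local Notation form a1 a2 P n := (rho ^+ a2 * y1 ^+ a1 * iota ((u P)^-1 ^+ n)).

Lemma vge_form_at P n :
  vge nu (if P == Q then - (E * n%:Z) else E * (Q == None)%:Z * n%:Z) (iota ((u P)^-1 ^+ n)).
Proof.
case: eqP => [->|neq].
  have [u0 vu] := pt_unif pts Q.
  by rewrite vgeE ?fmorph_eq0 ?expf_neq0 ?invr_eq0 // nuE ?expf_neq0 ?invr_eq0 //
    (valX val) ?invr_eq0 // (valV val) // vu mulN1r mulrN.
by rewrite -mulrA; apply: (vge_iota E_gt0 nuE); apply: (vgeX val); apply: (pt_other pts).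
Qed.

Lemma rho_as : rho ^+ p - rho = witt_g p y1 + iota h - (ev theta) ^+ p + ev theta.
Proof.
have -> : rho ^+ p = y2 ^+ p - (ev theta) ^+ p.
  by apply/eqP; rewrite eq_sym subr_eq -(exprD_char charL) /rho subrK.
by rewrite -y2E /rho; ring.
Qed.

Lemma int_mod_cancel (g x y : nat) (s : int) : (0 < g < p)%N -> (x < p)%N -> (y < p)%N ->
  g%:Z * x%:Z - g%:Z * y%:Z = p%:Z * s -> x = y.
Proof.
move=> ltg ltx lty; case: s => n e.
  by apply: (@mod_cancel p p_prime p_gt2 g x y 0 n) => //; move: e; clear; lia.
by apply: (@mod_cancel p p_prime p_gt2 g x y n.+1 0) => //; move: e; rewrite NegzE; clear; lia.
Qed.

Lemma D_exp_log z n : z != 0 -> D (z ^+ n) = z ^+ n * (n%:R * (D z / z)).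
Proof.
move=> z0; rewrite D_exp; case: n => [|n]; first by rewrite mulr0n mul0r mulr0.
by rewrite /= -mulr_natl exprS; field.
Qed.

Lemma D_monomial j i n : rho != 0 -> y1 != 0 ->
  D (rho ^+ j * y1 ^+ i * iota (u Q ^ n)) = rho ^+ j * y1 ^+ i * iota (u Q ^ n) *
    (j%:R * (D rho / rho) + (i%:R * (D y1 / y1) + n%:~R * iota (lam Q))).
Proof.
move=> r0 y0; have [u0 _] := pt_unif pts Q; have [_ _ Du] := lamP Q.
rewrite !DM !D_exp_log // fmorphXz (derivation_exprz DM DC (l := iota (lam Q))) ?fmorph_eq0 ?Du ?rmorphM //.
by ring.
Qed.

Lemma vge_intr (n : int) : vge nu 0 (n%:~R : L).
Proof.
rewrite -(rmorph_int iota) -(rmorph_int cst) -(mulr0 E).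
exact: (vge_iota E_gt0 nuE (vge_cst pts Q _)).
Qed.

Lemma vge_Q_lam : vge nu (E * dlog_ord Q) (iota (lam Q)).
Proof. by have [l0 vl _] := lamP Q; rewrite vgeE ?fmorph_eq0 // nuE // vl. Qed.

Section RegularBase.
Hypothesis QB1 : Q \notin B1 X.

Lemma Q_finite : Q != None.
Proof. by apply: contraNneq QB1 => ->; apply: (nd_infty X_norm). Qed.

Let dlogQ : dlog_ord Q = -1. Proof. by have := Q_finite; case: Q. Qed.

Let vf : vge nu 0 (iota f).
Proof. by rewrite -(mulr0 E); apply: (vge_iota E_gt0 nuE); apply: f_reg. Qed.

Lemma vge_y1_reg : vge nu 0 y1.
Proof. by apply: (as_vge_ge0 nu_val p_gt1); rewrite y1E. Qed.

Lemma vge_ev_reg q : wt (v Q) 0 0 q -> vge nu 0 (ev q).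
Proof.
move=> wq; rewrite horner_coef; apply: (vge_sum nu_val) => i _; rewrite coef_map /=.
have vq : vge nu 0 (iota q`_i).
  by rewrite -(mulr0 E); apply: (vge_iota E_gt0 nuE); have := wq i; rewrite mul0r subr0.
by have := vgeM nu_val vq (vgeX nu_val i vge_y1_reg); rewrite mul0r addr0.
Qed.

Lemma vge_witt_g_reg : vge nu 0 (witt_g p y1).
Proof. exact: (vge_witt_g nu_val vge_y1_reg). Qed.

Lemma approx_y1 : approximable iota nu y1.
Proof.
apply: (approx_artin_schreier charL nu_val E_gt0 nuE (vge_cst pts Q) (pt_residue pts (P := Q)));
  rewrite y1E //; exact: approx_iota.
Qed.

(* As Q is unramified in F(y1), y1 is a limit of elements of F, so a uniformizer
   can be replaced by a polynomial in rho over F. *)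
Lemma tau_approx : exists a : 'I_p -> F,
  \sum_(j < p) rho ^+ j * iota (a j) != 0 /\ nu (\sum_(j < p) rho ^+ j * iota (a j)) = 1.
Proof.
have [B _ eB] := span theta tau.
have ex (j : 'I_p) : exists a, vge nu 2 (rho ^+ j * (ev (B j) - iota a)).
  have [n _ vn] := vge_some nu (rho ^+ j).
  have [a va] := approx_horner nu_val (B j) approx_y1 (2 - n); exists a.
  by apply: vge_le (vgeM nu_val vn va); rewrite addrC subrK.
have [a va] := fin_all_exists ex; exists a.
have -> : \sum_(j < p) rho ^+ j * iota (a j) = tau + - \sum_(j < p) rho ^+ j * (ev (B j) - iota (a j)).
  by rewrite {1}eB -sumrB; apply: eq_bigr => j _; rewrite -/rho; ring.
rewrite -nu_tau; apply: val_addl => //; rewrite nu_tau (vgeN nu_val).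
exact: (vge_sum nu_val).
Qed.

(** Here y1 and rho are both limits of elements of k(x), hence so is every uniformizer. An element
    of k(x) then has order 1, which forces E = 1 and makes u_Q a uniformizer. *)
Lemma regular_unramified m : Q \notin B2 X -> m \in W p X ->
  regular_form (form m.1.1.2 m.1.2 m.1.1.1 m.2).
Proof.
case: m => [[[P a1] a2] n] /= QB2; rewrite mem_W ?prime_gt0 // => /and4P[PB2 _ _ _].
have v1 := vge_y1_reg; have vt := vge_ev_reg (theta_reg QB1).
have vh : vge nu 0 (iota h).
  by rewrite -(mulr0 E); apply: (vge_iota E_gt0 nuE); apply: h_reg.
have vR : vge nu 0 (rho ^+ p - rho).
  rewrite rho_as; apply: (vgeD nu_val) => //; apply: (vgeB nu_val).
    by apply: (vgeD nu_val) => //; apply: vge_witt_g_reg.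
  by have := vgeX nu_val p vt; rewrite mul0r.
have vr : vge nu 0 rho by apply: (as_vge_ge0 nu_val p_gt1).
have Ar : approximable iota nu rho.
  apply: (approx_artin_schreier charL nu_val E_gt0 nuE (vge_cst pts Q) (pt_residue pts (P := Q))) => //.
  rewrite rho_as; apply: (approxD nu_val); last exact: (approx_horner nu_val _ approx_y1).
  rewrite -mulN1r; apply: (approxD nu_val).
    apply: (approxD nu_val); last exact: approx_iota.
    rewrite (witt_gE p_prime y1 p_gt2 charL); apply: (approx_sum nu_val) => l _.
    have -> : y1 - y1 ^+ p = iota (- f) by rewrite rmorphN -y1E opprB.
    rewrite -(rmorph_nat iota) -rmorphXn -rmorphM.
    apply: (approxM nu_val); first exact: approx_iota.
    exact: (approx_exp nu_val _ approx_y1).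
  apply: (approxM nu_val); first by rewrite -(rmorphN1 iota); apply: approx_iota.
  by apply: (approx_exp nu_val); apply: (approx_horner nu_val _ approx_y1).
have [B _ eB] := span theta tau.
have [a va] : exists a, vge nu 2 (tau - iota a).
  suff Atau : approximable iota nu tau by apply: Atau.
  rewrite eB; apply: (approx_sum nu_val) => j _; apply: (approxM nu_val).
    exact: (approx_exp nu_val).
  exact: (approx_horner nu_val _ approx_y1).
have [ia0 na] : iota a != 0 /\ nu (iota a) = 1.
  have -> : iota a = tau + - (tau - iota a) by ring.
  by rewrite -nu_tau; apply: val_addl => //; rewrite nu_tau (vgeN nu_val).
have a0 : a != 0 by rewrite -(fmorph_eq0 iota).
have E1 : E = 1.
  have : (E %| nu (iota a))%Z by rewrite nuE // dvdz_mulr.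
  by rewrite na dvdz1 => /eqP; move: E_gt0; clear; lia.
have [u0 vu] := pt_unif pts Q; have [l0 vl Du] := lamP Q.
apply: (@regular_of (iota (u Q))).
- by rewrite fmorph_eq0.
- by rewrite nuE // vu mulr1.
- by rewrite Du fmorph_eq0 mulf_neq0.
rewrite Du nuE ?mulf_neq0 // (valM val) // vl vu dlogQ addNr mulr0.
have PQ : P != Q by apply: contraNneq QB2 => <-.
have := vge_form_at P n; rewrite (negPf PQ) (negPf Q_finite) mulr0 mul0r => vx.
have := vgeM nu_val (vgeM nu_val (vgeX nu_val a2 vr) (vgeX nu_val a1 v1)) vx.
by rewrite !mul0r !addr0.
Qed.

(** The pole of h gives p nu(rho) = -E e. The orders of the rho^j a with a in k(x) and j < p are
    distinct since p does not divide e, so one of them is 1; this leaves E = p and a uniformizer T =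
    rho^j u^n. *)
Lemma regular_tame m : Q \in B2 X -> m \in W p X ->
  regular_form (form m.1.1.2 m.1.2 m.1.1.1 m.2).
Proof.
case: m => [[[P a1] a2] n'] /= QB2; rewrite mem_W ?prime_gt0 // => /and4P[PB2 lt1 lt2 Wc].
have [h0 vh] := h_B2 QB2 QB1; have v1 := vge_y1_reg; have vt := vge_ev_reg (theta_reg QB1).
have [e_gt0 e_dvd] := pole_gt0 p_prime p_gt2 X_norm QB2; have e_lt := pole_lt p_prime p_gt2 X_norm QB2.
rewrite /pole (negPf QB1) in e_gt0 e_dvd e_lt.
set e := e_ X Q in vh e_gt0 e_dvd e_lt.
have nh : nu (iota h) = - (E * e%:Z) by rewrite nuE // vh mulrN.
have ih0 : iota h != 0 by rewrite fmorph_eq0.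
have [R0 nR] : rho ^+ p - rho != 0 /\ nu (rho ^+ p - rho) = - (E * e%:Z).
  have -> : rho ^+ p - rho = iota h + (witt_g p y1 - (ev theta) ^+ p + ev theta).
    by rewrite rho_as; ring.
  rewrite -nh; apply: val_addl => //; rewrite nh.
  apply: (@vge_le _ _ 0); first by move: E_gt0 e_gt0; clear; nia.
  apply: (vgeD nu_val) => //; apply: (vgeB nu_val); first exact: vge_witt_g_reg.
  by have := vgeX nu_val p vt; rewrite mul0r.
have [|r0 nr] := as_val nu_val p_gt1 R0; first by rewrite nR; move: E_gt0 e_gt0; clear; nia.
rewrite nR in nr.
have [a [t0 nt]] := tau_approx.
have [j _ [z0 nz]] : exists2 j, j \in index_enum 'I_p & rho ^+ j * iota (a j) != 0 /\
    nu (\sum_(j < p) rho ^+ j * iota (a j)) = nu (rho ^+ j * iota (a j)).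
  apply: (val_sum_neq0 nu_val _ (index_enum_uniq _) t0) => i j _ _.
  rewrite !mulf_eq0 !negb_or !fmorph_eq0 => /andP[ri ai] /andP[rj aj].
  rewrite !(valM nu_val) ?fmorph_eq0 // !nuE // !(valX nu_val) // => eqn.
  apply/val_inj/(@int_mod_cancel e _ _ (v Q (a i) - v Q (a j))); rewrite ?e_gt0 ?e_lt ?ltn_ord //.
  apply: (mulfI (lt0r_neq0 E_gt0)).
  have -> : E * (e%:Z * i%:Z - e%:Z * j%:Z) = p%:Z * (nu rho * j%:Z - nu rho * i%:Z).
    by transitivity (p%:Z * nu rho * (j%:Z - i%:Z)); first rewrite nr; ring.
  have -> : nu rho * j%:Z - nu rho * i%:Z = E * (v Q (a i) - v Q (a j)).
    by move: eqn; clear; lia.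
  by ring.
rewrite nt mulf_eq0 negb_or fmorph_eq0 in nz z0; have /andP[rj aj] := z0.
rewrite (valM nu_val) ?fmorph_eq0 // nuE // (valX nu_val) // in nz.
set n := v Q (a j) in nz.
have eE : E * (p%:Z * n - e%:Z * j%:Z) = p%:Z.
  have -> : E * (p%:Z * n - e%:Z * j%:Z) = p%:Z * (E * n) + (- (E * e%:Z)) * j%:Z by ring.
  by rewrite -nr -mulrA -mulrDr [E * n + _]addrC -nz mulr1.
have Ep : E = p%:Z.
  have [m em] : exists m : nat, E = m%:Z by exists `|E|%N; move: E_gt0; clear; lia.
  have : (m %| p)%N.
    by have : (m%:Z %| p%:Z)%Z by rewrite -eE em dvdz_mulr.
  case/primeP: p_prime => _ dv /dv /orP[/eqP m1|/eqP mp]; last by rewrite em mp.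
  have : (p %| e)%N.
    have : (p%:Z %| - (E * e%:Z))%Z by rewrite -nr dvdz_mulr.
    by rewrite em m1 mul1r dvdzE abszN.
  by move/(dvdn_leq e_gt0); move: e_lt; clear; lia.
have nrho : nu rho = - e%:Z.
  by apply: (mulfI (lt0r_neq0 p_pos)); rewrite nr Ep mulrN.
have pj : p%:Z * n - e%:Z * j%:Z = 1.
  by apply: (mulfI (lt0r_neq0 E_gt0)); rewrite eE mulr1.
have [u0 vu] := pt_unif pts Q.
have nun : nu (iota (u Q ^ n)) = p%:Z * n by rewrite nuE ?expfz_neq0 // valXz // vu mul1r Ep.
set T := rho ^+ j * y1 ^+ 0 * iota (u Q ^ n).
have T0 : T != 0 by rewrite /T expr0 mulr1 mulf_neq0 ?expf_neq0 ?fmorph_eq0 ?expfz_neq0.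
have nT : nu T = 1.
  rewrite /T expr0 mulr1 (valM nu_val) ?expf_neq0 ?fmorph_eq0 ?expfz_neq0 //.
  by rewrite nun (valX nu_val) // nrho -pj; clear; lia.
have dlogQ1 : dlog_ord Q = -1 by have := Q_finite; case: (Q).
have vDy1 : vge nu (- p%:Z) (D y1).
  rewrite D_y1 (vgeN nu_val); apply: vge_le (vge_D_iota (f_reg QB1)).
  by rewrite dlogQ1 Ep; clear; lia.
have [Dr0 nDr] : D rho != 0 /\ nu (D rho) = - (p%:Z * (e%:Z + 1)).
  have [|b [eb b0 vb]] := @D_iota_exact Q h h0.
    by rewrite vh abszN; apply/negP => /(dvdn_leq e_gt0); move: e_lt; clear; lia.
  have nD : nu (- D (iota h)) = - (p%:Z * (e%:Z + 1)).
    by rewrite (valN nu_val) eb nuE // vb vh dlogQ1 Ep; clear; lia.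
  have -> : D rho = - D (iota h) + (- D (witt_g p y1) - D (ev theta)) by rewrite D_rho; ring.
  rewrite -nD; apply: val_addl => //; first by rewrite oppr_eq0 eb fmorph_eq0.
  rewrite nD; apply: (@vge_le _ _ (- p%:Z)); first by move: e_gt0 p_gt2; clear; nia.
  have vX i z : vge nu 0 z -> vge nu 0 (z ^+ i) by move/(vgeX nu_val i); rewrite mul0r.
  apply: (vgeB nu_val).
    rewrite (vgeN nu_val) D_witt_g; apply: (@vge_le _ _ (- p%:Z + 0)); first by rewrite addr0.
    apply: (vgeM nu_val) => //; apply: (vgeB nu_val); first exact: vX.
    apply: vX; rewrite (vgeN nu_val) -(mulr0 E); apply: (vge_iota E_gt0 nuE); exact: f_reg.
  rewrite D_ev; apply: (vge_sum nu_val) => i _; apply: (vgeD nu_val).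
    apply: (@vge_le _ _ (- p%:Z + 0)); first by rewrite addr0.
    apply: (vgeM nu_val) (vX _ _ v1).
    have := theta_reg QB1 i; rewrite mul0r subr0 => /(vge_D_iota).
    by apply: vge_le; rewrite dlogQ1 Ep; clear; lia.
  apply: (vge_mulrn nu_val); apply: (@vge_le _ _ (0 + (0 + - p%:Z))); first by rewrite !add0r.
  apply: (vgeM nu_val); last by apply: (vgeM nu_val) => //; apply: vX.
  by rewrite -(mulr0 E); apply: (vge_iota E_gt0 nuE); have := theta_reg QB1 i; rewrite mul0r subr0.
have [jn0 njn] : (j%:R : L) != 0 /\ nu j%:R = 0.
  apply: (nat_val charL nu_val); apply/negP => /dvdnP[q eq].
  have : (p%:Z %| p%:Z * n - e%:Z * j%:Z)%Z by rewrite eq PoszM mulrA [_ * p%:Z]mulrC -mulrBr dvdz_mulr.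
  by rewrite pj dvdz1 => /eqP; move: p_gt2; clear; lia.
(* In the logarithmic derivative of T the term j D rho / rho dominates. The value is -(p - 1)(e +
   1), so dx has order (p - 1)(e + 1). *)
have [DT0 nDT] : D T != 0 /\ nu (D T) = 1 - p%:Z * (e%:Z + 1) + e%:Z.
  have eDT : D T = T * (j%:R * (D rho / rho) + n%:~R * iota (lam Q)).
    rewrite /T expr0 mulr1 DM D_exp_log // fmorphXz.
    have [_ _ Du] := lamP Q.
    rewrite (derivation_exprz DM DC (l := iota (lam Q))) ?fmorph_eq0 ?Du ?rmorphM //.
    by ring.
  have main0 : j%:R * (D rho / rho) != 0 by rewrite !mulf_neq0 ?invr_eq0.
  have nmain : nu (j%:R * (D rho / rho)) = - (p%:Z * (e%:Z + 1)) + e%:Z.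
    by rewrite (valM nu_val) ?mulf_neq0 ?invr_eq0 // njn (val_div nu_val) // nDr nrho; clear; lia.
  have [|s0 ns] := val_addl nu_val main0 (b := n%:~R * iota (lam Q)).
    rewrite nmain; apply: vge_le (vgeM nu_val (vge_intr n) vge_Q_lam).
    by rewrite dlogQ1 Ep; move: e_gt0 p_gt2; clear; nia.
  rewrite eDT; split; first by rewrite mulf_neq0.
  by rewrite (valM nu_val) // ns nmain nT; clear; lia.
apply: (@regular_of T) => //; rewrite nDT.
have vr2 : vge nu (- e%:Z * a2%:Z) (rho ^+ a2) by apply: (vgeX nu_val); rewrite vgeE // nrho.
have := vgeM nu_val (vgeM nu_val vr2 (vgeX nu_val a1 v1)) (vge_form_at P n').
apply: vge_le; rewrite Ep (negPf Q_finite) mulr0 mul0r mul0r.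
case: eqP Wc => [->|_ _]; last by move: e_gt0 lt2 p_gt2; clear; nia.
rewrite /W_cond (negPf QB1) -/e => /andP[_]; move: lt2; clear; nia.
Qed.

End RegularBase.

Section WildBase.
Hypothesis QB1 : Q \in B1 X.
Let d := d_ X Q.
Let M : int := p%:Z * p%:Z - p%:Z + 1.

Let QB2 : Q \in B2 X. Proof. exact: (nd_sub X_norm). Qed.
Let d_gt0 : (0 < d)%N.
Proof. by have [] := pole_gt0 p_prime p_gt2 X_norm QB2; rewrite /pole QB1. Qed.
Let d_lt : (d < p)%N.
Proof. by have := pole_lt p_prime p_gt2 X_norm QB2; rewrite /pole QB1. Qed.
Let f0 : f != 0. Proof. by have [] := f_B1 QB1. Qed.
Let vf : v Q f = - d%:Z. Proof. by have [] := f_B1 QB1. Qed.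
Let M_gt : p%:Z < M. Proof. by rewrite /M; move: p_gt2; clear; nia. Qed.

Lemma y1_wild : y1 != 0 /\ p%:Z * nu y1 = - (E * d%:Z).
Proof.
have nf : nu (iota f) = - (E * d%:Z) by rewrite nuE // vf mulrN.
rewrite -nf -y1E; apply: (as_val nu_val p_gt1); rewrite y1E ?fmorph_eq0 // nf.
by move: E_gt0 d_gt0; clear; nia.
Qed.

Let vy1 : vge pnu (- (E * d%:Z)) y1.
Proof. by have [y0 ny] := y1_wild; rewrite vgeE // /pnu ny. Qed.

Lemma ev_frob : ev (frob p f theta) = (ev theta) ^+ p.
Proof.
have eX : ev ('X + f%:P) = y1 ^+ p.
  by rewrite rmorphD /= map_polyX map_polyC /= hornerD hornerX hornerC -y1E addrC subrK.
rewrite [in RHS](horner_coef_wide y1 (n := p)) ?size_map_poly //.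
rewrite (big_morph (fun z : L => z ^+ p) (exprD_char charL) (id1 := 0)); last first.
  by rewrite expr0n (gtn_eqF (prime_gt0 p_prime)).
rewrite /frob rmorph_sum horner_sum; apply: eq_bigr => i _.
rewrite rmorphM rmorphXn hornerM horner_exp eX /= map_polyC hornerC /= coef_map.
by rewrite exprMn rmorphXn exprAC.
Qed.

(** The term i = 1 of g(y1) is -y1^(p(p-1)+1), whence M = p^2 - p + 1. The other terms have smaller
    degree in y1, and theta was chosen so that h - theta(y1)^p has a strictly smaller pole. *)
Lemma rho_wild : rho != 0 /\ p%:Z * (p%:Z * nu rho) = - (E * d%:Z * M).
Proof.
have [y0 ny] := y1_wild; pose y := - y1 ^+ (p * p.-1 + 1).
have z0 : y != 0 by rewrite oppr_eq0 expf_neq0.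
have nz : pnu y = - (E * d%:Z * M).
  rewrite /y (valN pnu_val) (valX pnu_val) // /pnu ny.
  have -> : (p * p.-1 + 1)%N%:Z = M by rewrite /M; move: p_gt1; clear; nia.
  by ring.
have eR : rho ^+ p - rho = y + (\sum_(2 <= i < p) (-1) ^+ i * (wbin p i)%:R * y1 ^+ (p * (p - i) + i)
    + (ev (h%:P - frob p f theta) + ev theta)).
  rewrite rho_as (witt_g_wbin p_prime y1 p_gt2 charL) big_ltn // expr1.
  have -> : wbin p 1 = 1%N by rewrite /wbin bin1 divnn prime_gt0.
  rewrite rmorphB /= map_polyC /= hornerD hornerN hornerC ev_frob /y subn1; ring.
have [R0 nR] : rho ^+ p - rho != 0 /\ pnu (rho ^+ p - rho) = - (E * d%:Z * M).
  rewrite eR -nz; apply: (val_addl pnu_val) => //; rewrite nz.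
  apply: (vgeD pnu_val).
    rewrite big_seq; apply: (vge_sum pnu_val) => i; rewrite mem_index_iota => lti.
    apply: (@vge_le _ _ (0 + - (E * d%:Z) * (p * (p - i) + i)%N%:Z)).
      by move: lti E_gt0 d_gt0; rewrite /M; clear; nia.
    apply: (vgeM pnu_val); last exact: (vgeX pnu_val).
    apply: (@vge_le _ _ (0 * i%:Z + 0)); first by rewrite mul0r addr0.
    apply: (vgeM pnu_val); last exact: (vge_nat pnu_val).
    by apply: (vgeX pnu_val); rewrite (vgeN pnu_val) vgeE ?oner_eq0 ?(val1 pnu_val).
  apply: (vgeD pnu_val).
    apply: vge_le (vge_ev vy1 (frob_theta QB1)).
    by rewrite expr2 -/d /M; move: E_gt0; clear; nia.
  apply: vge_le (vge_ev vy1 (theta_B1 QB1)).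
  have : 0 <= E * (d%:Z * (M - p%:Z)).
    by rewrite !mulr_ge0 ?(ltW E_gt0) // subr_ge0 ltW.
  by rewrite -/d; move: E_gt0; clear; lia.
have [|r0 nr] := as_val pnu_val p_gt1 R0; last by rewrite -nR -nr.
by rewrite nR oppr_lt0 !mulr_gt0 // (lt_trans p_pos).
Qed.

(* The monomials rho^j y1^i c, with c in F and j, i < p, have distinct orders, so
   one of those of a uniformizer has order 1; this forces E = p^2. *)
Lemma wild_monomial : exists j i n, [/\ E = p%:Z * p%:Z, ~~ (p %| j)%N &
  nu (rho ^+ j * y1 ^+ i * iota (u Q ^ n)) = 1].
Proof.
have [y0 ny] := y1_wild; have [r0 nr] := rho_wild.
have [B sB eB] := span theta tau.
pose G (ji : 'I_p * 'I_p) := rho ^+ ji.1 * y1 ^+ ji.2 * iota (B ji.1)`_ji.2.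
have eG : \sum_ji G ji = tau.
  rewrite eB -(pair_bigA _ (fun j i => G (j, i))) /=; apply: eq_bigr => j _.
  rewrite (@horner_coef_wide _ p (map_poly iota (B j)) y1) ?size_map_poly // mulr_sumr.
  apply: eq_bigr => i _.
  by rewrite /G coef_map /= -mulrA [y1 ^+ i * _]mulrC.
have nG (j i : nat) c : c != 0 -> p%:Z * (p%:Z * nu (rho ^+ j * y1 ^+ i * iota c)) =
    E * (p%:Z * p%:Z * v Q c - d%:Z * M * j%:Z - p%:Z * d%:Z * i%:Z).
  move=> c0; rewrite !(valM nu_val) ?mulf_neq0 ?expf_neq0 ?fmorph_eq0 // !(valX nu_val) // nuE //.
  transitivity (p%:Z * (p%:Z * nu rho) * j%:Z + p%:Z * (p%:Z * nu y1) * i%:Z + p%:Z * p%:Z * (E * v Q c)).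
    by ring.
  by rewrite nr ny; ring.
have inj : {in index_enum ('I_p * 'I_p)%type &, forall s t, G s != 0 -> G t != 0 -> nu (G s) = nu (G t) -> s = t}.
  move=> [j i] [j' i'] _ _; rewrite /G /= !mulf_eq0 !negb_or !fmorph_eq0.
  move=> /andP[_ c0] /andP[_ c'0] eqn.
  have := nG j i _ c0; rewrite eqn nG // => /(mulfI (lt0r_neq0 E_gt0)) eq1.
  (* M = 1 modulo p, so the order modulo p determines d j; for equal j, dividing by p and reducing
     again determines d i. *)
  have jj : j' = j.
    apply/val_inj/(@int_mod_cancel d _ _ (p%:Z * (v Q (B j')`_i' - v Q (B j)`_i)
      - d%:Z * (i'%:Z - i%:Z) - (p%:Z - 1) * d%:Z * (j'%:Z - j%:Z))); rewrite ?d_gt0 ?d_lt ?ltn_ord //=.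
    by move: eq1; rewrite /M; clear; lia.
  subst j'; congr pair; apply/esym/val_inj/(@int_mod_cancel d _ _ (v Q (B j)`_i' - v Q (B j)`_i));
    rewrite ?d_gt0 ?d_lt ?ltn_ord //=.
  apply: (mulfI (lt0r_neq0 p_pos)); by move: eq1; clear; lia.
have [|[j i] _ [z0 nz]] := val_sum_neq0 nu_val inj (index_enum_uniq _); first by rewrite eG.
rewrite eG nu_tau in nz; move: z0; rewrite /G /= mulf_eq0 negb_or fmorph_eq0 => /andP[_ c0].
set c := (B j)`_i in nz c0; have [u0 vu] := pt_unif pts Q; set n := v Q c.
have nT : nu (rho ^+ j * y1 ^+ i * iota (u Q ^ n)) = 1.
  rewrite nz /G /= -/c !(valM nu_val) ?mulf_neq0 ?expf_neq0 ?fmorph_eq0 ?expfz_neq0 // !nuE ?expfz_neq0 //.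
  by rewrite (valXz val) // vu mul1r.
have := nG j i _ c0; rewrite -[X in p%:Z * (p%:Z * X)]nz -/n mulr1 => eE.
have [m em] : exists m : nat, E = m%:Z by exists `|E|%N; move: E_gt0; clear; lia.
have m_gt0 : (0 < m)%N by move: E_gt0; rewrite em.
have dvd1 : (m %| p * p)%N.
  by have : (m%:Z %| (p * p)%N%:Z)%Z by rewrite PoszM eE em dvdz_mulr.
(* p^2 nu(rho) = -E d M, and d M is prime to p. *)
have dvd2 : (p * p %| m)%N.
  pose M' := (p * p.-1 + 1)%N; have eM : M'%:Z = M by rewrite /M /M'; move: p_gt1; clear; nia.
  have : (p * p %| m * (d * M'))%N.
    have : ((p * p)%N%:Z %| - (E * d%:Z * M))%Z by rewrite -nr mulrA PoszM dvdz_mulr.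
    by rewrite dvdzE abszN em -eM -!PoszM -mulnA.
  rewrite Gauss_dvdl // coprimeMl andbb coprimeMr !prime_coprime // (gtnNdvd d_gt0 d_lt).
  by rewrite /M' dvdn_addr ?dvdn_mulr // dvdn1; move: p_gt2; clear; case: eqP => // ->.
have Em : m = (p * p)%N by apply/eqP; rewrite eqn_dvd dvd1.
have Ep : E = p%:Z * p%:Z by rewrite em Em PoszM.
have eS : 1 = p%:Z * p%:Z * n - d%:Z * M * j%:Z - p%:Z * d%:Z * i%:Z.
  by apply: (mulfI (lt0r_neq0 E_gt0)); rewrite -eE mulr1.
exists j, i, n; split=> //; apply/negP => /dvdnP[q eq].
have : (p%:Z %| p%:Z * (p%:Z * n - d%:Z * M * q%:Z - d%:Z * i%:Z))%Z by rewrite dvdz_mulr.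
have -> : p%:Z * (p%:Z * n - d%:Z * M * q%:Z - d%:Z * i%:Z) = 1.
  by rewrite eS eq PoszM; ring.
by rewrite dvdz1 => /eqP; move: p_gt2; clear; lia.
Qed.

Section Derivatives.
Hypothesis Ep : E = p%:Z * p%:Z.

Let ny1 : nu y1 = - (p%:Z * d%:Z).
Proof.
by have [_ ny] := y1_wild; apply: (mulfI (lt0r_neq0 p_pos)); rewrite ny Ep; ring.
Qed.

Let nrho : nu rho = - (d%:Z * M).
Proof.
have [_ nr] := rho_wild; apply: (mulfI (lt0r_neq0 p_pos)); apply: (mulfI (lt0r_neq0 p_pos)).
by rewrite nr Ep; ring.
Qed.

Lemma D_y1_wild : D y1 != 0 /\ nu (D y1) = p%:Z * p%:Z * (dlog_ord Q - d%:Z).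
Proof.
have [|b [eb b0 vb]] := @D_iota_exact Q f f0; first by rewrite vf abszN gtnNdvd.
by rewrite D_y1 oppr_eq0 (valN nu_val) eb fmorph_eq0 nuE // vb vf Ep; split=> //; ring.
Qed.

(** By [D_witt_g] the order comes from D y1 * f^(p-1). The derivative of h is of higher order since
    its pole is smaller than p d, and so is that of theta(y1). *)
Lemma D_rho_wild : D rho != 0 /\
  nu (D rho) = p%:Z * p%:Z * (dlog_ord Q - p%:Z * d%:Z).
Proof.
have [Dy0 nDy] := D_y1_wild; have [y0 _] := y1_wild; set l := dlog_ord Q in nDy *.
have vyX i : vge nu (- (p%:Z * d%:Z) * i%:Z) (y1 ^+ i) by apply: (vgeX nu_val); rewrite vgeE // ny1.
have [Dg0 nDg] : D (witt_g p y1) != 0 /\ nu (D (witt_g p y1)) = p%:Z * p%:Z * (l - p%:Z * d%:Z).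
  have z0 : - (- iota f) ^+ p.-1 != 0 by rewrite oppr_eq0 expf_neq0 // oppr_eq0 fmorph_eq0.
  have nz : nu (- (- iota f) ^+ p.-1) = - (p%:Z * p%:Z * d%:Z * p.-1%:Z).
    by rewrite (valN nu_val) (valX nu_val) ?oppr_eq0 ?fmorph_eq0 // (valN nu_val) nuE // vf Ep; ring.
  have [|s0 ns] := val_addl nu_val z0 (b := y1 ^+ p.-1).
    apply: vge_le (vyX p.-1); rewrite nz.
    have : 0 < p%:Z * d%:Z * p.-1%:Z * (p%:Z - 1).
      by rewrite !mulr_gt0 // ?subr_gt0 ltz_nat //; move: p_gt1; clear; lia.
    by clear; lia.
  rewrite D_witt_g addrC; split; first by rewrite mulf_neq0 // addrC.
  rewrite addrC (valM nu_val) 1?addrC // ns nDy nz.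
  have -> : p.-1%:Z = p%:Z - 1 by move: p_gt1; clear; lia.
  by ring.
have -> : D rho = - D (witt_g p y1) + (- D (iota h) - D (ev theta)) by rewrite D_rho; ring.
rewrite -nDg -(valN nu_val (D _)); apply: (val_addl nu_val); first by rewrite oppr_eq0.
rewrite (valN nu_val) nDg.
have e_lt : ((e_ X Q).+1 <= p * d)%N by apply: (nd_min X_norm).
have vh : vge nu (p%:Z * p%:Z * (l - (e_ X Q)%:Z)) (D (iota h)).
  by apply: vge_le (vge_D_iota (h_B1 QB1)); rewrite Ep -/l; clear; lia.
apply: (vgeB nu_val).
  rewrite (vgeN nu_val); apply: vge_le vh.
  have : 0 <= p%:Z * p%:Z * (p%:Z * d%:Z - (e_ X Q)%:Z - 1).
    by rewrite mulr_ge0 ?mulr_ge0 //; move: e_lt; clear; lia.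
  by move: (mulr_gt0 p_pos p_pos); clear; lia.
have vth i : vge (v Q) (- d%:Z) theta`_i.
  have := theta_B1 QB1 i; case: (eqVneq theta`_i 0) => [-> _|t0]; first exact: vge0.
  rewrite !vgeE // -/d => le; rewrite -(ler_pM2l p_pos); move: le.
  have : 0 <= d%:Z * i%:Z by rewrite mulr_ge0.
  by clear; lia.
rewrite D_ev; apply: (vge_sum nu_val) => i _.
have lti : (i < p)%N := leq_trans (ltn_ord i) theta_size.
apply: (vgeD nu_val).
  apply: vge_le (vgeM nu_val (vge_D_iota (vth i)) (vyX i)); rewrite Ep -/l.
  have : 0 < p%:Z * d%:Z * (p%:Z * p%:Z - p%:Z - i%:Z).
    by rewrite !mulr_gt0 //; move: lti p_gt2; clear; nia.
  by clear; lia.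
apply: (vge_mulrn nu_val).
have vDy : vge nu (p%:Z * p%:Z * (l - d%:Z)) (D y1) by rewrite vgeE // nDy.
apply: vge_le (vgeM nu_val (vge_iota E_gt0 nuE (vth i)) (vgeM nu_val (vyX i.-1) vDy)).
have {}lti : (i.-1 <= p.-2)%N by move: lti; clear; lia.
rewrite Ep; move: (i.-1) lti => i' lti.
have : 0 < p%:Z * d%:Z * (p%:Z * p%:Z - 2 * p%:Z - i'%:Z).
  by rewrite !mulr_gt0 //; move: lti p_gt2; clear; nia.
by clear; lia.
Qed.

Lemma D_monomial_wild j i n T : ~~ (p %| j)%N -> T = rho ^+ j * y1 ^+ i * iota (u Q ^ n) ->
  T != 0 -> nu T = 1 ->
  D T != 0 /\ nu (D T) = 1 + p%:Z * p%:Z * (dlog_ord Q - p%:Z * d%:Z) + d%:Z * M.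
Proof.
move=> pj eT T0 nT; have [y0 _] := y1_wild; have [r0 _] := rho_wild.
have [Dy0 nDy] := D_y1_wild; have [Dr0 nDr] := D_rho_wild.
have [jn0 njn] := nat_val charL nu_val pj.
rewrite {1 2}eT D_monomial // -eT.
have main0 : j%:R * (D rho / rho) != 0 by rewrite !mulf_neq0 ?invr_eq0.
have nmain : nu (j%:R * (D rho / rho)) = p%:Z * p%:Z * (dlog_ord Q - p%:Z * d%:Z) + d%:Z * M.
  by rewrite (valM nu_val) ?mulf_neq0 ?invr_eq0 // njn (val_div nu_val) // nDr nrho; ring.
have [|s0 ns] := val_addl nu_val main0 (b := i%:R * (D y1 / y1) + n%:~R * iota (lam Q)).
  rewrite nmain; apply: (vgeD nu_val).
    apply: (@vge_le _ _ (0 + (p%:Z * p%:Z * (dlog_ord Q - d%:Z) + p%:Z * d%:Z))).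
      have : 0 < d%:Z * (p%:Z * p%:Z * p%:Z - 2 * p%:Z * p%:Z + 2 * p%:Z - 1).
        by rewrite mulr_gt0 //; move: p_gt2; clear; nia.
      by rewrite /M; clear; lia.
    apply: (vgeM nu_val); first exact: (vge_nat nu_val).
    by rewrite vgeE ?mulf_neq0 ?invr_eq0 // (val_div nu_val) // nDy ny1; clear; lia.
  apply: vge_le (vgeM nu_val (vge_intr n) vge_Q_lam); rewrite Ep /M.
  have : 0 < d%:Z * (p%:Z * p%:Z * p%:Z - p%:Z * p%:Z + p%:Z - 1).
    by rewrite mulr_gt0 //; move: p_gt2; clear; nia.
  by clear; lia.
by split; [rewrite mulf_neq0 | rewrite (valM nu_val) // ns nmain nT; ring].
Qed.

(** In terms of b_i = p - 1 - a_i the claim becomes p^2 l + 1 <= c + p d b1 + d M b2, where l is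
    [dlog_ord Q] and c the order of x_P^n at Q. For P = Q, where c = -p^2 n, this is the inequality
    that defines W. *)
Lemma wild_form_bound P a1 a2 n : (P, a1, a2, n) \in W p X ->
  vge nu (1 + p%:Z * p%:Z * (dlog_ord Q - p%:Z * d%:Z) + d%:Z * M) (form a1 a2 P n).
Proof.
rewrite mem_W ?prime_gt0 // => /and4P[PB2 lt1 lt2 Wc].
have [y0 _] := y1_wild; have [r0 _] := rho_wild.
have vr : vge nu (- (d%:Z * M)) rho by rewrite vgeE // nrho.
have vy : vge nu (- (p%:Z * d%:Z)) y1 by rewrite vgeE // ny1.
apply: vge_le (vgeM nu_val (vgeM nu_val (vgeX nu_val a2 vr) (vgeX nu_val a1 vy)) (vge_form_at P n)).
rewrite Ep.
have [b1 e1] : exists b1 : nat, a1%:Z = p%:Z - 1 - b1%:Z by exists (p.-1 - a1)%N; move: lt1; clear; lia.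
have [b2 e2] : exists b2 : nat, a2%:Z = p%:Z - 1 - b2%:Z by exists (p.-1 - a2)%N; move: lt2; clear; lia.
have eb1 : (p.-1 - a1)%N = b1 by move: e1 lt1; clear; lia.
have eb2 : (p.-1 - a2)%N = b2 by move: e2 lt2; clear; lia.
have eM : (p ^ 2 - p + 1)%N%:Z = M by rewrite /M -mulnn; move: p_gt1; clear; nia.
have cost : 0 <= p%:Z * d%:Z * b1%:Z + d%:Z * M * b2%:Z.
  by rewrite addr_ge0 ?mulr_ge0 // (le_trans _ (ltW M_gt)).
have top P' : (W_top p X P' a1 a2)%:Z = p%:Z * (d_ X P')%:Z * b1%:Z + (d_ X P')%:Z * M * b2%:Z.
  by rewrite /W_top eb1 eb2 PoszD !PoszM eM.
have goalE c (l : int) : p%:Z * p%:Z * (l + 1) - (p%:Z * d%:Z * b1%:Z + d%:Z * M * b2%:Z) + 1 - p%:Z * p%:Z <= c ->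
    1 + p%:Z * p%:Z * (l - p%:Z * d%:Z) + d%:Z * M <= - (d%:Z * M) * a2%:Z + - (p%:Z * d%:Z) * a1%:Z + c.
  by rewrite e1 e2 /M; clear; lia.
apply: goalE; move: Wc; rewrite /W_cond; case: (eqVneq P Q) => [->|PQ].
  rewrite QB1; have := top Q; rewrite -/d => <-; rewrite -!mulnn.
  case: (Q) => [c|] /=; last by clear; lia.
  have : 0 < p%:Z * p%:Z by rewrite mulr_gt0.
  by move=> pp /andP[_]; move: pp; clear; lia.
have pp : 0 < p%:Z * p%:Z by rewrite mulr_gt0.
case: (Q) PQ => [c _ _|] /=; first by rewrite mulr0 mul0r; move: cost pp; clear; lia.
case: P PB2 => // c PB2 _ Wc.
have n_gt0 : (0 < n)%N by move: Wc; case: ifP => _ /andP[].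
(* At infinity x_P^n has order p^2 n with n > 0, so one more unit is needed. If a1 = a2 = p - 1, the
   bounds of W at a finite pole read p^2 n <= p^2 - 1 or p n <= p - 1, which no n > 0 satisfies. *)
have b_gt0 : (0 < b1 + b2)%N.
  rewrite lt0n addn_eq0; apply/negP => /andP[/eqP z1 /eqP z2]; move: Wc.
  case: ifP => _ /andP[_].
    by have := top (Some c); rewrite z1 z2 !mulr0 addr0 => -[->]; rewrite -mulnn; move: n_gt0 p_gt1; clear; nia.
  by rewrite eb2 z2 muln0; move: n_gt0 p_gt1; clear; nia.
have cost_gt0 : 0 < p%:Z * d%:Z * b1%:Z + d%:Z * M * b2%:Z.
  case: (posnP b1) b_gt0 => [-> |b1_gt0 _].
    by rewrite mulr0 add0r add0n => b2_gt0; rewrite !mulr_gt0 // (lt_trans p_pos).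
  by rewrite ltr_pwDl ?mulr_ge0 ?mulr_gt0 // ltW // (lt_trans p_pos).
have : 0 <= p%:Z * p%:Z * (n%:Z - 1) by rewrite mulr_ge0 ?(ltW pp) //; move: n_gt0; clear; lia.
by move: cost_gt0; clear; lia.
Qed.
End Derivatives.

Lemma regular_wild m : m \in W p X -> regular_form (form m.1.1.2 m.1.2 m.1.1.1 m.2).
Proof.
case: m => [[[P a1] a2] n'] /= mW; have [y0 _] := y1_wild; have [r0 _] := rho_wild.
have [j [i [n [Ep pj nT]]]] := wild_monomial; have [u0 _] := pt_unif pts Q.
have T0 : rho ^+ j * y1 ^+ i * iota (u Q ^ n) != 0.
  by rewrite !mulf_neq0 ?expf_neq0 ?fmorph_eq0 ?expfz_neq0.
have [DT0 nDT] := D_monomial_wild Ep pj (erefl _) T0 nT.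
by apply: (regular_of T0) => //; rewrite nDT; apply: wild_form_bound.
Qed.
End WildBase.

End PlaceOver.

(* A place trivial on F would be trivial on L, which is integral over F. *)
Lemma place_center (nu : L -> int) t : is_val nu ->
    (forall c, c != 0 -> nu (iota (cst c)) = 0) -> t != 0 -> nu t = 1 ->
  exists Q E, 0 < E /\ forall a, a != 0 -> nu (iota a) = E * v Q a.
Proof.
move=> nu_val nuC t0 nt.
have w_val : is_val (fun a => nu (iota a)).
  split=> a b a0 b0; first by rewrite rmorphM (valM nu_val) ?fmorph_eq0.
  by move=> s0; rewrite rmorphD (valD nu_val) ?fmorph_eq0 // -rmorphD fmorph_eq0.
have [triv|//] := pt_center pts w_val nuC.
have vi a : vge nu 0 (iota a).
  by case: (eqVneq a 0) => [->|a0]; [rewrite rmorph0 vge0 | rewrite vgeE ?fmorph_eq0 // triv].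
have v1 : vge nu 0 y1 by apply: (as_vge_ge0 nu_val p_gt1); rewrite y1E.
have v2 : vge nu 0 y2.
  apply: (as_vge_ge0 nu_val p_gt1); rewrite y2E.
  by apply: (vgeD nu_val) => //; apply: vge_witt_g.
have vX n z : vge nu 0 z -> vge nu 0 (z ^+ n) by move/(vgeX nu_val n); rewrite mul0r.
(* Everything in L would be a sum of products of elements of nonnegative order, yet 1/t has order
   -1. *)
have [B _ eB] := span 0 t^-1; have : vge nu 0 t^-1.
  rewrite eB; apply: (vge_sum nu_val) => j _; rewrite rmorph0 horner0 subr0 -[0]addr0.
  apply: (vgeM nu_val); first exact: vX.
  rewrite horner_coef; apply: (vge_sum nu_val) => i _; rewrite -[0]addr0 coef_map.
  by apply: (vgeM nu_val); [apply: vi | apply: vX].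
by rewrite vgeE ?invr_eq0 // (valV nu_val) // nt.
Qed.

Lemma basis_regular (nu : L -> int) t m : is_val nu ->
    (forall c, c != 0 -> nu (iota (cst c)) = 0) -> t != 0 -> nu t = 1 -> m \in W p X ->
  regular_form nu (rho ^+ m.1.2 * y1 ^+ m.1.1.2 * iota ((u m.1.1.1)^-1 ^+ m.2)).
Proof.
move=> nu_val nuC t0 nt mW; have [Q [E [E_gt0 nuE]]] := place_center nu_val nuC t0 nt.
case: (boolP (Q \in B1 X)) => QB1; first exact: (regular_wild nu_val E_gt0 nuE t0 nt QB1).
case: (boolP (Q \in B2 X)) => QB2; first exact: (regular_tame nu_val E_gt0 nuE t0 nt QB1).
exact: (regular_unramified nu_val E_gt0 nuE t0 nt QB1).
Qed.

End Places.

(** * Pole orders from partial fractions *)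

Section PolarSums.
Variables (p : nat) (k : closedFieldType) (F : fieldType).
Variables (cst : {rmorphism k -> F}) (u : option k -> F) (v : option k -> F -> int).
Hypothesis pts : function_field_points p cst u v.

Definition polar_sum (B : seq (option k)) (q : option k -> {poly k}) : F :=
  \sum_(P <- B) (map_poly cst (q P)).[(u P)^-1].

Lemma polar_other (r : {poly k}) P Q : P <> Q -> vge (v Q) 0 (map_poly cst r).[(u P)^-1].
Proof.
move=> neq; have val := pt_val pts Q; rewrite horner_coef; apply: (vge_sum val) => i _.
rewrite coef_map -[0]addr0; apply: (vgeM val); first exact: (vge_cst pts).
have v0 : vge (v Q) 0 (u P)^-1 by apply: vge_le (pt_other pts neq); case: (Q).
by have := vgeX val i v0; rewrite mul0r.
Qed.

Lemma polar_own (r : {poly k}) P : vge (v P) (- (size r).-1%:Z) (map_poly cst r).[(u P)^-1].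
Proof.
have val := pt_val pts P; have [u0 vu] := pt_unif pts P.
rewrite horner_coef size_map_poly; apply: (vge_sum val) => i _; rewrite coef_map.
apply: (@vge_le _ _ (0 + -1 * i%:Z)); first by have := ltn_ord i; move: (size r) (nat_of_ord i) => a b; lia.
apply: (vgeM val); first exact: (vge_cst pts).
by apply: (vgeX val); rewrite vgeE ?invr_eq0 // (valV val) // vu.
Qed.

Lemma polar_own_exact (r : {poly k}) P : (0 < (size r).-1)%N ->
  (map_poly cst r).[(u P)^-1] != 0 /\ v P (map_poly cst r).[(u P)^-1] = - (size r).-1%:Z.
Proof.
move=> r_gt0; have val := pt_val pts P; have [u0 vu] := pt_unif pts P.
have r0 : r != 0 by apply: contraTneq r_gt0 => ->; rewrite size_poly0.
have l0 : lead_coef r != 0 by rewrite lead_coef_eq0.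
have iu0 : (u P)^-1 != 0 by rewrite invr_eq0.
have vx : vge (v P) (-1) (u P)^-1 by rewrite vgeE // (valV val) // vu.
have z0 : cst (lead_coef r) * (u P)^-1 ^+ (size r).-1 != 0.
  by rewrite mulf_neq0 ?expf_neq0 // fmorph_eq0.
have vz : v P (cst (lead_coef r) * (u P)^-1 ^+ (size r).-1) = - (size r).-1%:Z.
  rewrite (valM val) ?expf_neq0 ?fmorph_eq0 // (pt_const pts) // add0r (valX val) //.
  by rewrite (valV val) // vu mulN1r.
rewrite (@horner_coef_wide _ (size r).-1.+1) ?size_map_poly ?leqSpred //.
rewrite big_ord_recr /= coef_map addrC -lead_coefE -vz; apply: (val_addl val) => //; rewrite vz.
apply: (vge_sum val) => i _; rewrite coef_map.
apply: (@vge_le _ _ (0 + -1 * i%:Z)); first by have := ltn_ord i; move: (_.-1) (nat_of_ord i) => a b; lia.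
by apply: (vgeM val); [apply: (vge_cst pts) | apply: (vgeX val)].
Qed.

Lemma polar_sum_regular B (q : option k -> {poly k}) Q : Q \notin B -> vge (v Q) 0 (polar_sum B q).
Proof.
move=> QB; rewrite /polar_sum big_seq; apply: (vge_sum (pt_val pts Q)) => P PB.
by apply: polar_other => eq; rewrite -eq PB in QB.
Qed.

Lemma polar_sum_rem B (q : option k -> {poly k}) Q : uniq B -> Q \in B -> exists2 r, vge (v Q) 0 r &
  polar_sum B q = (map_poly cst (q Q)).[(u Q)^-1] + r.
Proof.
move=> uB QB; exists (\sum_(P <- rem Q B) (map_poly cst (q P)).[(u P)^-1]).
  rewrite big_seq; apply: (vge_sum (pt_val pts Q)) => P; rewrite mem_rem_uniq // inE.
  by move=> /andP[/eqP neq _]; apply: polar_other.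
by rewrite /polar_sum (big_rem Q).
Qed.

Lemma polar_sum_bound B (q : option k -> {poly k}) Q : uniq B -> Q \in B ->
  vge (v Q) (- (size (q Q)).-1%:Z) (polar_sum B q).
Proof.
move=> uB /(polar_sum_rem q uB)[r vr ->]; apply: (vgeD (pt_val pts Q)); first exact: polar_own.
by apply: vge_le vr; clear; lia.
Qed.

Lemma polar_sum_exact B (q : option k -> {poly k}) Q : uniq B -> Q \in B -> (0 < (size (q Q)).-1)%N ->
  polar_sum B q != 0 /\ v Q (polar_sum B q) = - (size (q Q)).-1%:Z.
Proof.
move=> uB /(polar_sum_rem q uB)[r vr ->] q_gt0; have [z0 vz] := polar_own_exact Q q_gt0.
by rewrite -vz; apply: (val_addl (pt_val pts Q)) => //; apply: vge_le vr; rewrite vz; move: q_gt0; clear; lia.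
Qed.

End PolarSums.

(** * The rank bound *)

Section CartierRank.
Variables (p : nat) (k : closedFieldType) (X : witt_data k) (F : fieldType) (L : fieldExtType F).
Variables (cst : {rmorphism k -> F}) (u : option k -> F) (v : option k -> F -> int).
Variables (D C : L -> L) (y1 y2 : L).
Hypotheses (k_char : p \in [pchar k]) (p_gt2 : (2 < p)%N) (X_norm : normalized_data p X).
Hypothesis pts : function_field_points p cst u v.
Local Notation iota := (in_alg L).
Hypothesis DD : forall a b, D (a + b) = D a + D b.
Hypothesis DM : forall a b, D (a * b) = D a * b + a * D b.
Hypothesis DC : forall c, D (iota (cst c)) = 0.
Hypothesis D_iota : forall a, exists b, D (iota a) = iota b /\
  forall P n, vge (v P) n a -> vge (v P) (n + dlog_ord P) b.
Hypothesis D_unif : forall P, exists l, [/\ l != 0, v P l = dlog_ord P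
  & D (iota (u P)) = iota (l * u P)].
Hypothesis CD : forall a b, C (a + b) = C a + C b.
Hypothesis CM : forall a b, C (a ^+ p * b) = a * C b.
Hypothesis C_exact : forall a, C (D a) = 0.
Hypothesis C_log : forall a, C (a ^+ p.-1 * D a) = D a.
Local Notation f := (polar_sum cst u (B1 X) (f_part X)).
Local Notation h := (polar_sum cst u (B2 X) (h_part X)).
Hypotheses (y1E : y1 ^+ p - y1 = f%:A) (y2E : y2 ^+ p - y2 = witt_g p y1 + h%:A).
Hypothesis gen : (<<<<1; y1>>; y2>> = fullv)%VS.

Let p_prime : prime p := pcharf_prime k_char.
Let p_gt1 : (1 < p)%N := prime_gt1 p_prime.
Let charF : p \in [pchar F]. Proof. by rewrite (fmorph_pchar cst). Qed.

Let poleB P : P \in B2 X -> (0 < pole X P)%N /\ (pole X P < p)%N.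
Proof.
move=> PB; split; last exact: (pole_lt p_prime p_gt2 X_norm).
by have [] := pole_gt0 p_prime p_gt2 X_norm PB.
Qed.

Let f_B1 P : P \in B1 X -> f != 0 /\ v P f = - (d_ X P)%:Z.
Proof.
move=> PB; apply: (polar_sum_exact pts) => //; first exact: (nd_uniq1 X_norm).
by have [] := poleB (nd_sub X_norm PB); rewrite /pole PB.
Qed.

Let f_reg P : P \notin B1 X -> vge (v P) 0 f.
Proof. exact: (polar_sum_regular pts). Qed.

Let h_B1 P : P \in B1 X -> vge (v P) (- (e_ X P)%:Z) h.
Proof.
by move=> PB; apply: (polar_sum_bound pts); [apply: (nd_uniq2 X_norm) | apply: (nd_sub X_norm)].
Qed.

Let h_B2 P : P \in B2 X -> P \notin B1 X -> h != 0 /\ v P h = - (e_ X P)%:Z.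
Proof.
move=> PB PB1; apply: (polar_sum_exact pts) => //; first exact: (nd_uniq2 X_norm).
by have [] := poleB PB; rewrite /pole (negPf PB1).
Qed.

Let h_reg P : P \notin B2 X -> vge (v P) 0 h.
Proof. exact: (polar_sum_regular pts). Qed.

(** A section of [key_term] over its image K: one differential is kept for each key term. *)
Lemma key_preimages : exists s, [/\ uniq s, {subset s <= H p X},
  {in s &, injective (key_term p X)} & size s = size (K p X)].
Proof.
pose m0 : monomial k := (None, 0%N, 0%N, 0%N).
pose g x := nth m0 (H p X) (index x (map (key_term p X) (H p X))).
have gP x : x \in K p X -> g x \in H p X /\ key_term p X (g x) = x.
  rewrite mem_undup => xH; have lt : (index x (map (key_term p X) (H p X)) < size (H p X))%N.
    by rewrite -(size_map (key_term p X)) index_mem.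
  by split; [rewrite mem_nth | rewrite -(nth_map m0 x) // nth_index].
exists (map g (K p X)); split.
- rewrite map_inj_in_uniq ?undup_uniq // => x y /gP[_ ex] /gP[_ ey] eg.
  by rewrite -ex -ey eg.
- by move=> m /mapP[x /gP[gH _] ->].
- by move=> m n /mapP[x /gP[_ ex] ->] /mapP[y /gP[_ ey] ->]; rewrite ex ey => ->.
by rewrite size_map.
Qed.

Lemma cartier_rank_forms : exists w : 'I_(size (K p X)) -> L,
  (forall i nu t, is_val nu -> (forall c, c != 0 -> nu (iota (cst c)) = 0) ->
     t != 0 -> nu t = 1 -> regular_form D nu (w i)) /\
  (forall a : 'I_(size (K p X)) -> k,
     \sum_i iota (cst (a i)) * C (w i) = 0 -> forall i, a i = 0).
Proof.
have ex_lam P : exists l, [&& l != 0, v P l == dlog_ord P & D (iota (u P)) == iota (l * u P)].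
  by have [l [l0 vl ->]] := D_unif P; exists l; rewrite l0 vl !eqxx.
pose lam P := xchoose (ex_lam P).
have lamP P : [/\ lam P != 0, v P (lam P) = dlog_ord P & D (iota (u P)) = iota (lam P * u P)].
  by have /and3P[l0 /eqP vl /eqP Dl] := xchooseP (ex_lam P).
have [cF [C_iota cF_bound cF_exact]] := cartier_restrict k_char pts DM DC CD CM C_exact C_log lamP.
have [theta [th_size th_B1 th_reg th_frob]] :=
  pole_reduction k_char p_gt2 pts f_B1 (nd_fdeg X_norm) h_B1 (nd_min X_norm).
(* The pole of f at infinity, of order prime to p, ensures that the y2^j y1^i with i, j < p form a
   basis of L over k(x). *)
have inf := nd_infty X_norm; have [d_gt0 d_lt] := poleB (nd_sub X_norm inf).
rewrite /pole inf in d_gt0 d_lt.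
have ndvd : ~~ (p %| d_ X None)%N by rewrite gtnNdvd.
have [f0 vf] := f_B1 inf.
have span := tower_span charF p_gt2 y1E y2E gen (pt_val pts None) f0 vf d_gt0 ndvd.
have free := tower_free charF p_gt2 y1E y2E (pt_val pts None) f0 vf d_gt0 ndvd.
have rest_B1 P : P \in B1 X -> wt (v P) (d_ X P) (p%:Z * (d_ X P)%:Z - 1) (witt_rest f h theta).
  move=> PB; have val := pt_val pts P; have [fP0 vfP] := f_B1 PB.
  apply: (wtD val).
    apply: wtC; apply: vge_le (h_B1 PB).
    by have : (e_ X P < p * d_ X P)%N := nd_min X_norm PB; clear; lia.
  apply: (wt_comp_sub val); first by rewrite vgeE // vfP.
  (* The bound on theta is known for p v and is needed for v. As i < p, the number d i - (p d - 1)
     is at most 0, so multiplying it by p only lowers it. *)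
  move=> i; case: (eqVneq theta`_i 0) => [->|t0]; first exact: vge0.
  have lti : (i < p)%N.
    by apply: leq_trans th_size; rewrite ltnNge; apply: contra t0 => /(nth_default 0)->.
  have := th_B1 P PB i; rewrite !vgeE // => le; rewrite -(ler_pM2l (_ : 0 < p%:Z)); last first.
    by rewrite ltz_nat prime_gt0.
  apply: le_trans le; have : 0 <= (p%:Z - 1) * ((d_ X P)%:Z * (p%:Z - i%:Z) - 1).
    have [dP _] := poleB (nd_sub X_norm PB); rewrite /pole PB in dP.
    by rewrite mulr_ge0 //; move: p_gt1 dP lti; clear; nia.
  by clear; lia.
have [s [us sH injs sz]] := key_preimages.
pose m0 : monomial k := (None, 0%N, 0%N, 0%N).
pose omega (m : monomial k) : L := (y2 - (map_poly iota theta).[y1]) ^+ m.1.2 * y1 ^+ m.1.1.2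
  * iota ((u m.1.1.1)^-1 ^+ m.2).
exists (fun i => omega (nth m0 s i)); split=> [i nu t nu_val nuC t0 nt|a sum0 i].
  have mW : nth m0 s i \in W p X.
    have := sH (nth m0 s i); rewrite mem_nth ?sz // => /(_ isT).
    by rewrite mem_filter => /andP[].
  exact: (basis_regular k_char p_gt2 X_norm pts DD DM DC D_iota lamP y1E y2E span f_B1 f_reg h_B1 h_B2 h_reg th_size th_B1 th_reg th_frob nu_val nuC t0 nt mW).
pose c m := if insub (index m s) is Some j then a j else 0.
have cE (j : 'I_(size (K p X))) : c (nth m0 s j) = a j.
  by rewrite /c index_uniq ?sz // valK.
rewrite -cE; apply: (key_indep charF p_gt2 X_norm pts (lam := lam) (v := v) (c := c) _ _ cF_bound cF_exact
  f_B1 f_reg h_B2 rest_B1 th_reg us sH injs); last by rewrite mem_nth ?sz.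
- by move=> P; have [] := lamP P.
- exact: (cFD CD C_iota).
apply: (free (fun j => \sum_(m <- s) cst (c m) *: cc_of p u cF f h theta m j)) => [j|].
  apply: leq_trans (size_sum _ _ _) _; apply/bigmax_leqP_seq => m _ _.
  by apply: leq_trans (size_scale_leq _ _) _; apply: size_mod_asP.
have term m : m \in s -> iota (cst (c m)) * C (omega m) =
    \sum_(j < p) y2 ^+ j * (map_poly iota (cst (c m) *: cc_of p u cF f h theta m j)).[y1].
  move=> /sH/(HP p_prime p_gt2 X_norm) Hm.
  rewrite /omega (cartier_expansion charF p_gt2 CD CM C_iota theta y1E y2E _ _ (Hs_a2 Hm)).
  rewrite mulr_sumr; apply: eq_bigr => j _.
  by rewrite /cc_of map_polyZ hornerZ mulrCA.
have : \sum_(m <- s) iota (cst (c m)) * C (omega m) = 0.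
  rewrite (big_nth m0) sz big_mkord -[RHS]sum0; apply: eq_bigr => j _.
  by rewrite cE.
rewrite big_seq (eq_bigr _ term) -big_seq exchange_big /= => e.
rewrite -[RHS]e; apply: eq_bigr => j _.
by rewrite -mulr_sumr raddf_sum -horner_sum.
Qed.

End CartierRank.

Lemma partial_fractions_polar_sum (k : closedFieldType) (B : seq (option k)) q :
  partial_fractions B q = polar_sum (@constF k) (@unif k) B q.
Proof.
apply: eq_bigr => P _; rewrite unif.unlock invrK //.
Qed.

Theorem theorem3p18 (p : nat) (k : closedFieldType)
    (p_prime : prime p) (p_gt2 : (2 < p)%N) (k_char : p \in [pchar k])
    (X : witt_data k) (X_norm : normalized_data p X)
    (L : fieldExtType {fraction {poly k}}) (y1 y2 : L)
    (L_ff : function_field p X y1 y2)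
    (D : L -> L) (D_ddx : is_ddx D)
    (C : L -> L) (C_cartier : is_cartier p D C)
    (key_neq0 : forall m', m' \in K p X ->
       exists m, [/\ m \in H p X, key_term p X m = m' &
         exists2 c, W_coef p X y1 y2 (C (basis_form y1 y2 m)) (key_term p X m) c
                    & c != 0]) :
  cartier_rank_ge D C (size (K p X)).
Proof.
have [DD DM DC DX] := D_ddx; have [CD CM C_exact C_log] := C_cartier.
have [y1E y2E gen] := L_ff.
rewrite /f_of /h_of !partial_fractions_polar_sum in y1E y2E.
have pts := rational_function_points k (prime_gt0 p_prime).
have [w [reg indep]] := @cartier_rank_forms p k X _ L _ _ _ D C y1 y2 k_char p_gt2
  X_norm pts DD DM DC (ddx_frac (iota := in_alg L) DD DM DC DX) (ddx_unif (iota := in_alg L) DD DM DC DX)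
  CD CM C_exact C_log y1E y2E gen.
exists (fun i => C (w i)); split; last exact: indep.
move=> i; exists (w i) => // nu [nuM nuD nuC [t t0 nt]].
by apply: (reg i nu t) => //; split.
Qed.
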